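(* For $\phi\in\hat{\mathcal{A}}$ and $f\in\mathcal{A}$, we have $$\Delta_D\bigl(\Pi(\phi\otimes f)\bigr)=\Delta_D\bigl(\pi'(\lambda_\phi)\pi(L_f)\bigr)=\bigl[(\pi'\otimes\pi')(\hat{\Delta}\phi)\bigr]\bigl[(\pi\otimes\pi)(\Delta f)\bigr]=(\Pi\otimes\Pi)\Bigl(\sum\phi_{(1)}\otimes f_{(1)}\otimes\phi_{(2)}\otimes f_{(2)}\Bigr),$$ where $\hat{\Delta}\phi$ stands for $\hat{\Delta}(\lambda_\phi)$, $\Delta f$ for $\Delta(L_f)$, and the last expression is the preceding one in Sweedler notation.
   Context: Setting. Fix an integer $n\ge 1$ and $\lambda\in\mathbb{R}$. Let $\mathcal{H}=L^2(\mathbb{R}^{n}\times\mathbb{R}^n\times\mathbb{R})$, functions $\xi(x,y,r)$ with $x,y\in\mathbb{R}^n$, $r\in\mathbb{R}$. $\beta$ is the inner product on $\mathbb{R}^n$, $e(t)=e^{2\pi i t}$, $\bar{e}(t)=e^{-2\pi i t}$, $\eta_\lambda(r)=\frac{e^{2\lambda r}-1}{2\lambda}$ (and $\eta_0(r)=r$). Define the multiplicative unitary $U_A$ on $\mathcal{H}\otimes\mathcal{H}$ by $$U_A\xi(x,y,r;x',y',r')=(e^{-\lambda r'})^n\bar{e}[\eta_\lambda(r')\beta(e^{-\lambda r'}x,y'-e^{-\lambda r'}y)]\,\xi(e^{-\lambda r'}x,e^{-\lambda r'}y,r+r';x'-e^{-\lambda r'}x,y'-e^{-\lambda r'}y,r').$$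 $A=\overline{\{(\omega\otimes\mathrm{id})(U_A):\omega\in\mathcal{B}(\mathcal{H})_*\}}^{\|\cdot\|}$ with $\Delta(a)=U_A(a\otimes1)U_A^*$. Let $\hat{J}\xi(x,y,r)=(e^{\lambda r})^n\overline{\xi(e^{\lambda r}x,e^{\lambda r}y,-r)}$, $J\xi(x,y,r)=\bar{e}[\eta_\lambda(r)\beta(x,y)]\overline{\xi(-x,-y,r)}$, $j=\hat{J}J=J\hat{J}$, and $\Sigma$ the flip. Put $Y=\Sigma(j\otimes1)U_A(j\otimes1)\Sigma$, $X=\Sigma Y^*\Sigma$, $\widehat{\widehat{Y}}=(j\otimes j)Y(j\otimes j)$, $Z=Y^*\widehat{\widehat{Y}}=\widehat{\widehat{Y}}Y^*$. Let $\hat{A}^{\operatorname{op}}=\overline{\{(\mathrm{id}\otimes\omega)(X):\omega\in\mathcal{B}(\mathcal{H})_*\}}^{\|\cdot\|}$ with $\hat{\Delta}(b)=X^*(1\otimes b)X$; also $\Delta(a)=Y^*(1\otimes a)Y$. Leg numbering notation is used. $V_D=Z_{12}Y_{24}Z_{12}^*X_{13}$ on $\mathcal{H}^{\otimes 4}$; $A_D=\overline{\{(\mathrm{id}\otimes\mathrm{id}\otimes\Omega)(V_D):\Omega\in\mathcal{B}(\mathcal{H}\otimes\mathcal{H})_*\}}^{\|\cdot\|}$, with $\Delta_D(x)=V_D^*(1\otimes1\otimes x)V_D$. $\mathcal{A}=\hat{\mathcal{A}}$ is the space of Schwartz functions in $(x,y,r)$ with compact support in $r$; $(L_f\xi)(x,y,r)=\int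 f(\tilde{x},\tilde{y},r)\xi(x-\tilde{x},y-\tilde{y},r)\bar{e}[\eta_\lambda(r)\beta(\tilde{x},y-\tilde{y})]\,d\tilde{x}d\tilde{y}$ (an element of $A$), $(\lambda_\phi\xi)(x,y,r)=\int\phi(e^{\lambda\tilde{r}}x,e^{\lambda\tilde{r}}y,r-\tilde{r})\xi(x,y,\tilde{r})\,d\tilde{r}$ (an element of $\hat{A}^{\operatorname{op}}$). $\pi(a)=Z(1\otimes a)Z^*$ ($a\in A$), $\pi'(b)=b\otimes1$ ($b\in\hat{A}^{\operatorname{op}}$), $\Pi(\phi\otimes f)=\pi'(\lambda_\phi)\pi(L_f)$. Formally $\Delta f=\sum f_{(1)}\otimes f_{(2)}$ and $\hat{\Delta}\phi=\sum\phi_{(1)}\otimes\phi_{(2)}$. *)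

(* Defs.v *)
From HB Require Import structures.
From mathcomp Require Import all_boot all_order all_algebra.
From mathcomp Require Import all_classical all_reals all_analysis.
From mathcomp Require Import complex.

Set Implicit Arguments.
Unset Strict Implicit.
Unset Printing Implicit Defensive.

Import Order.TTheory GRing.Theory Num.Theory.
Import numFieldNormedType.Exports.

Local Open Scope classical_set_scope.
Local Open Scope ring_scope.

(* The library has no measurable structure on row vectors; we equip ['rV[R]_n]
   with the sigma-algebra generated by the coordinates, as the library does for
   [n.-tuple T]. *)
Definition rV_display : measure_display -> measure_display.
Proof. exact. Qed.

Section measurable_rV.
Context (R : realType) (n : nat).

Let coors : 'I_n -> 'rV[R]_n -> measurableTypeR R := fun i x => x ord0 i.

Let rV_set0 : g_sigma_preimage coors set0.
Proof. exact: sigma_algebra0. Qed.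

Let rV_setC A : g_sigma_preimage coors A -> g_sigma_preimage coors (~` A).
Proof. exact: sigma_algebraC. Qed.

Let rV_bigcup (F : _^nat) : (forall i, g_sigma_preimage coors (F i)) ->
  g_sigma_preimage coors (\bigcup_i (F i)).
Proof. exact: sigma_algebra_bigcup. Qed.

HB.instance Definition _ := @isMeasurable.Build
  (rV_display R.-ocitv.-measurable.-sigma) 'rV[R]_n
  (g_sigma_preimage coors) rV_set0 rV_setC rV_bigcup.

End measurable_rV.

(* [m1 \x m2] packaged with its sigma-finiteness: the library's instance for
   sigma-finite factors is shadowed by the one for subprobabilities. *)
Section product_measure.
Context d1 d2 (T1 : measurableType d1) (T2 : measurableType d2) (R : realType).
Context (m1 : {sigma_finite_measure set T1 -> \bar R}).
Context (m2 : {sigma_finite_measure set T2 -> \bar R}).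

Definition sprod : set (T1 * T2) -> \bar R := (m1 \x m2)%E.

HB.instance Definition _ := Measure.copy sprod (m1 \x m2)%E.

Let sprod_sigma_finite : sigma_finite setT sprod.
Proof.
have /sigma_finiteP[F [TF ndF Foo]] := sigma_finiteT m1.
have /sigma_finiteP[G [TG ndG Goo]] := sigma_finiteT m2.
exists (fun n => F n `*` G n).
  rewrite -setXTT TF TG predeqE => -[x y]; split.
    move=> [/= [n _ Fnx] [k _ Gky]]; exists (maxn n k) => //; split.
    - by move: x Fnx; exact/subsetPset/ndF/leq_maxl.
    - by move: y Gky; exact/subsetPset/ndG/leq_maxr.
  by move=> [n _ []/= ? ?]; split; exists n.
move=> k; have [? ?] := Foo k; have [? ?] := Goo k.
split; first exact: measurableX.
by rewrite /sprod product_measure1E// lte_mul_pinfty// ge0_fin_numE.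
Qed.

HB.instance Definition _ := Measure_isSigmaFinite.Build _ _ _ sprod
  sprod_sigma_finite.

End product_measure.

Section lebesgue_rV.
Context (R : realType).

Definition cons_rV n (p : measurableTypeR R * 'rV[R]_n) : 'rV[R]_n.+1 :=
  \row_i (if unlift ord0 i is Some j then p.2 ord0 j else p.1).

Definition uncons_rV n (v : 'rV[R]_n.+1) : measurableTypeR R * 'rV[R]_n :=
  (v ord0 ord0, \row_j v ord0 (lift ord0 j)).

Lemma uncons_rVK n : cancel (@uncons_rV n) (@cons_rV n).
Proof.
move=> v; apply/rowP => i; rewrite !mxE.
by case: unliftP => [j ->|->]; rewrite ?mxE.
Qed.

Lemma cons_rVK n : cancel (@cons_rV n) (@uncons_rV n).
Proof.
move=> [t v]; rewrite /uncons_rV !mxE unlift_none; congr (_, _).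
by apply/rowP => j; rewrite !mxE liftK.
Qed.

Lemma measurable_coor_rV n (i : 'I_n) :
  measurable_fun [set: 'rV[R]_n] (fun x => x ord0 i : measurableTypeR R).
Proof.
move=> _ Y mY; rewrite setTI; apply: sub_sigma_algebra => /=.
rewrite -bigcup_seq/=; exists i => /=; first by rewrite mem_index_enum.
by exists Y => //; rewrite setTI.
Qed.

Lemma measurable_fun_rV d (T : measurableType d) n (f : T -> 'rV[R]_n) :
  (forall i, measurable_fun [set: T] (fun t => f t ord0 i : measurableTypeR R)) ->
  measurable_fun [set: T] f.
Proof.
move=> mf _ Y; rewrite setTI => mY.
suff: (<<s \big[setU/set0]_(i < n) preimage_set_system [set: 'rV[R]_n]
        (fun x => x ord0 i : measurableTypeR R) measurable >>
        `<=` [set A | measurable (f @^-1` A)]) by apply.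
apply: smallest_sub.
  split => /=; first by rewrite preimage_set0.
    by move=> A mA; rewrite setTD preimage_setC; exact: measurableC.
  by move=> F mF; rewrite preimage_bigcup; exact: bigcupT_measurable.
rewrite -bigcup_seq; apply: bigcup_sub => i _ A [B mB <-] /=.
by rewrite setTI; have := mf i measurableT B mB; rewrite setTI.
Qed.

Lemma measurable_cons_rV n :
  measurable_fun [set: measurableTypeR R * 'rV[R]_n] (@cons_rV n).
Proof.
apply: measurable_fun_rV => i; case: (unliftP ord0 i) => [j ->|->].
  rewrite (_ : (fun _ => _) =
    (fun x : 'rV[R]_n => x ord0 j : measurableTypeR R) \o snd).
    by apply: measurableT_comp => //; exact: measurable_coor_rV.
  by apply/funext => p /=; rewrite mxE liftK.
rewrite (_ : (fun _ => _) = fst) //.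
by apply/funext => p /=; rewrite mxE unlift_none.
Qed.

Lemma measurable_uncons_rV n : measurable_fun setT (@uncons_rV n).
Proof.
apply/measurable_fun_pairP; split; first exact: measurable_coor_rV.
apply: measurable_fun_rV => j.
rewrite (_ : (fun _ => _) =
  (fun x : 'rV[R]_n.+1 => x ord0 (lift ord0 j) : measurableTypeR R)).
  exact: measurable_coor_rV.
by apply/funext => p /=; rewrite mxE.
Qed.

Section cons_measure.
Context n (mu : {sigma_finite_measure set 'rV[R]_n -> \bar R}).

Definition cons_measure : set 'rV[R]_n.+1 -> \bar R :=
  pushforward (sprod (@lebesgue_measure R) mu) (@cons_rV n).

Let preimage_cons_rV A :
  measurable A -> measurable (@cons_rV n @^-1` A).
Proof. by rewrite -[X in _ -> measurable X]setTI; exact: measurable_cons_rV. Qed.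

Let cons_measure0 : cons_measure set0 = 0%E.
Proof. by rewrite /cons_measure /pushforward preimage_set0 measure0. Qed.

Let cons_measure_ge0 A : (0 <= cons_measure A)%E.
Proof. by rewrite /cons_measure /pushforward measure_ge0. Qed.

Let cons_measure_sigma_additive : semi_sigma_additive cons_measure.
Proof.
move=> F mF tF mUF; rewrite /cons_measure /pushforward preimage_bigcup.
apply: measure_semi_sigma_additive.
- by move=> k; exact: preimage_cons_rV.
- apply/trivIsetP => /= i j _ _ ij; rewrite -preimage_setI.
  by move/trivIsetP : tF => /(_ _ _ _ _ ij) ->//; rewrite preimage_set0.
- by rewrite -preimage_bigcup; exact: preimage_cons_rV.
Qed.

HB.instance Definition _ := isMeasure.Build _ _ _ cons_measure
  cons_measure0 cons_measure_ge0 cons_measure_sigma_additive.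

Let cons_measure_sigma_finite : sigma_finite setT cons_measure.
Proof.
have [F TF Foo] := sigma_finiteT (sprod (@lebesgue_measure R) mu).
exists (fun k => @uncons_rV n @^-1` F k).
  by rewrite -preimage_bigcup -TF preimage_setT.
move=> k; have [mFk Fkoo] := Foo k; split.
  by rewrite -[X in measurable X]setTI; exact: measurable_uncons_rV.
rewrite /cons_measure /pushforward -comp_preimage.
rewrite (_ : _ @^-1` _ = F k) //.
by rewrite /preimage; apply/seteqP; split => p /=; rewrite cons_rVK.
Qed.

HB.instance Definition _ := Measure_isSigmaFinite.Build _ _ _ cons_measure
  cons_measure_sigma_finite.

End cons_measure.

(* Lebesgue measure on R^n: the iterated product of [lebesgue_measure]. *)
Fixpoint lebesgue_rV n : {sigma_finite_measure set 'rV[R]_n -> \bar R} :=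
  match n with
  | 0 => @dirac _ 'rV[R]_0 0 R
  | m.+1 => cons_measure (lebesgue_rV m)
  end.

End lebesgue_rV.

(* Vectors of L^2(mu) are represented by square-integrable functions
   [T -> R[i]], identified when equal almost everywhere; operators are
   functions on such functions, only their action on L^2(mu) being relevant. *)
Section L2.
Context (R : realType) d (T : measurableType d).
Context (mu : {sigma_finite_measure set T -> \bar R}).

Definition cfun := T -> R[i].
Definition op := cfun -> cfun.
Implicit Types (f g : cfun) (A B : op).

Definition L2 f : Prop :=
  ((fun x => complex.Re (f x)) \in Lfun mu 2%:E) /\
  ((fun x => complex.Im (f x)) \in Lfun mu 2%:E).

Definition cint f : R[i] :=
  Complex (\int[mu]_x complex.Re (f x)) (\int[mu]_x complex.Im (f x)).

Definition inner f g : R[i] := cint (fun x => f x * (g x)^*).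

Definition norm2 f : R := Num.sqrt (complex.Re (inner f f)).

Definition ae_equal f g := f = g %[ae mu].

Definition bounded_op A :=
  [/\ forall f, L2 f -> L2 (A f),
      forall (a : R[i]) f g, L2 f -> L2 g ->
        ae_equal (A (fun x => a * f x + g x)) (fun x => a * A f x + A g x)
    & exists C : R, forall f, L2 f -> norm2 (A f) <= C * norm2 f].

(* equality in B(L^2(mu)) *)
Definition op_eq A B := forall f, L2 f -> ae_equal (A f) (B f).

Definition is_adjoint A B :=
  bounded_op B /\
  forall f g, L2 f -> L2 g -> inner (A f) g = inner f (B g).

(* The adjoint of a bounded operator is unique up to [op_eq]. *)
Definition adj A : op := xget (fun _ => cst 0) [set B | is_adjoint A B].

Definition wot_cvg (Ak : nat -> op) A :=
  forall f g, L2 f -> L2 g ->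
    (fun k => complex.Re (inner (Ak k f) g)) @ \oo --> complex.Re (inner (A f) g) /\
    (fun k => complex.Im (inner (Ak k f) g)) @ \oo --> complex.Im (inner (A f) g).

Definition op_bounded_by (C : R) A :=
  bounded_op A /\ forall f, L2 f -> norm2 (A f) <= C * norm2 f.

End L2.

(* L^2(mu) (x) L^2(nu) is L^2(mu \x nu), with (f (x) g)(x, y) = f x * g y. *)
Section tensor.
Context (R : realType) d1 d2 (T1 : measurableType d1) (T2 : measurableType d2).
Context (mu : {sigma_finite_measure set T1 -> \bar R}).
Context (nu : {sigma_finite_measure set T2 -> \bar R}).

Definition ftens (f : cfun R T1) (g : cfun R T2) : cfun R (T1 * T2)%type :=
  fun p => f p.1 * g p.2.

Definition is_tens (A : op R T1) (B : op R T2) (W : op R (T1 * T2)%type) :=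
  bounded_op (sprod mu nu) W /\
  forall f g, L2 mu f -> L2 nu g ->
    ae_equal (sprod mu nu) (W (ftens f g)) (ftens (A f) (B g)).

(* For bounded A and B, A (x) B is unique up to [op_eq]. *)
Definition tens (A : op R T1) (B : op R T2) : op R (T1 * T2)%type :=
  xget (fun _ => cst 0) [set W | is_tens A B W].

End tensor.
Arguments tens {R d1 d2 T1 T2} mu nu A B.

(* For rho_i : B(L^2(mu_i)) -> B(L^2(nu_i)), the map rho_1 (x) rho_2 on the whole
   of B(L^2(mu_1) (x) L^2(mu_2)): the normal *-homomorphism Phi with
   Phi (a (x) b) = rho_1 a (x) rho_2 b.  On the multipliers of the tensor
   product of two C*-algebras of operators it is the usual (strictly
   continuous) extension.  The spaces being separable, normality amounts to weak
   continuity along norm-bounded sequences. *)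
Section tensor_hom.
Context (R : realType) (d1 d2 e1 e2 : measure_display).
Context (S1 : measurableType d1) (S2 : measurableType d2).
Context (T1 : measurableType e1) (T2 : measurableType e2).
Context (mu1 : {sigma_finite_measure set S1 -> \bar R}).
Context (mu2 : {sigma_finite_measure set S2 -> \bar R}).
Context (nu1 : {sigma_finite_measure set T1 -> \bar R}).
Context (nu2 : {sigma_finite_measure set T2 -> \bar R}).

Let mu := sprod mu1 mu2.
Let nu := sprod nu1 nu2.

Definition normal_star_hom (Phi : op R (S1 * S2)%type -> op R (T1 * T2)%type) :=
  [/\ forall A, bounded_op mu A -> bounded_op nu (Phi A),
      forall A B, bounded_op mu A -> bounded_op mu B ->
        op_eq mu A B -> op_eq nu (Phi A) (Phi B),
      forall (a : R[i]) A B, bounded_op mu A -> bounded_op mu B ->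
        op_eq nu (Phi (fun f p => a * A f p + B f p))
                 (fun f p => a * Phi A f p + Phi B f p)
    & [/\ forall A B, bounded_op mu A -> bounded_op mu B ->
            op_eq nu (Phi (A \o B)) (Phi A \o Phi B),
          forall A B, bounded_op mu A -> is_adjoint mu A B ->
            is_adjoint nu (Phi A) (Phi B)
        & forall (Ak : nat -> op R (S1 * S2)%type) A (C : R),
            (forall k, op_bounded_by mu C (Ak k)) -> bounded_op mu A ->
            wot_cvg mu Ak A -> wot_cvg nu (fun k => Phi (Ak k)) (Phi A)]].

Definition is_tens_hom (rho1 : op R S1 -> op R T1) (rho2 : op R S2 -> op R T2)
    (Phi : op R (S1 * S2)%type -> op R (T1 * T2)%type) :=
  normal_star_hom Phi /\
  forall a b, bounded_op mu1 a -> bounded_op mu2 b ->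
    op_eq nu (Phi (tens mu1 mu2 a b)) (tens nu1 nu2 (rho1 a) (rho2 b)).

Definition tens_hom (rho1 : op R S1 -> op R T1) (rho2 : op R S2 -> op R T2) :
    op R (S1 * S2)%type -> op R (T1 * T2)%type :=
  xget (fun _ _ => cst 0) [set Phi | is_tens_hom rho1 rho2 Phi].

End tensor_hom.
Arguments tens_hom {R d1 d2 e1 e2 S1 S2 T1 T2} mu1 mu2 nu1 nu2 rho1 rho2.

(* C^infinity functions all of whose iterated directional derivatives decay
   faster than any power of the norm. *)
Section schwartz.
Context (R : realType) (V : normedModType R).

Definition iter_derive (f : V -> R) (s : seq V) : V -> R :=
  foldr (fun v g => 'D_v g) f s.

Definition schwartz (f : V -> R) :=
  forall s : seq V,
    (forall p, differentiable (iter_derive f s) p) /\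
    forall k : nat, exists C : R,
      forall p, `|p| ^+ k * `|iter_derive f s p| <= C.

End schwartz.

Section quantum_double.
Context (R : realType) (n : nat) (l : R).

Local Notation Rn := 'rV[R]_n.
Local Notation pt := (Rn * Rn * measurableTypeR R)%type.

(* The measures on the underlying spaces of H, H (x) H and the fourth tensor
   power of H, the latter read as (H (x) H) (x) (H (x) H). *)
Definition mu1 := sprod (sprod (lebesgue_rV R n) (lebesgue_rV R n))
  (@lebesgue_measure R).
Definition mu2 := sprod mu1 mu1.
Definition mu4 := sprod mu2 mu2.

Local Notation op1 := (op R pt).
Local Notation op2 := (op R (pt * pt)%type).
Local Notation op4 := (op R ((pt * pt) * (pt * pt))%type).

Definition beta (x y : Rn) : R := \sum_i x ord0 i * y ord0 i.

Definition ephase (t : R) : R[i] := Complex (cos (2 * pi * t)) (sin (2 * pi * t)).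
Definition ebar (t : R) : R[i] := ephase (- t).

Definition eta (r : R) : R :=
  if l == 0 then r else (expR (2 * l * r) - 1) / (2 * l).

Definition UA : op2 := fun xi '((x, y, r), (x', y', r')) =>
  let c := expR (- l * r') in
  (c ^+ n)%:C%C * ebar (eta r' * beta (c *: x) (y' - c *: y)) *
  xi ((c *: x, c *: y, r + r'), (x' - c *: x, y' - c *: y, r')).

Definition Jhatop : op1 := fun xi '(x, y, r) =>
  let c := expR (l * r) in
  (c ^+ n)%:C%C * (xi (c *: x, c *: y, - r))^*.

Definition Jop : op1 := fun xi '(x, y, r) =>
  ebar (eta r * beta x y) * (xi (- x, - y, r))^*.

Definition jop : op1 := Jhatop \o Jop.

Definition flip : op2 := fun xi '(p, q) => xi (q, p).

Definition Yop : op2 :=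
  flip \o tens mu1 mu1 jop id \o UA \o tens mu1 mu1 jop id \o flip.
Definition Xop : op2 := flip \o adj mu2 Yop \o flip.
Definition Yhhop : op2 := tens mu1 mu1 jop jop \o Yop \o tens mu1 mu1 jop jop.
Definition Zop : op2 := adj mu2 Yop \o Yhhop.

Definition Delta (a : op1) : op2 := UA \o tens mu1 mu1 a id \o adj mu2 UA.
Definition Deltahat (b : op1) : op2 := adj mu2 Xop \o tens mu1 mu1 id b \o Xop.

Definition flip23 : op4 := fun xi '((p1, p2), (p3, p4)) =>
  xi ((p1, p3), (p2, p4)).
Definition leg12 (A : op2) : op4 := tens mu2 mu2 A id.
Definition leg34 (A : op2) : op4 := tens mu2 mu2 id A.
Definition leg13 (A : op2) : op4 := flip23 \o leg12 A \o flip23.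
Definition leg24 (A : op2) : op4 := flip23 \o leg34 A \o flip23.

Definition VD : op4 :=
  leg12 Zop \o leg24 Yop \o adj mu4 (leg12 Zop) \o leg13 Xop.
Definition DeltaD (x : op2) : op4 := adj mu4 VD \o leg34 x \o VD.

Definition schwartz_c (f : cfun R pt) :=
  [/\ schwartz (fun p : Rn * Rn * R => complex.Re (f p)),
      schwartz (fun p : Rn * Rn * R => complex.Im (f p))
    & exists K : R, forall x y r, K < `|r| -> f (x, y, r) = 0].

Definition Lop (f : cfun R pt) : op1 := fun xi '(x, y, r) =>
  cint (sprod (lebesgue_rV R n) (lebesgue_rV R n)) (fun '(x', y') =>
    f (x', y', r) * xi (x - x', y - y', r) * ebar (eta r * beta x' (y - y'))).

Definition lamop (phi : cfun R pt) : op1 := fun xi '(x, y, r) =>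
  cint (@lebesgue_measure R) (fun r' =>
    phi (expR (l * r') *: x, expR (l * r') *: y, r - r') * xi (x, y, r')).

Definition pi_ (a : op1) : op2 := Zop \o tens mu1 mu1 id a \o adj mu2 Zop.
Definition pi' (b : op1) : op2 := tens mu1 mu1 b id.

(* Pi on the elementary tensor of phi and f *)
Definition Pi (phi f : cfun R pt) : op2 := pi' (lamop phi) \o pi_ (Lop f).

Definition tens_hom2 (rho : op1 -> op2) : op2 -> op4 :=
  tens_hom mu1 mu1 mu2 mu2 rho rho.

End quantum_double.

(* Main.v *)
Require Import Defs.
From mathcomp Require Import all_boot all_order all_algebra.
From mathcomp Require Import all_classical all_reals all_analysis.
From mathcomp Require Import measurable_realfun.
From mathcomp Require Import complex.
From mathcomp Require Import ring lra.

(** The weighted composition operators [xi |-> (p |-> m p * xi (T p))] with [T]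
   an invertible change of variables and [nsq (m p)] its Jacobian are unitary,
   and they are closed under products, adjoints and tensor products with the
   identity.  All of [UA], [Y], [X] and [Z] are of this kind, hence so is [V_D],
   and an identity between words in them reduces to an identity between
   explicit weights and explicit points ([YwE], [ZwE], [Dw_m], [Uw_m0]).

   The first equality holds by definition of [Pi].  For the second, [Delta_D]
   is a conjugation by a unitary, hence multiplicative, and it suffices to
   treat the two factors separately.

   - [Delta_D (b \otimes 1) = (Deltahat b)_13] ([DeltaD_pi']).  In the four legs
     [Delta_D (b \otimes 1) = V_D^* b_3 V_D], where [b_3] commutes with
     [Z_12 Y_24 Z_12^*]; what remains is [X_13^* b_3 X_13].
   - [Delta_D (pi a) = (pi \otimes pi) (Delta a)] for [a = L_f] ([DeltaD_pi_]).
     The left-hand side is [V_D^* Z_34 a_4 Z_34^* V_D]; since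
     [Delta a = Y^* (1 \otimes a) Y], the right-hand side is
     [Z_12 Z_34 Y_24^* a_4 Y_24 Z_34^* Z_12^*].  They agree if and only if [a_4] is
     fixed under conjugation by [Y_24 Z_34^* Z_12^* V_D^* Z_34]
     ([double_intertwiner]).  The change of variables of this unitary fixes
     [(x_4, y_4, r_4)] and moves the other coordinates independently of
     [(x_4, y_4)]; its weight is constant in [(x_4, y_4)] as well.  It therefore
     commutes with [a_4], which is a twisted convolution in [(x_4, y_4)] with
     [r_4] as a parameter ([Uw_T], [Uw_rd], [Uw_m]).  That
     the weight is constant in [(x_4, y_4)] uses the cocycle identity [etaD] of
     [eta] and its symmetric form [eta_sym].  The formula for [Delta a] is
     proved in the same way on two legs ([Delta_Y], [wconj_Dw]).

   The homomorphisms [pi' \otimes pi'] and [pi \otimes pi] are characterized by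
   normality and by their values on elementary tensors.  Normal homomorphisms
   agreeing on elementary tensors are equal, because the compressions of an
   operator to finitely many vectors of a product basis are combinations of
   elementary tensors of rank one operators and converge weakly to it
   ([tens_hom_unique]).  The maps [W |-> W_13] and
   [W |-> Z_12 Z_34 W_24 Z_34^* Z_12^*] are normal and have the required values
   ([is_tens_hom_pi'], [is_tens_hom_pi_]).

   The analysis behind this is the following.  Tensor products of bounded
   operators exist by a slicewise bound on the algebraic tensor product and
   extension along an orthonormal basis ([is_tens_exists],
   [bounded_extension]), which rests on the completeness of L^2.  The
   underlying L^2 spaces have orthonormal sequences that are total: on the
   line, by Gram-Schmidt from the indicators of rational intervals, whose
   totality is Lebesgue's differentiation theorem ([onb_leb]).  Finally, [L_f]
   and [lambda_phi] are integral operators [conv] with kernels dominated by an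
   integrable function of the translation variable, hence bounded by Young's
   inequality ([conv_bop]), and [1 \otimes L_f] acts by the same formula on
   every fibre ([tens_fiber]), so that commutation with a weighted composition
   can be checked under the integral sign ([Lop_commute]). *)

Set Implicit Arguments.
Unset Strict Implicit.
Unset Printing Implicit Defensive.

Import Order.TTheory GRing.Theory Num.Theory.
Import numFieldNormedType.Exports.

Local Open Scope classical_set_scope.
Local Open Scope ring_scope.

(** * Square-integrable complex functions and their inner product *)

Section modulus.
Context (R : realType).
Implicit Types z w : R[i].

(** The squared modulus, as a real number: the modulus on [R[i]] has complex
    values. *)
Definition nsq z : R := complex.Re z ^+ 2 + complex.Im z ^+ 2.

Lemma nsq_ge0 z : 0 <= nsq z.
Proof. by rewrite addr_ge0// sqr_ge0. Qed.

Lemma nsqM z w : nsq (z * w) = nsq z * nsq w.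
Proof. by case: z w => a b [c e]; rewrite /nsq /=; ring. Qed.

(** The parallelogram law; squared norms are used throughout, so that this
    replaces the triangle inequality. *)
Lemma nsqD_le z w : nsq (z + w) <= 2 * nsq z + 2 * nsq w.
Proof.
case: z w => a b [c e]; rewrite /nsq /=.
rewrite -subr_ge0 (_ : _ - _ = (a - c) ^+ 2 + (b - e) ^+ 2); last by ring.
by rewrite addr_ge0// sqr_ge0.
Qed.

Lemma nsq_conj z : nsq z^* = nsq z.
Proof. by case: z => a b; rewrite /nsq /= sqrrN. Qed.

Lemma nsqN z : nsq (- z) = nsq z.
Proof. by case: z => a b; rewrite /nsq /= !sqrrN. Qed.

Lemma nsq0 : nsq 0 = 0.
Proof. by rewrite /nsq /= expr0n addr0. Qed.

Lemma nsq1 : nsq 1 = 1.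
Proof. by rewrite /nsq /= expr0n expr1n addr0. Qed.

Lemma nsq_eq0 z : nsq z = 0 -> z = 0.
Proof.
case: z => a b; rewrite /nsq /= => /eqP.
by rewrite paddr_eq0 ?sqr_ge0// !sqrf_eq0 => /andP[/eqP-> /eqP->].
Qed.

Lemma nsq_real (a : R) : nsq a%:C%C = a ^+ 2.
Proof. by rewrite /nsq /= expr0n addr0. Qed.

Lemma mulcJ z : z * z^* = (nsq z)%:C%C.
Proof. by case: z => a b; apply/eqP; rewrite eq_complex /nsq /=; apply/andP; split; apply/eqP; ring. Qed.

Lemma cReD z w : complex.Re (z + w) = complex.Re z + complex.Re w.
Proof. by case: z w => ? ? []. Qed.
Lemma cImD z w : complex.Im (z + w) = complex.Im z + complex.Im w.
Proof. by case: z w => ? ? []. Qed.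
Lemma cReN z : complex.Re (- z) = - complex.Re z.
Proof. by case: z. Qed.
Lemma cImN z : complex.Im (- z) = - complex.Im z.
Proof. by case: z. Qed.
Lemma cReM z w : complex.Re (z * w) = complex.Re z * complex.Re w - complex.Im z * complex.Im w.
Proof. by case: z w => ? ? []. Qed.
Lemma cImM z w : complex.Im (z * w) = complex.Re z * complex.Im w + complex.Im z * complex.Re w.
Proof. by case: z w => ? ? []. Qed.
Lemma cReJ z : complex.Re z^* = complex.Re z.
Proof. by case: z. Qed.
Lemma cImJ z : complex.Im z^* = - complex.Im z.
Proof. by case: z. Qed.

Lemma Re_mulNJ (t : R) z : complex.Re (t%:C%C * ((- z)^* * z)) = - t * nsq z.
Proof. by case: z => a b; rewrite /nsq /=; ring. Qed.

Lemma complex_ext z w : complex.Re z = complex.Re w ->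
  complex.Im z = complex.Im w -> z = w.
Proof. by case: z w => a b [c e] /= -> ->. Qed.

End modulus.

Section measurable_complex.
Context (R : realType) d (T : measurableType d).
Implicit Types f g : cfun R T.

Definition cmeas f :=
  measurable_fun [set: T] (fun x => complex.Re (f x)) /\
  measurable_fun [set: T] (fun x => complex.Im (f x)).

Lemma cmeas_cst (a : R[i]) : cmeas (fun=> a).
Proof. by split; exact: measurable_cst. Qed.

Lemma cmeasD f g : cmeas f -> cmeas g -> cmeas (fun x => f x + g x).
Proof.
move=> [f1 f2] [g1 g2]; split.
  by under eq_fun do rewrite cReD; exact: measurable_funD.
by under eq_fun do rewrite cImD; exact: measurable_funD.
Qed.

Lemma cmeasM f g : cmeas f -> cmeas g -> cmeas (fun x => f x * g x).
Proof.
move=> [f1 f2] [g1 g2]; split.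
  under eq_fun do rewrite cReM.
  by apply: measurable_funB; exact: measurable_funM.
under eq_fun do rewrite cImM.
by apply: measurable_funD; exact: measurable_funM.
Qed.

Lemma cmeasJ f : cmeas f -> cmeas (fun x => (f x)^*).
Proof.
move=> [f1 f2]; split; first by under eq_fun do rewrite cReJ.
by under eq_fun do rewrite cImJ; exact: measurableT_comp.
Qed.

Lemma cmeasZ (a : R[i]) f : cmeas f -> cmeas (fun x => a * f x).
Proof. by move=> mf; apply: (@cmeasM (fun=> a)) => //; exact: cmeas_cst. Qed.

Lemma cmeasN f : cmeas f -> cmeas (fun x => - f x).
Proof.
move=> mf; rewrite (_ : (fun _ => _) = fun x => (fun=> -1) x * f x).
  exact: cmeasM (cmeas_cst _) mf.
by apply/funext => x /=; rewrite mulN1r.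
Qed.

Lemma cmeas_real (h : T -> R) : measurable_fun [set: T] h -> cmeas (fun x => (h x)%:C%C).
Proof. by move=> mh; split=> //=; exact: measurable_cst. Qed.

Lemma measurable_nsq f : cmeas f -> measurable_fun [set: T] (fun x => nsq (f x)).
Proof. by move=> [f1 f2]; apply: measurable_funD; exact: measurable_funX. Qed.

Lemma measurable_ensq f : cmeas f ->
  measurable_fun [set: T] (fun x => (nsq (f x))%:E).
Proof. by move=> mf; apply/measurable_EFinP; exact: measurable_nsq. Qed.

End measurable_complex.

Lemma cmeas_comp (R : realType) d d' (T : measurableType d) (S : measurableType d')
    (h : S -> T) (f : cfun R T) :
  measurable_fun [set: S] h -> cmeas f -> cmeas (fun s => f (h s)).
Proof.
move=> mh [f1 f2]; split.
  exact: (measurableT_comp f1 mh).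
exact: (measurableT_comp f2 mh).
Qed.

Section L2_basics.
Context (R : realType) d (T : measurableType d).
Context (mu : {sigma_finite_measure set T -> \bar R}).
Implicit Types f g h : cfun R T.

(** Extended-valued, so that Tonelli applies before finiteness is known. *)
Definition enorm2 f : \bar R := (\int[mu]_x (nsq (f x))%:E)%E.

Lemma enorm2_ge0 f : (0 <= enorm2 f)%E.
Proof. by apply: integral_ge0 => x _; rewrite lee_fin nsq_ge0. Qed.

Lemma Lfun2P (f : T -> R) : f \in Lfun mu 2%:E <->
  measurable_fun [set: T] f /\ (\int[mu]_x ((f x) ^+ 2)%:E < +oo)%E.
Proof.
split=> [h|[mf foo]].
  split; last first.
    have /integrableP[_] := Lfun2_integrable_sqr h.
    by under eq_integral do rewrite /= ger0_norm ?sqr_ge0//.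
  by move: h; rewrite inE => /andP[/[!inE]].
rewrite inE; apply/andP; split; rewrite inE//= /finite_norm unlock.
apply: poweR_lty; apply: le_lt_trans foo.
apply: ge0_le_integral => //.
- by move=> x _; exact: poweR_ge0.
- apply/measurable_EFinP.
  apply/(@measurableT_comp _ _ _ _ _ _ (fun x : R => x `^ 2)%R) => //.
  exact/measurableT_comp.
- by apply/measurable_EFinP; exact: measurable_funX.
- by move=> x _; rewrite lee_fin powR_mulrn// -normrX ger0_norm ?sqr_ge0.
Qed.

Lemma L2P f : L2 mu f <-> cmeas f /\ (enorm2 f < +oo)%E.
Proof.
rewrite /L2 !Lfun2P; split=> [[[m1 o1] [m2 o2]]|[[m1 m2] oo]].
  split=> //; rewrite /enorm2 /nsq; under eq_integral do rewrite EFinD.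
  rewrite ge0_integralD//; first exact: lte_add_pinfty.
  - by move=> x _; rewrite lee_fin sqr_ge0.
  - by apply/measurable_EFinP; exact: measurable_funX.
  - by move=> x _; rewrite lee_fin sqr_ge0.
  - by apply/measurable_EFinP; exact: measurable_funX.
split; split=> //; apply: le_lt_trans oo; apply: ge0_le_integral => //.
- by move=> x _; rewrite lee_fin sqr_ge0.
- by apply/measurable_EFinP; exact: measurable_funX.
- exact/measurable_ensq.
- by move=> x _; rewrite lee_fin /nsq lerDl sqr_ge0.
- by move=> x _; rewrite lee_fin sqr_ge0.
- by apply/measurable_EFinP; exact: measurable_funX.
- exact/measurable_ensq.
- by move=> x _; rewrite lee_fin /nsq lerDr sqr_ge0.
Qed.

Lemma L2_cmeas f : L2 mu f -> cmeas f. Proof. by case/L2P. Qed.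

Lemma L2_fin f : L2 mu f -> enorm2 f \is a fin_num.
Proof. by case/L2P => _ oo; rewrite ge0_fin_numE// enorm2_ge0. Qed.

Lemma enorm2Z (a : R[i]) f : cmeas f ->
  enorm2 (fun x => a * f x) = ((nsq a)%:E * enorm2 f)%E.
Proof.
move=> mf; rewrite /enorm2; under eq_integral do rewrite nsqM EFinM.
by rewrite ge0_integralZl_EFin ?nsq_ge0//; [move=> x _; rewrite lee_fin nsq_ge0|exact: measurable_ensq].
Qed.

Lemma L2_le f g : cmeas f -> (forall x, nsq (f x) <= nsq (g x)) -> L2 mu g -> L2 mu f.
Proof.
move=> mf fg /L2P[mg oo]; apply/L2P; split=> //; apply: le_lt_trans oo.
apply: ge0_le_integral => //.
- by move=> x _; rewrite lee_fin nsq_ge0.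
- exact: measurable_ensq.
- exact: measurable_ensq.
- by move=> x _; rewrite lee_fin.
Qed.

Lemma L2Z (a : R[i]) f : L2 mu f -> L2 mu (fun x => a * f x).
Proof.
move=> /L2P[mf oo]; apply/L2P; split; first exact: cmeasZ.
by rewrite enorm2Z// lte_mul_pinfty ?lee_fin ?nsq_ge0.
Qed.

Lemma L2D f g : L2 mu f -> L2 mu g -> L2 mu (fun x => f x + g x).
Proof.
move=> /L2P[mf fo] /L2P[mg go]; apply/L2P; split; first exact: cmeasD.
apply: (@le_lt_trans _ _ (2%:E * enorm2 f + 2%:E * enorm2 g)%E); last first.
  by apply: lte_add_pinfty; apply: lte_mul_pinfty.
rewrite -!ge0_integralZl_EFin//; last 4 first.
- by move=> x _; rewrite lee_fin nsq_ge0.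
- exact: measurable_ensq.
- by move=> x _; rewrite lee_fin nsq_ge0.
- exact: measurable_ensq.
rewrite -ge0_integralD//; last 4 first.
- by move=> x _; rewrite -EFinM lee_fin mulr_ge0// nsq_ge0.
- by apply: measurable_funeM; exact: measurable_ensq.
- by move=> x _; rewrite -EFinM lee_fin mulr_ge0// nsq_ge0.
- by apply: measurable_funeM; exact: measurable_ensq.
apply: ge0_le_integral => //.
- by move=> x _; rewrite lee_fin nsq_ge0.
- by apply: measurable_ensq; exact: cmeasD.
- apply: emeasurable_funD; apply: measurable_funeM; exact: measurable_ensq.
- by move=> x _; rewrite -!EFinM -EFinD lee_fin nsqD_le.
Qed.

Lemma L2_0 : L2 mu (fun=> 0).
Proof.
apply/L2P; split; first exact: cmeas_cst.
by rewrite /enorm2; under eq_integral do rewrite nsq0; rewrite integral0.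
Qed.

Lemma L2N f : L2 mu f -> L2 mu (fun x => - f x).
Proof.
move=> Lf; apply: (L2_le _ _ Lf); first exact/cmeasN/L2_cmeas.
by move=> x; rewrite nsqN.
Qed.

Lemma L2B f g : L2 mu f -> L2 mu g -> L2 mu (fun x => f x - g x).
Proof. by move=> Lf Lg; exact: L2D Lf (L2N Lg). Qed.

Lemma L2J f : L2 mu f -> L2 mu (fun x => (f x)^*).
Proof.
move=> Lf; apply: (L2_le _ _ Lf); first exact/cmeasJ/L2_cmeas.
by move=> x; rewrite nsq_conj.
Qed.

Lemma L2_sum I (s : seq I) (F : I -> cfun R T) :
  (forall i, L2 mu (F i)) -> L2 mu (fun x => \sum_(i <- s) F i x).
Proof.
move=> LF; elim: s => [|i s IH].
  by under eq_fun do rewrite big_nil; exact: L2_0.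
by under eq_fun do rewrite big_cons; exact: L2D.
Qed.

Definition cintegrable f :=
  mu.-integrable [set: T] (fun x => (complex.Re (f x))%:E) /\
  mu.-integrable [set: T] (fun x => (complex.Im (f x))%:E).

Lemma cintegrableZ (a : R[i]) f : cintegrable f -> cintegrable (fun x => a * f x).
Proof.
move=> [f1 f2]; split.
  apply: eq_integrable (integrableB measurableT
    (integrableZl measurableT (complex.Re a) f1)
    (integrableZl measurableT (complex.Im a) f2)) => //.
  by move=> x _; rewrite /= cReM.
apply: eq_integrable (integrableD measurableT
  (integrableZl measurableT (complex.Re a) f2)
  (integrableZl measurableT (complex.Im a) f1)) => //.
by move=> x _; rewrite /= cImM.
Qed.

Lemma cintD f g : cintegrable f -> cintegrable g ->
  cint mu (fun x => f x + g x) = cint mu f + cint mu g.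
Proof.
move=> [f1 f2] [g1 g2]; apply: complex_ext => /=.
  by under eq_Rintegral do rewrite cReD; exact: RintegralD.
by under eq_Rintegral do rewrite cImD; exact: RintegralD.
Qed.

Lemma cintZ (a : R[i]) f : cintegrable f ->
  cint mu (fun x => a * f x) = a * cint mu f.
Proof.
move=> [f1 f2]; apply: complex_ext; rewrite ?cReM ?cImM /=.
  under eq_Rintegral do rewrite cReM.
  by rewrite RintegralB ?RintegralZl//; [exact: integrableZl f1|exact: integrableZl f2].
under eq_Rintegral do rewrite cImM.
by rewrite RintegralD ?RintegralZl//; [exact: integrableZl f2|exact: integrableZl f1].
Qed.

Lemma cintJ f : cintegrable f -> cint mu (fun x => (f x)^*) = (cint mu f)^*.
Proof.
move=> [f1 f2]; apply: complex_ext; rewrite /=.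
  by under eq_Rintegral do rewrite cReJ.
under eq_Rintegral do rewrite cImJ -mulN1r.
by rewrite RintegralZl// mulN1r.
Qed.

Lemma cintegrable_mul f g : L2 mu f -> L2 mu g -> cintegrable (fun x => f x * g x).
Proof.
move=> [f1 f2] [g1 g2].
have := Lfun2_mul_Lfun1 f1 g1; have := Lfun2_mul_Lfun1 f1 g2.
have := Lfun2_mul_Lfun1 f2 g1; have := Lfun2_mul_Lfun1 f2 g2.
rewrite !Lfun1_integrable => i22 i21 i12 i11; split.
  apply: eq_integrable (integrableB measurableT i11 i22) => //.
  by move=> x _; rewrite /= cReM.
apply: eq_integrable (integrableD measurableT i12 i21) => //.
by move=> x _; rewrite /= cImM.
Qed.

Lemma cintegrable_inner f g : L2 mu f -> L2 mu g -> cintegrable (fun x => f x * (g x)^*).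
Proof. by move=> Lf /L2J; exact: cintegrable_mul. Qed.

Lemma ae_equal_refl f : ae_equal mu f f. Proof. exact: aeW. Qed.

Lemma ae_equal_sym f g : ae_equal mu f g -> ae_equal mu g f.
Proof. by apply: filterS => x /= h /h. Qed.

Lemma ae_equal_trans f g h : ae_equal mu f g -> ae_equal mu g h -> ae_equal mu f h.
Proof. by apply: filterS2 => x /= h1 h2 t; rewrite h1// h2. Qed.

Lemma ae_equalP f g : ae_equal mu f g <-> {ae mu, forall x, f x = g x}.
Proof. by split; apply: filterS => x /=; [move=> /(_ I)|move=> ->]. Qed.

Lemma ae_equal_map2 (k : T -> R[i] -> R[i] -> R[i]) f f' g g' :
  ae_equal mu f f' -> ae_equal mu g g' ->
  ae_equal mu (fun x => k x (f x) (g x)) (fun x => k x (f' x) (g' x)).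
Proof. by apply: filterS2 => x /= h1 h2 t; rewrite h1// h2. Qed.

Lemma cint_ae f g : cmeas f -> cmeas g -> ae_equal mu f g -> cint mu f = cint mu g.
Proof.
move=> [f1 f2] [g1 g2] /ae_equalP fg; apply: complex_ext => /=.
  congr fine; apply: ae_eq_integral => //; try exact/measurable_EFinP.
  by apply: filterS fg => x /= ->.
congr fine; apply: ae_eq_integral => //; try exact/measurable_EFinP.
by apply: filterS fg => x /= ->.
Qed.

Lemma inner_ae f f' g g' : cmeas f -> cmeas f' -> cmeas g -> cmeas g' ->
  ae_equal mu f f' -> ae_equal mu g g' -> inner mu f g = inner mu f' g'.
Proof.
move=> mf mf' mg mg' ff gg; apply: cint_ae.
- exact: cmeasM mf (cmeasJ mg).
- exact: cmeasM mf' (cmeasJ mg').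
- exact: (@ae_equal_map2 (fun _ a b => a * b^*)).
Qed.

Lemma innerDl f g h : L2 mu f -> L2 mu g -> L2 mu h ->
  inner mu (fun x => f x + g x) h = inner mu f h + inner mu g h.
Proof.
move=> Lf Lg Lh; rewrite /inner -cintD; try exact: cintegrable_inner.
by congr cint; apply/funext => x; rewrite mulrDl.
Qed.

Lemma innerZl (a : R[i]) f g : L2 mu f -> L2 mu g ->
  inner mu (fun x => a * f x) g = a * inner mu f g.
Proof.
move=> Lf Lg; rewrite /inner -cintZ; last exact: cintegrable_inner.
by congr cint; apply/funext => x; rewrite mulrA.
Qed.

Lemma innerC f g : L2 mu f -> L2 mu g -> inner mu g f = (inner mu f g)^*.
Proof.
move=> Lf Lg; rewrite /inner -cintJ; last exact: cintegrable_inner.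
by congr cint; apply/funext => x; rewrite rmorphM/= conjCK mulrC.
Qed.

Lemma innerDr f g h : L2 mu f -> L2 mu g -> L2 mu h ->
  inner mu h (fun x => f x + g x) = inner mu h f + inner mu h g.
Proof.
by move=> Lf Lg Lh; rewrite innerC ?innerDl// ?rmorphD/= -?innerC//; exact: L2D.
Qed.

Lemma innerZr (a : R[i]) f g : L2 mu f -> L2 mu g ->
  inner mu g (fun x => a * f x) = a^* * inner mu g f.
Proof.
by move=> Lf Lg; rewrite innerC ?innerZl// ?rmorphM/= -?innerC//; exact: L2Z.
Qed.

Lemma inner0l f : inner mu (fun=> 0) f = 0.
Proof.
rewrite /inner /cint; under eq_Rintegral do rewrite mul0r/=.
by under [X in Complex _ X]eq_Rintegral do rewrite mul0r/=; rewrite /Rintegral integral0.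
Qed.

Lemma innerNl f g : L2 mu f -> L2 mu g ->
  inner mu (fun x => - f x) g = - inner mu f g.
Proof.
move=> Lf Lg; have := innerZl (-1) Lf Lg; rewrite mulN1r => <-.
by congr (inner mu _ g); apply/funext => x; rewrite mulN1r.
Qed.

Lemma innerNr f g : L2 mu f -> L2 mu g ->
  inner mu g (fun x => - f x) = - inner mu g f.
Proof.
by move=> Lf Lg; rewrite innerC ?innerNl// ?rmorphN/= -?innerC//; exact: L2N.
Qed.

Lemma innerBl f g h : L2 mu f -> L2 mu g -> L2 mu h ->
  inner mu (fun x => f x - g x) h = inner mu f h - inner mu g h.
Proof. by move=> Lf Lg Lh; rewrite innerDl ?innerNl//; exact: L2N. Qed.

Lemma innerBr f g h : L2 mu f -> L2 mu g -> L2 mu h ->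
  inner mu h (fun x => f x - g x) = inner mu h f - inner mu h g.
Proof. by move=> Lf Lg Lh; rewrite innerDr ?innerNr//; exact: L2N. Qed.

Lemma inner_suml I (s : seq I) (F : I -> cfun R T) g :
  (forall i, L2 mu (F i)) -> L2 mu g ->
  inner mu (fun x => \sum_(i <- s) F i x) g = \sum_(i <- s) inner mu (F i) g.
Proof.
move=> LF Lg; elim: s => [|i s IH].
  rewrite big_nil -[RHS](inner0l g); congr inner.
  by apply/funext => x; rewrite big_nil.
rewrite big_cons -IH -innerDl//; last exact: L2_sum.
by congr inner; apply/funext => x; rewrite big_cons.
Qed.

Definition sqn f : R := complex.Re (inner mu f f).

Lemma sqnE f : L2 mu f -> sqn f = fine (enorm2 f).
Proof.
move=> Lf; rewrite /sqn /inner /cint /= /Rintegral /enorm2; congr fine.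
by apply: eq_integral => x _; rewrite mulcJ.
Qed.

Lemma enorm2E f : L2 mu f -> enorm2 f = (sqn f)%:E.
Proof. by move=> Lf; rewrite sqnE// fineK// L2_fin. Qed.

Lemma inner_diag f : inner mu f f = (sqn f)%:C%C.
Proof.
apply: complex_ext => //=; rewrite /Rintegral.
under eq_integral do rewrite mulcJ/=; by rewrite integral0.
Qed.

Lemma sqn_ge0 f : 0 <= sqn f.
Proof.
rewrite /sqn /inner /cint /= Rintegral_ge0// => x _.
by rewrite mulcJ/= nsq_ge0.
Qed.

Lemma sqn_ae f g : cmeas f -> cmeas g -> ae_equal mu f g -> sqn f = sqn g.
Proof. by move=> mf mg fg; rewrite /sqn (inner_ae mf mg mf mg). Qed.

Lemma sqn0 : sqn (fun=> 0) = 0.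
Proof. by rewrite /sqn inner0l. Qed.

Lemma sqn_eq0 f : L2 mu f -> sqn f = 0 <-> ae_equal mu f (fun=> 0).
Proof.
move=> Lf; split=> [f0|f0]; last first.
  by rewrite (sqn_ae (L2_cmeas Lf) _ f0) ?sqn0//; exact: cmeas_cst.
have /ae_eq_integral_abs : measurable_fun setT (fun x => (nsq (f x))%:E).
  exact/measurable_ensq/L2_cmeas.
move=> /(_ mu measurableT)[+ _].
have -> : (\int[mu]_x `|(nsq (f x))%:E| = 0)%E.
  under eq_integral do rewrite gee0_abs ?lee_fin ?nsq_ge0//.
  by rewrite -/(enorm2 f) enorm2E// f0.
move=> /(_ erefl); apply: filterS => x /= h t.
by apply: nsq_eq0; have [->] := h t.
Qed.

Lemma sqnZ (a : R[i]) f : L2 mu f -> sqn (fun x => a * f x) = nsq a * sqn f.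
Proof.
move=> Lf; rewrite !sqnE//; last exact: L2Z.
by rewrite enorm2Z ?fineM// ?L2_fin//; exact: L2_cmeas.
Qed.

Lemma sqnN f : sqn (fun x => - f x) = sqn f.
Proof.
by rewrite /sqn /inner; congr (complex.Re (cint _ _)); apply/funext => x; rewrite rmorphN/= mulrNN.
Qed.

Lemma sqnBC f g : sqn (fun x => f x - g x) = sqn (fun x => g x - f x).
Proof. by rewrite -sqnN; congr sqn; apply/funext => x; rewrite opprB. Qed.

Lemma sqnD f g : L2 mu f -> L2 mu g ->
  sqn (fun x => f x + g x) = sqn f + sqn g + 2 * complex.Re (inner mu f g).
Proof.
move=> Lf Lg; rewrite /sqn innerDl ?innerDr//; last exact: L2D.
rewrite (innerC Lf Lg) !cReD cReJ; ring.
Qed.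

Lemma sqnD_le f g : L2 mu f -> L2 mu g ->
  sqn (fun x => f x + g x) <= 2 * sqn f + 2 * sqn g.
Proof.
move=> Lf Lg; have := sqn_ge0 (fun x => f x - g x).
rewrite !sqnD//; last exact: L2N.
rewrite sqnN innerNr// => h.
by move: h; rewrite cReN; lra.
Qed.

(** The quadratic polynomial [t |-> sqn (t f - c g)], with [c = inner f g], is
    nonnegative. *)
Lemma inner_le f g : L2 mu f -> L2 mu g -> nsq (inner mu f g) <= sqn f * sqn g.
Proof.
move=> Lf Lg; set c := inner mu f g.
have key (t : R) : 0 <= sqn f * t ^+ 2 - 2 * t * nsq c + nsq c * sqn g.
  have := sqn_ge0 (fun x => t%:C%C * f x + (- c) * g x).
  rewrite sqnD; [|exact: L2Z|exact: L2Z].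
  rewrite !sqnZ// innerZl ?innerZr//; last exact: L2Z.
  rewrite nsqN nsq_real -/c Re_mulNJ.
  by move=> h; apply: le_trans h _; rewrite le_eqVlt; apply/orP; left; apply/eqP; ring.
have [f0|f0] := eqVneq (sqn f) 0.
  have [->|c0] := eqVneq (nsq c) 0; first by rewrite mulr_ge0 ?sqn_ge0.
  have cp : 0 < nsq c by rewrite lt_neqAle eq_sym c0 nsq_ge0.
  (* at this point the polynomial, which is affine, takes the value [- nsq c] *)
  have := key ((sqn g + 1) / 2); rewrite f0 mul0r add0r.
  rewrite (_ : - _ + _ = - nsq c); last by field.
  by rewrite oppr_ge0 leNgt cp.
have fp : 0 < sqn f by rewrite lt_neqAle eq_sym f0 sqn_ge0.
(* the minimum of the polynomial *)
have := key (nsq c / sqn f).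
rewrite (_ : _ + _ = (nsq c * (sqn f * sqn g - nsq c)) / sqn f); last by field.
rewrite pmulr_lge0 ?invr_gt0// => h.
have [->|c0] := eqVneq (nsq c) 0; first by rewrite mulr_ge0 ?sqn_ge0.
move: h.
have cp : 0 < nsq c by rewrite lt_neqAle eq_sym c0 nsq_ge0.
by rewrite pmulr_rge0// subr_ge0.
Qed.

Lemma norm2E f : norm2 mu f = Num.sqrt (sqn f). Proof. by []. Qed.

Lemma norm2_leP (C : R) f g : 0 <= C ->
  norm2 mu f <= C * norm2 mu g <-> sqn f <= C ^+ 2 * sqn g.
Proof.
move=> C0; rewrite !norm2E; split=> h.
  rewrite -(sqr_sqrtr (sqn_ge0 f)) -(sqr_sqrtr (sqn_ge0 g)) -exprMn.
  by rewrite ler_pXn2r// ?nnegrE ?mulr_ge0// sqrtr_ge0.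
rewrite -(ger0_norm C0) -sqrtr_sqr -sqrtrM ?sqr_ge0//.
exact: ler_wsqrtr.
Qed.

End L2_basics.

(** * Completeness of L^2 *)

Section completeness.
Context (R : realType) d (T : measurableType d).
Context (mu : {sigma_finite_measure set T -> \bar R}).
Implicit Types f g h : cfun R T.

Lemma quarter_pow (i : nat) : (2:R) ^+ i * 4^-1 ^+ i = 2^-1 ^+ i.
Proof. by rewrite -exprMn; congr (_ ^+ _); field. Qed.

(** Absolute convergence of the telescoping series; the geometric term comes
    from [sqrt_split_le]. *)
Lemma telescope_cvg (v e : nat -> R) :
  (forall i, `|v i.+1 - v i| <= 2^-1 ^+ i + e i) -> (forall i, 0 <= e i) ->
  cvgn (series e) -> cvgn v.
Proof.
move=> ve e0 cve.
have cs : cvgn (series (fun i => v i.+1 - v i)).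
  apply: normed_cvg; apply: (@series_le_cvg _ _ (fun i => 2^-1 ^+ i + e i)).
  - by move=> n /=; exact: normr_ge0.
  - by move=> n; rewrite addr_ge0// exprn_ge0// invr_ge0.
  - by move=> n; exact: ve.
  - rewrite (_ : (fun i => _) = geometric 1 2^-1 + e); last first.
      by apply/funext => i; rewrite /geometric /= fctE mul1r.
    rewrite seriesD; apply: is_cvgD => //.
    by apply: is_cvg_geometric_series; rewrite ger0_norm ?invr_ge0// invf_lt1// ltr1n.
rewrite (_ : v = (fun=> v 0%N) + series (fun i => v i.+1 - v i)).
  by apply: is_cvgD => //; exact: is_cvg_cst.
apply/funext => n; rewrite fctE /series /= telescope_sumr//.
by rewrite addrC subrK.
Qed.

(** A weighted arithmetic-geometric mean inequality: it turns square
    summability with exponentially growing weights into summability. *)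
Lemma sqrt_split_le (a c : R) (i : nat) : a ^+ 2 <= c -> `|a| <= 2^-1 ^+ i + 2 ^+ i * c.
Proof.
move=> ac; set b := `|a|; have b0 : 0 <= b by exact: normr_ge0.
have p0 : 0 < 2 ^+ i :> R by rewrite exprn_gt0.
apply: (@le_trans _ _ (2^-1 ^+ i + 2 ^+ i * b ^+ 2)); last first.
  by rewrite lerD2l ler_pM2l// /b real_normK ?num_real.
rewrite exprVn; set t := 2 ^+ i in p0 *.
rewrite -subr_ge0 (_ : _ - _ = t^-1 * ((t * b - 2^-1) ^+ 2 + 3 / 4)); last by field; rewrite gt_eqF.
by rewrite mulr_ge0 ?invr_ge0 ?(ltW p0)// addr_ge0// sqr_ge0.
Qed.

(** The weighted sum of the squared increments is integrable, hence finite
    almost everywhere. *)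
Lemma fast_cvg_ae (u : nat -> cfun R T) : (forall i, L2 mu (u i)) ->
  (forall i, sqn mu (fun x => u i.+1 x - u i x) <= 4^-1 ^+ i) ->
  {ae mu, forall x, cvgn (fun k => complex.Re (u k x)) /\ cvgn (fun k => complex.Im (u k x))}.
Proof.
move=> Lu ud.
have Ld i : L2 mu (fun x => u i.+1 x - u i x) by exact: L2B.
pose w i x : \bar R := ((2 ^+ i)%:E * (nsq (u i.+1 x - u i x))%:E)%E.
have w0 i x : (0 <= w i x)%E by rewrite /w -EFinM lee_fin mulr_ge0 ?nsq_ge0 ?exprn_ge0.
have mw i : measurable_fun setT (w i).
  by apply: measurable_funeM; exact/measurable_ensq/(L2_cmeas (Ld i)).
have mW : measurable_fun setT (fun x => \sum_(0 <= i <oo) w i x)%E.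
  exact: ge0_emeasurable_sum.
have iW : mu.-integrable setT (fun x => \sum_(0 <= i <oo) w i x)%E.
  apply/integrableP; split => //.
  under eq_integral do rewrite gee0_abs ?nneseries_ge0//.
  rewrite integral_nneseries//.
  apply: (@le_lt_trans _ _ (\sum_(0 <= i <oo) (2^-1 ^+ i)%:E)%E).
    apply: lee_nneseries => [i _ _|i _]; first exact: integral_ge0.
    rewrite ge0_integralZl_EFin ?exprn_ge0//; last 2 first.
    - by move=> x _; rewrite lee_fin nsq_ge0.
    - exact/measurable_ensq/(L2_cmeas (Ld i)).
    rewrite -/(enorm2 mu _) enorm2E// -EFinM lee_fin -quarter_pow.
    by rewrite ler_pM2l ?exprn_gt0.
  have h := @is_cvg_geometric_series R 1 2^-1.
  have /h {h} : `|2^-1 : R| < 1 by rewrite ger0_norm ?invr_ge0// invf_lt1// ltr1n.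
  move=> h; rewrite (_ : limn _ = (limn (series (geometric 1 (2^-1:R))))%:E) ?ltry//.
  rewrite -EFin_lim//; congr (limn _); apply/funext => n /=.
  by rewrite sumEFin /series /=; congr EFin; apply: eq_bigr => i _; rewrite /geometric /= mul1r.
have := integrable_ae measurableT iW; apply: filterS => x /(_ I) Wx.
have cw : cvgn (series (fun i => 2 ^+ i * nsq (u i.+1 x - u i x))).
  apply: nnseries_is_cvg; first by move=> i; rewrite mulr_ge0 ?nsq_ge0 ?exprn_ge0.
  rewrite -ge0_fin_numE; first exact: Wx.
  by apply: nneseries_ge0 => i _ _; exact: w0.
split; apply: telescope_cvg cw.
- by move=> i; rewrite -cReN -cReD; apply: sqrt_split_le; rewrite /nsq lerDl sqr_ge0.
- by move=> i; rewrite mulr_ge0 ?nsq_ge0 ?exprn_ge0.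
- by move=> i; rewrite -cImN -cImD; apply: sqrt_split_le; rewrite /nsq lerDr sqr_ge0.
- by move=> i; rewrite mulr_ge0 ?nsq_ge0 ?exprn_ge0.
Qed.

(** A total function, so that it is measurable even where the sequence diverges. *)
Definition pw_lim (u : nat -> cfun R T) : cfun R T := fun x =>
  Complex (fine (limn_esup (fun k => (complex.Re (u k x))%:E)))
          (fine (limn_esup (fun k => (complex.Im (u k x))%:E))).

Lemma cmeas_pw_lim (u : nat -> cfun R T) : (forall i, cmeas (u i)) -> cmeas (pw_lim u).
Proof.
move=> mu_; split=> /=.
  apply: (measurableT_comp (fine_measurable measurableT)).
  by apply: measurable_fun_limn_esup => k; apply/measurable_EFinP; case: (mu_ k).
apply: (measurableT_comp (fine_measurable measurableT)).
by apply: measurable_fun_limn_esup => k; apply/measurable_EFinP; case: (mu_ k).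
Qed.

Lemma pw_limE (v : nat -> R) : cvgn v ->
  (fun k => v k) @ \oo --> fine (limn_esup (fun k => (v k)%:E)).
Proof.
move=> cv.
have : (fun k => (v k)%:E) @ \oo --> (limn v)%:E by apply: cvg_EFin => //; exact: nearW.
by move/cvg_limn_einf_sup => [_ ->].
Qed.

Lemma limn_einf_le (v : nat -> \bar R) (c : \bar R) (N : nat) :
  (forall k, (N <= k)%N -> (v k <= c)%E) -> (limn_einf v <= c)%E.
Proof.
move=> vc; rewrite limn_einf_lim; apply: lime_le; first exact: is_cvg_einfs.
apply: nearW => n; apply: (@le_trans _ _ (v (maxn n N))); last by apply: vc; exact: leq_maxr.
by apply: ereal_inf_lbound; exists (maxn n N) => //=; exact: leq_maxl.
Qed.

(** A subsequence with exponentially small increments converges almost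
    everywhere, and Fatou's lemma bounds the distance to its pointwise limit. *)
Lemma L2_complete (f : nat -> cfun R T) : (forall k, L2 mu (f k)) ->
  (forall e : R, 0 < e -> exists N, forall j k, (N <= j)%N -> (N <= k)%N ->
     sqn mu (fun x => f j x - f k x) <= e) ->
  exists g, L2 mu g /\ (fun k => sqn mu (fun x => f k x - g x)) @ \oo --> 0.
Proof.
move=> Lf cf.
have /choice[N NP] i : exists N, forall j k, (N <= j)%N -> (N <= k)%N ->
    sqn mu (fun x => f j x - f k x) <= 4^-1 ^+ i.
  by apply: cf; rewrite exprn_gt0// invr_gt0.
(* partial sums of the thresholds: nondecreasing and above each of them *)
pose s i := (\sum_(j < i.+1) N j)%N.
have sN i : (N i <= s i)%N by rewrite /s big_ord_recr/= leq_addl.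
have sS i : (s i <= s i.+1)%N by rewrite {2}/s big_ord_recr/= leq_addr.
have smono : {homo s : i j / (i <= j)%N} by exact: homo_leq leqnn leq_trans sS.
pose u i := f (s i); pose g := pw_lim u.
have Lu i : L2 mu (u i) by exact: Lf.
have mg : cmeas g by apply: cmeas_pw_lim => i; exact/L2_cmeas/Lu.
have ug : {ae mu, forall x, ((fun k => complex.Re (u k x)) @ \oo --> complex.Re (g x)) /\
                            ((fun k => complex.Im (u k x)) @ \oo --> complex.Im (g x))}.
  have : {ae mu, forall x, cvgn (fun k => complex.Re (u k x)) /\ cvgn (fun k => complex.Im (u k x))}.
    by apply: fast_cvg_ae => // i; apply: NP; [exact: leq_trans (sS i)|exact: sN].
  by apply: filterS => x [h1 h2]; split; exact: pw_limE.
have bound i j : (s i <= j)%N -> (enorm2 mu (fun x => (f j x - g x)%R) <= (4^-1 ^+ i)%:E)%E.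
  move=> sij; pose F k x := (nsq (f j x - u k x))%:E.
  have mF k : measurable_fun setT (F k) by exact/measurable_ensq/L2_cmeas/L2B.
  have -> : enorm2 mu (fun x => f j x - g x) = (\int[mu]_x limn_einf (F^~ x))%E.
    apply: ae_eq_integral => //.
    - by apply: measurable_ensq; apply: cmeasD; [exact: L2_cmeas|exact: cmeasN].
    - rewrite /limn_einf; apply: (measurableT_comp (f := -%E)) => //.
      apply: (measurable_fun_limn_esup (f := fun k x => - F k x)%E) => k.
      exact: measurableT_comp.
    apply: filterS ug => x [h1 h2] _.
    suff /cvg_limn_einf_sup[-> _] : (F^~ x) @ \oo --> (nsq (f j x - g x))%:E by [].
    apply: cvg_EFin; first exact: nearW.
    rewrite /nsq /comp /=; apply: cvgD; rewrite /=.
    - under eq_fun do rewrite cReD cReN; rewrite cReD cReN.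
      by rewrite expr2; under eq_fun do rewrite expr2; apply: cvgM; apply: cvgB => //; exact: cvg_cst.
    - under eq_fun do rewrite cImD cImN; rewrite cImD cImN.
      by rewrite expr2; under eq_fun do rewrite expr2; apply: cvgM; apply: cvgB => //; exact: cvg_cst.
  apply: le_trans (fatou mu measurableT mF _) _.
    by move=> k x _; rewrite lee_fin nsq_ge0.
  apply: (@limn_einf_le _ _ i) => k ik.
  rewrite -/(enorm2 mu (fun x => f j x - u k x)) enorm2E; last exact: L2B.
  rewrite lee_fin; apply: NP; first exact: leq_trans (sN i) sij.
  exact: leq_trans (sN i) (smono _ _ ik).
have Lfg j : (s 0%N <= j)%N -> L2 mu (fun x => f j x - g x).
  move=> sj; apply/L2P; split.
    by apply: cmeasD; [exact: L2_cmeas|exact: cmeasN].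
  by apply: le_lt_trans (bound 0%N j sj) _; rewrite ltry.
have Lg : L2 mu g.
  rewrite (_ : g = fun x => f (s 0%N) x - (f (s 0%N) x - g x)); last first.
    by apply/funext => x; rewrite opprB addrC subrK.
  by apply: L2B => //; exact: Lfg.
exists g; split=> //; apply/cvgrPdist_le => e e0.
have [i ie] : exists i, (4^-1 : R) ^+ i <= e.
  have h : `|4^-1 : R| < 1 by rewrite ger0_norm ?invr_ge0// invf_lt1// ltr1n.
  have /cvgrPdist_le/(_ e e0)[i _ /(_ i (leqnn i))] := cvg_geometric 1 h.
  rewrite /geometric /= sub0r normrN mul1r => h1; exists i.
  by apply: le_trans h1; rewrite ler_norm.
near=> j; rewrite sub0r normrN ger0_norm ?sqn_ge0//.
apply: le_trans ie; rewrite -lee_fin -enorm2E; last exact: L2B.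
by apply: bound; near: j; exists (s i).
Unshelve. all: by end_near. Qed.

End completeness.

(** * Convergence in mean and bounded operators *)

Section complex_limits.
Context (R : realType).

Definition ccvg (z : nat -> R[i]) (w : R[i]) := (fun k => nsq (z k - w)) @ \oo --> (0 : R).

Lemma cvg0P (v : nat -> R) : (forall k, 0 <= v k) ->
  v @ \oo --> (0 : R) <-> (forall e : R, 0 < e -> exists N, forall k, (N <= k)%N -> v k <= e).
Proof.
move=> v0; rewrite cvgrPdist_le; split=> h e e0.
  have [N _ HN] := h e e0; exists N => k Nk.
  by have := HN k Nk; rewrite /= sub0r normrN ger0_norm.
have [N HN] := h e e0; exists N => // k /= Nk.
by rewrite sub0r normrN ger0_norm//; exact: HN.
Qed.

Lemma cvg0_le (u v : nat -> R) (C : R) : (forall k, 0 <= u k <= C * v k) ->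
  v @ \oo --> (0 : R) -> u @ \oo --> (0 : R).
Proof.
move=> uv v0; apply: (@squeeze_cvgr _ _ _ _ (fun=> 0) (fun k => C * v k)).
- exact: nearW.
- exact: cvg_cst.
- by rewrite -(mulr0 C); apply: cvgM => //; exact: cvg_cst.
Qed.

Lemma ccvgE z w : ccvg z w <->
  ((fun k => complex.Re (z k)) @ \oo --> complex.Re w) /\
  ((fun k => complex.Im (z k)) @ \oo --> complex.Im w).
Proof.
split=> [h|[h1 h2]].
  have aux (f : R[i] -> R) : (forall a b, f (a - b) = f a - f b) ->
      (forall a, (f a) ^+ 2 <= nsq a) -> (fun k => f (z k)) @ \oo --> f w.
    move=> fB fn; apply/cvgrPdist_le => e e0.
    have := h; rewrite /ccvg cvg0P; last by move=> k; exact: nsq_ge0.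
    move=> /(_ (e ^+ 2)); rewrite exprn_gt0// => /(_ isT)[N HN].
    exists N => // k /= Nk; rewrite distrC -fB.
    rewrite -(ger0_norm (ltW e0)) -ler_sqr ?nnegrE// !real_normK ?num_real//.
    exact: le_trans (fn _) (HN k Nk).
  split; apply: aux.
  - by move=> a b; rewrite cReD cReN.
  - by move=> a; rewrite /nsq lerDl sqr_ge0.
  - by move=> a b; rewrite cImD cImN.
  - by move=> a; rewrite /nsq lerDr sqr_ge0.
rewrite /ccvg /nsq -(addr0 (0 : R)).
have sq (v : nat -> R) c : v @ \oo --> c -> (fun k => (v k - c) ^+ 2) @ \oo --> (0 : R).
  move=> vc; rewrite -(mulr0 (0 : R)); under eq_fun do rewrite expr2.
  by apply: cvgM; rewrite -(subrr c); apply: cvgB => //; exact: cvg_cst.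
by apply: cvgD; [under eq_fun do rewrite cReD cReN|under eq_fun do rewrite cImD cImN]; exact: sq.
Qed.

Lemma ccvg_cst w : ccvg (fun=> w) w.
Proof. by rewrite /ccvg subrr nsq0; exact: cvg_cst. Qed.

Lemma ccvgD z z' w w' : ccvg z w -> ccvg z' w' -> ccvg (fun k => z k + z' k) (w + w').
Proof.
move=> h h'; rewrite /ccvg.
apply: (@cvg0_le _ (fun k => nsq (z k - w) + nsq (z' k - w')) 2).
  move=> k; rewrite nsq_ge0 /= mulrDr (_ : _ - _ = (z k - w) + (z' k - w')); last by ring.
  exact: nsqD_le.
by rewrite -(addr0 (0 : R)); exact: cvgD.
Qed.

Lemma ccvgZ a z w : ccvg z w -> ccvg (fun k => a * z k) (a * w).
Proof.
move=> h; rewrite /ccvg; apply: (@cvg0_le _ (fun k => nsq (z k - w)) (nsq a)) => //.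
by move=> k; rewrite nsq_ge0 /= -mulrBr nsqM.
Qed.

Lemma ccvg_sum I (s : seq I) (z : I -> nat -> R[i]) w : (forall i, ccvg (z i) (w i)) ->
  ccvg (fun k => \sum_(i <- s) z i k) (\sum_(i <- s) w i).
Proof.
move=> h; elim: s => [|i s IH].
  by rewrite big_nil; under eq_fun do rewrite big_nil; exact: ccvg_cst.
by rewrite big_cons; under eq_fun do rewrite big_cons; exact: ccvgD.
Qed.

Lemma ccvg_uniq z w w' : ccvg z w -> ccvg z w' -> w = w'.
Proof.
move=> /ccvgE[h1 h2] /ccvgE[h1' h2']; apply: complex_ext.
  exact: (cvg_unique _ h1 h1').
exact: (cvg_unique _ h2 h2').
Qed.

Lemma ccvg_near z z' w N : (forall k, (N <= k)%N -> z k = z' k) -> ccvg z w -> ccvg z' w.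
Proof.
move=> zz; rewrite /ccvg !cvg0P; try by move=> k; exact: nsq_ge0.
move=> h e /h[M HM]; exists (maxn N M) => k; rewrite geq_max => /andP[Nk Mk].
by rewrite -zz//; exact: HM.
Qed.

(** An interchange of limits, used to pass from a total set of vectors to all
    vectors. *)
Lemma ccvg_approx z w : (forall e : R, 0 < e -> exists z' w',
   [/\ ccvg z' w', forall k, nsq (z k - z' k) <= e & nsq (w - w') <= e]) -> ccvg z w.
Proof.
move=> h; rewrite /ccvg cvg0P; last by move=> k; exact: nsq_ge0.
move=> e e0; have e8 : 0 < e / 12 by rewrite divr_gt0.
have [z' [w' [c zz ww]]] := h _ e8.
move: c; rewrite /ccvg cvg0P; last by move=> k; exact: nsq_ge0.
move=> /(_ _ e8)[N HN]; exists N => k Nk.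
rewrite (_ : z k - w = ((z k - z' k) + (z' k - w')) + (w' - w)); last by ring.
apply: le_trans (nsqD_le _ _) _; have := nsqD_le (z k - z' k) (z' k - w').
have := HN k Nk; have := zz k; move: ww; rewrite -nsqN opprB => *; lra.
Qed.

End complex_limits.

Section hilbert.
Context (R : realType) d (T : measurableType d).
Context (mu : {sigma_finite_measure set T -> \bar R}).
Implicit Types f g h : cfun R T.

Definition cvg2 (u : nat -> cfun R T) g := (fun k => sqn mu (fun x => u k x - g x)) @ \oo --> (0 : R).

Lemma sqn_ae2 f g : L2 mu f -> L2 mu g -> ae_equal mu f g -> sqn mu f = sqn mu g.
Proof. by move=> /L2_cmeas mf /L2_cmeas mg; exact: sqn_ae. Qed.

Lemma inner_ael f g h : L2 mu f -> L2 mu g -> L2 mu h -> ae_equal mu f g ->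
  inner mu f h = inner mu g h.
Proof.
by move=> /L2_cmeas mf /L2_cmeas mg /L2_cmeas mh fg; exact: inner_ae (ae_equal_refl mu h).
Qed.

Lemma L2_comb I (s : seq I) (c : I -> R[i]) (F : I -> cfun R T) :
  (forall i, L2 mu (F i)) -> L2 mu (fun x => \sum_(i <- s) c i * F i x).
Proof. by move=> LF; apply: (@L2_sum _ _ _ _ _ s (fun i x => c i * F i x)) => i; exact: L2Z. Qed.

Lemma inner_combl I (s : seq I) (c : I -> R[i]) (F : I -> cfun R T) g :
  (forall i, L2 mu (F i)) -> L2 mu g ->
  inner mu (fun x => \sum_(i <- s) c i * F i x) g = \sum_(i <- s) c i * inner mu (F i) g.
Proof.
move=> LF Lg; rewrite (@inner_suml _ _ _ _ _ s (fun i x => c i * F i x))//.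
  by apply: eq_bigr => i _; rewrite innerZl.
by move=> i; exact: L2Z.
Qed.

Lemma sqnB_tri f g h : L2 mu f -> L2 mu g -> L2 mu h ->
  sqn mu (fun x => f x - h x) <=
  2 * sqn mu (fun x => f x - g x) + 2 * sqn mu (fun x => g x - h x).
Proof.
move=> Lf Lg Lh; rewrite (_ : (fun x => f x - h x) = (fun x => (f x - g x) + (g x - h x))).
  by apply: sqnD_le; exact: L2B.
by apply/funext => x; ring.
Qed.

Lemma sqnB_eq0 f g : L2 mu f -> L2 mu g ->
  sqn mu (fun x => f x - g x) = 0 <-> ae_equal mu f g.
Proof.
move=> Lf Lg; rewrite sqn_eq0; last exact: L2B.
split; apply: filterS => x /= h t; first by apply/eqP; rewrite -subr_eq0 h.
by rewrite h// subrr.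
Qed.

Lemma cvg2_uniq u g h : (forall k, L2 mu (u k)) -> L2 mu g -> L2 mu h ->
  cvg2 u g -> cvg2 u h -> ae_equal mu g h.
Proof.
move=> Lu Lg Lh ug uh; apply/sqnB_eq0 => //; apply/eqP; rewrite eq_le sqn_ge0 andbT.
have c : (fun k => 2 * sqn mu (fun x => u k x - g x) + 2 * sqn mu (fun x => u k x - h x)) @ \oo --> (0 : R).
  by rewrite -(addr0 0); apply: cvgD; rewrite -(mulr0 2); apply: cvgM => //; exact: cvg_cst.
apply: (ler_cvg_to _ c); first exact: cvg_cst.
apply: nearW => k; rewrite (sqnBC _ (u k) g); exact: sqnB_tri.
Qed.

Lemma cvg2_ae u g h : (forall k, L2 mu (u k)) -> L2 mu g -> L2 mu h ->
  ae_equal mu g h -> cvg2 u g -> cvg2 u h.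
Proof.
move=> Lu Lg Lh gh; rewrite /cvg2; suff -> : (fun k => sqn mu (fun x => u k x - g x)) =
  (fun k => sqn mu (fun x => u k x - h x)) by [].
apply/funext => k; apply: sqn_ae.
- by apply: L2_cmeas; exact: L2B.
- by apply: L2_cmeas; exact: L2B.
by apply: filterS gh => x /= h1 t; rewrite h1.
Qed.

Lemma cvg2D u v g h : (forall k, L2 mu (u k)) -> (forall k, L2 mu (v k)) -> L2 mu g -> L2 mu h ->
  cvg2 u g -> cvg2 v h -> cvg2 (fun k x => u k x + v k x) (fun x => g x + h x).
Proof.
move=> Lu Lv Lg Lh ug vh.
apply: (@cvg0_le _ _ (fun k => sqn mu (fun x => u k x - g x) + sqn mu (fun x => v k x - h x)) 2).
  move=> k; rewrite sqn_ge0/= mulrDr.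
  rewrite (_ : (fun x => _) = (fun x => (u k x - g x) + (v k x - h x))).
    by apply: sqnD_le; exact: L2B.
  by apply/funext => x; ring.
by rewrite -(addr0 (0:R)); exact: cvgD.
Qed.

Lemma cvg2Z (a : R[i]) u g : (forall k, L2 mu (u k)) -> L2 mu g ->
  cvg2 u g -> cvg2 (fun k x => a * u k x) (fun x => a * g x).
Proof.
move=> Lu Lg ug.
apply: (@cvg0_le _ _ (fun k => sqn mu (fun x => u k x - g x)) (nsq a)) => // k.
rewrite sqn_ge0/= -sqnZ; last exact: L2B.
by rewrite le_eqVlt; apply/orP; left; apply/eqP; congr sqn; apply/funext => x; rewrite mulrBr.
Qed.

Lemma cvg2_inner u g h : (forall k, L2 mu (u k)) -> L2 mu g -> L2 mu h ->
  cvg2 u g -> ccvg (fun k => inner mu (u k) h) (inner mu g h).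
Proof.
move=> Lu Lg Lh ug; rewrite /ccvg.
apply: (@cvg0_le _ _ (fun k => sqn mu (fun x => u k x - g x)) (sqn mu h)) => // k.
by rewrite nsq_ge0/= -innerBl// mulrC inner_le//; exact: L2B.
Qed.

Lemma cvg2_complete (u : nat -> cfun R T) : (forall k, L2 mu (u k)) ->
  (forall e : R, 0 < e -> exists N, forall j k, (N <= j)%N -> (j <= k)%N ->
     sqn mu (fun x => u j x - u k x) <= e) ->
  exists g, L2 mu g /\ cvg2 u g.
Proof.
move=> Lu cu; apply: L2_complete => // e /cu[N HN]; exists N => j k Nj Nk.
by case: (leqP j k) => [jk|/ltnW kj]; [exact: HN|rewrite sqnBC; exact: HN].
Qed.

Lemma cvg2_cauchy (u : nat -> cfun R T) g : (forall k, L2 mu (u k)) -> L2 mu g -> cvg2 u g ->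
  forall e : R, 0 < e -> exists N, forall j k, (N <= j)%N -> (N <= k)%N ->
     sqn mu (fun x => u j x - u k x) <= e.
Proof.
move=> Lu Lg; rewrite /cvg2 cvg0P; last by move=> k; exact: sqn_ge0.
move=> ug e e0; have [|N HN] := ug (e / 4); first by rewrite divr_gt0.
exists N => j k /HN hj /HN hk; apply: le_trans (sqnB_tri (Lu j) Lg (Lu k)) _.
by rewrite (sqnBC _ g); lra.
Qed.

(** The constant is not sharp, the triangle inequality being replaced by its
    quadratic form [sqnD_le]. *)
Lemma cvg2_sqn_le u g (c : R) : (forall k, L2 mu (u k)) -> L2 mu g -> cvg2 u g ->
  (forall k, sqn mu (u k) <= c) -> sqn mu g <= 4 * c.
Proof.
move=> Lu Lg; rewrite /cvg2 cvg0P; last by move=> k; exact: sqn_ge0.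
move=> ug uc; apply/ler_addgt0Pr => e e0.
have [|N HN] := ug (e / 2); first by rewrite divr_gt0.
rewrite (_ : g = fun x => u N x + (g x - u N x)); last by apply/funext => x; ring.
apply: le_trans (sqnD_le (Lu N) (L2B Lg (Lu N))) _; rewrite sqnBC.
have := HN N (leqnn N); have := uc N; have := sqn_ge0 mu (u N); lra.
Qed.

(** [C] bounds the square of the operator norm. *)
Definition bop_le (C : R) (A : op R T) :=
  forall f, L2 mu f -> sqn mu (A f) <= C * sqn mu f.

Lemma bopP (A : op R T) : bounded_op mu A -> exists2 C, 0 <= C & bop_le C A.
Proof.
move=> [LA _ [C HC]]; exists (`|C| ^+ 2); first exact: sqr_ge0.
move=> f Lf; apply/norm2_leP => //; apply: le_trans (HC f Lf) _.
by apply: ler_wpM2r; [exact: sqrtr_ge0|exact: ler_norm].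
Qed.

Lemma bop_intro (A : op R T) (C : R) : 0 <= C ->
  (forall f, L2 mu f -> L2 mu (A f)) ->
  (forall (a : R[i]) f g, L2 mu f -> L2 mu g ->
        ae_equal mu (A (fun x => a * f x + g x)) (fun x => a * A f x + A g x)) ->
  bop_le C A -> bounded_op mu A.
Proof.
move=> C0 LA linA bA; split=> //; exists (Num.sqrt C) => f Lf.
by apply/norm2_leP; [exact: sqrtr_ge0|rewrite sqr_sqrtr//; exact: bA].
Qed.

Section bounded.
Context (A : op R T) (bA : bounded_op mu A).

Lemma bop_L2 f : L2 mu f -> L2 mu (A f). Proof. by case: bA => + _ _; exact. Qed.

Lemma bop_lin (a : R[i]) f g : L2 mu f -> L2 mu g ->
  ae_equal mu (A (fun x => a * f x + g x)) (fun x => a * A f x + A g x).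
Proof. by case: bA => _ + _; exact. Qed.

Lemma bop_B0 f g : L2 mu f -> L2 mu g ->
  ae_equal mu (A (fun x => -1 * g x + f x)) (fun x => A f x - A g x).
Proof.
move=> Lf Lg; apply: ae_equal_trans (bop_lin _ Lg Lf) _.
by apply: aeW => x _; rewrite mulN1r addrC.
Qed.

Lemma bop_B f g : L2 mu f -> L2 mu g ->
  ae_equal mu (A (fun x => f x - g x)) (fun x => A f x - A g x).
Proof.
move=> Lf Lg; have := bop_B0 Lf Lg; congr ae_equal; congr A.
by apply/funext => x; rewrite mulN1r addrC.
Qed.

(** Operators are functions on functions; boundedness applied to the difference
    makes them well defined on classes modulo null sets. *)
Lemma bop_ae f g : L2 mu f -> L2 mu g -> ae_equal mu f g -> ae_equal mu (A f) (A g).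
Proof.
move=> Lf Lg fg; apply/sqnB_eq0; [exact: bop_L2|exact: bop_L2|].
have [C C0 bC] := bopP bA.
rewrite -(sqn_ae _ _ (bop_B Lf Lg)); last 2 first.
- by apply/L2_cmeas/bop_L2/L2B.
- by apply/L2_cmeas/L2B; exact: bop_L2.
apply/eqP; rewrite eq_le sqn_ge0 andbT; apply: le_trans (bC _ _) _; first exact: L2B.
by rewrite (sqnB_eq0 Lf Lg).2// mulr0.
Qed.

Lemma bop_0 : ae_equal mu (A (fun=> 0)) (fun=> 0).
Proof.
have L0 := L2_0 mu; have := bop_B L0 L0.
rewrite (_ : (fun x => 0 - 0) = fun=> 0); last by apply/funext => x; rewrite subrr.
by move/ae_equal_trans; apply; apply: aeW => x _; rewrite subrr.
Qed.

Lemma bop_Z (a : R[i]) f : L2 mu f -> ae_equal mu (A (fun x => a * f x)) (fun x => a * A f x).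
Proof.
move=> Lf; have := bop_lin a Lf (L2_0 mu).
rewrite (_ : (fun x => a * f x + 0) = fun x => a * f x); last by apply/funext => x; rewrite addr0.
move/ae_equal_trans; apply; apply: filterS bop_0 => x /= h t.
by rewrite h// addr0.
Qed.

Lemma bop_lincomb I (s : seq I) (a : I -> R[i]) (F : I -> cfun R T) :
  (forall i, L2 mu (F i)) ->
  ae_equal mu (A (fun x => \sum_(i <- s) a i * F i x)) (fun x => \sum_(i <- s) a i * A (F i) x).
Proof.
move=> LF; elim: s => [|i s IH].
  by under eq_fun do rewrite big_nil; under [X in ae_equal _ _ X]eq_fun do rewrite big_nil; exact: bop_0.
under eq_fun do rewrite big_cons; under [X in ae_equal _ _ X]eq_fun do rewrite big_cons.
apply: ae_equal_trans (bop_lin _ (LF i) _) _.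
  by apply: L2_sum => j; exact: L2Z.
by apply: filterS IH => x /= h t; rewrite h.
Qed.

Lemma bop_cvg2 u g : (forall k, L2 mu (u k)) -> L2 mu g -> cvg2 u g ->
  cvg2 (fun k => A (u k)) (A g).
Proof.
move=> Lu Lg ug; have [C C0 bC] := bopP bA.
apply: (@cvg0_le _ _ (fun k => sqn mu (fun x => u k x - g x)) C) => // k.
rewrite sqn_ge0/=; apply: le_trans (bC _ (L2B (Lu k) Lg)).
rewrite (sqn_ae _ _ (bop_B (Lu k) Lg)) ?lexx//.
  by apply/L2_cmeas/bop_L2/L2B.
by apply/L2_cmeas/L2B; exact: bop_L2.
Qed.

Lemma bop_inner_comb I (s : seq I) (c : I -> R[i]) (F : I -> cfun R T) g :
  (forall i, L2 mu (F i)) -> L2 mu g ->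
  inner mu (A (fun x => \sum_(i <- s) c i * F i x)) g = \sum_(i <- s) c i * inner mu (A (F i)) g.
Proof.
move=> LF Lg; have LAF i : L2 mu (A (F i)) by exact: bop_L2.
rewrite -(inner_combl _ _ LAF)//; apply: inner_ael => //.
- by apply: bop_L2; exact: L2_comb.
- exact: L2_comb.
- exact: bop_lincomb.
Qed.

End bounded.

Lemma bop_comp A B : bounded_op mu A -> bounded_op mu B -> bounded_op mu (A \o B).
Proof.
move=> bA bB; have [C C0 hC] := bopP bA; have [D D0 hD] := bopP bB.
apply: (@bop_intro _ (C * D)); first exact: mulr_ge0.
- by move=> f Lf /=; apply: bop_L2 => //; exact: bop_L2.
- move=> a f g Lf Lg /=; have LBf := bop_L2 bB Lf; have LBg := bop_L2 bB Lg.
  apply: ae_equal_trans (bop_lin bA a LBf LBg).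
  apply: bop_ae => //; last exact: bop_lin.
    by apply: bop_L2 => //; apply: L2D => //; exact: L2Z.
  by apply: L2D => //; exact: L2Z.
- move=> f Lf /=; apply: le_trans (hC _ (bop_L2 bB Lf)) _.
  by rewrite -mulrA ler_wpM2l//; exact: hD.
Qed.

Lemma bop_id : bounded_op mu id.
Proof.
apply: (@bop_intro _ 1) => //; first by move=> *; exact: ae_equal_refl.
by move=> f _; rewrite mul1r.
Qed.

Lemma op_eq_refl A : op_eq mu A A.
Proof. by move=> f _; exact: ae_equal_refl. Qed.
Lemma op_eq_sym A B : op_eq mu A B -> op_eq mu B A.
Proof. by move=> h f Lf; apply: ae_equal_sym; exact: h. Qed.
Lemma op_eq_trans A B C : op_eq mu A B -> op_eq mu B C -> op_eq mu A C.
Proof. by move=> h1 h2 f Lf; exact: ae_equal_trans (h1 f Lf) (h2 f Lf). Qed.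

Lemma op_eq_comp A A' B B' : bounded_op mu A' -> bounded_op mu B -> bounded_op mu B' ->
  op_eq mu A A' -> op_eq mu B B' -> op_eq mu (A \o B) (A' \o B').
Proof.
move=> bA' bB bB' AA BB f Lf /=.
apply: ae_equal_trans (AA _ (bop_L2 bB Lf)) _.
by apply: bop_ae; [|exact: bop_L2|exact: bop_L2|exact: BB].
Qed.

Lemma bop_eq A B : bounded_op mu A -> op_eq mu A B -> (forall f, L2 mu f -> L2 mu (B f)) ->
  bounded_op mu B.
Proof.
move=> bA AB LB; have [C C0 hC] := bopP bA; apply: (@bop_intro _ C) => //.
  move=> a f g Lf Lg; have Lfg : L2 mu (fun x => a * f x + g x) by apply: L2D => //; exact: L2Z.
  apply: ae_equal_trans (ae_equal_sym (AB _ Lfg)) _.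
  apply: ae_equal_trans (bop_lin bA _ Lf Lg) _.
  exact: (@ae_equal_map2 _ _ _ _ (fun _ u v => a * u + v) _ _ _ _ (AB _ Lf) (AB _ Lg)).
move=> f Lf; rewrite -(sqn_ae _ _ (AB f Lf)); first exact: hC.
  exact/L2_cmeas/bop_L2.
exact/L2_cmeas/LB.
Qed.

End hilbert.

(** * Orthonormal expansions *)

Section orthonormal.
Context (R : realType) d (T : measurableType d).
Context (mu : {sigma_finite_measure set T -> \bar R}).
Implicit Types f g h : cfun R T.

(** Entries are allowed to vanish: Gram-Schmidt and pairing functions then need
   no reindexing. *)
Definition onb (e : nat -> cfun R T) :=
  [/\ forall i, L2 mu (e i),
      forall i j, i != j -> inner mu (e i) (e j) = 0,
      forall i, sqn mu (e i) = 0 \/ sqn mu (e i) = 1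
    & forall f, L2 mu f -> (forall i, inner mu f (e i) = 0) -> ae_equal mu f (fun=> 0)].

Section expansion.
Context (e : nat -> cfun R T) (eP : onb e).

Lemma onb_L2 i : L2 mu (e i). Proof. by case: eP. Qed.
Hint Resolve onb_L2 : core.

Definition proj k f : cfun R T := fun x => \sum_(i < k) inner mu f (e i) * e i x.

Lemma L2_lincomb k (c : nat -> R[i]) : L2 mu (fun x => \sum_(i < k) c i * e i x).
Proof. by apply: (L2_comb _ (fun i : 'I_k => c i) (F := fun i : 'I_k => e i)). Qed.

Lemma L2_proj k f : L2 mu (proj k f). Proof. exact: (L2_lincomb k (fun i => inner mu f (e i))). Qed.

Lemma inner_e0 f i : L2 mu f -> sqn mu (e i) = 0 -> inner mu f (e i) = 0.
Proof.
move=> Lf e0; apply: nsq_eq0; apply/eqP; rewrite eq_le nsq_ge0 andbT.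
by apply: le_trans (inner_le Lf (onb_L2 i)) _; rewrite e0 mulr0.
Qed.

Lemma inner_lincomb k (c : nat -> R[i]) j : inner mu (fun x => \sum_(i < k) c i * e i x) (e j) =
  if (j < k)%N then c j * (sqn mu (e j))%:C%C else 0.
Proof.
rewrite (inner_combl _ (fun i : 'I_k => c i) (F := fun i : 'I_k => e i))//.
case: ltnP => [jk|kj].
  rewrite (bigD1 (Ordinal jk))//= big1 ?addr0 ?inner_diag// => i ij.
  by case: eP => _ h _ _; rewrite h ?mulr0//; move: ij; rewrite -(inj_eq val_inj).
rewrite big1// => i _; case: eP => _ h _ _; rewrite h ?mulr0//.
by rewrite neq_ltn (leq_trans (ltn_ord i) kj).
Qed.

Lemma sqn_e_idem f j : L2 mu f -> inner mu f (e j) * (sqn mu (e j))%:C%C = inner mu f (e j).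
Proof.
move=> Lf; case: eP => _ _ /(_ j)[e0|e1] _; last by rewrite e1 mulr1.
by rewrite (inner_e0 Lf e0) mul0r.
Qed.

Lemma inner_proj k f j : L2 mu f ->
  inner mu (proj k f) (e j) = if (j < k)%N then inner mu f (e j) else 0.
Proof. by move=> Lf; rewrite (inner_lincomb k (fun i => inner mu f (e i))) sqn_e_idem. Qed.

Lemma sqn_lincomb k (c : nat -> R[i]) :
  sqn mu (fun x => \sum_(i < k) c i * e i x) = \sum_(i < k) nsq (c i) * sqn mu (e i).
Proof.
elim: k => [|k IH].
  by under eq_fun do rewrite big_ord0; rewrite sqn0 big_ord0.
under eq_fun do rewrite big_ord_recr/=.
rewrite sqnD; [|exact: L2_lincomb|exact: L2Z].
rewrite IH sqnZ// (innerZr (c k) (onb_L2 k) (L2_lincomb k c)).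
by rewrite inner_lincomb ltnn mulr0 -[complex.Re 0]/(0 : R) mulr0 addr0 big_ord_recr.
Qed.

Lemma sqn_proj k f : L2 mu f -> sqn mu (proj k f) = \sum_(i < k) nsq (inner mu f (e i)).
Proof.
move=> Lf; rewrite (sqn_lincomb k (fun i => inner mu f (e i))); apply: eq_bigr => i _.
case: eP => _ _ /(_ i)[e0|e1] _; last by rewrite e1 mulr1.
by rewrite (inner_e0 Lf e0) nsq0 mul0r.
Qed.

Lemma inner_proj_self k f : L2 mu f -> inner mu f (proj k f) = (sqn mu (proj k f))%:C%C.
Proof.
move=> Lf; rewrite innerC//; last exact: L2_proj.
rewrite (inner_combl _ (fun i : 'I_k => inner mu f (e i)) (F := fun i : 'I_k => e i))//.
rewrite sqn_proj// [in RHS]rmorph_sum [LHS]rmorph_sum /=; apply: eq_bigr => i _.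
by rewrite (innerC Lf)// rmorphM/= conjCK mulrC mulcJ.
Qed.

Lemma sqn_proj_compl k f : L2 mu f ->
  sqn mu (fun x => f x - proj k f x) = sqn mu f - sqn mu (proj k f).
Proof.
move=> Lf; have Lp := L2_proj k f.
rewrite sqnD ?sqnN//; last exact: L2N.
rewrite innerNr// inner_proj_self// cReN /=; ring.
Qed.

Lemma bessel k f : L2 mu f -> \sum_(i < k) nsq (inner mu f (e i)) <= sqn mu f.
Proof. by move=> Lf; rewrite -sqn_proj// -subr_ge0 -sqn_proj_compl// sqn_ge0. Qed.

Lemma sqn_proj_le k f : L2 mu f -> sqn mu (proj k f) <= sqn mu f.
Proof. by move=> Lf; rewrite sqn_proj// bessel. Qed.

Lemma lincombB j k (c : nat -> R[i]) : (j <= k)%N -> forall x,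
  (\sum_(i < k) c i * e i x) - \sum_(i < j) c i * e i x =
  \sum_(i < k) (if (i < j)%N then 0 else c i) * e i x.
Proof.
move=> jk x; rewrite (big_ord_widen k (fun i => c i * e i x) jk).
rewrite [X in _ - X]big_mkcond -sumrB; apply: eq_bigr => i _ /=.
by case: ifP => _; rewrite ?subrr ?mul0r ?subr0.
Qed.

(** The Riesz-Fischer theorem; the partial sums are Cauchy by orthogonality. *)
Lemma cvg2_lincomb (c : nat -> R[i]) (M : R) :
  (forall k, \sum_(i < k) nsq (c i) <= M) ->
  exists g, L2 mu g /\ cvg2 mu (fun k x => \sum_(i < k) c i * e i x) g.
Proof.
move=> cM; apply: cvg2_complete; first by move=> k; exact: L2_lincomb.
move=> ep ep0; pose s k := \sum_(i < k) nsq (c i).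
have s_nd : nondecreasing_seq s.
  by apply/nondecreasing_seqP => k; rewrite /s big_ord_recr/= lerDl nsq_ge0.
have cs : cvgn s by apply: nondecreasing_is_cvgn => //; exists M => _ [k _ <-]; exact: cM.
have /cvgrPdist_le/(_ _ ep0)[N _ HN] := cs.
exists N => j k Nj jk; rewrite sqnBC.
under eq_fun do rewrite lincombB//.
rewrite (sqn_lincomb k (fun i => if (i < j)%N then 0 else c i)); apply: (@le_trans _ _ (s k - s j)).
  rewrite /s (big_ord_widen k (fun i => nsq (c i)) jk).
  rewrite [X in _ - X]big_mkcond -sumrB; apply: ler_sum => i _ /=.
  case: ifP => _; first by rewrite nsq0 mul0r subrr.
  rewrite subr0 ler_piMr ?nsq_ge0//.
  by case: eP => _ _ /(_ i)[->|->] _.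
have := HN j Nj; rewrite /= ler_norml => /andP[_]; apply: le_trans.
by apply: lerB => //; apply: nondecreasing_cvgn_le.
Qed.

(** The limit of the expansion exists by [cvg2_lincomb] and has the coefficients
    of [f], so totality identifies it with [f]. *)
Lemma proj_cvg2 f : L2 mu f -> cvg2 mu (fun k => proj k f) f.
Proof.
move=> Lf; have [g [Lg pg]] := @cvg2_lincomb (fun i => inner mu f (e i)) _ (fun k => bessel k Lf).
have fg : ae_equal mu f g.
  apply/sqnB_eq0 => //; apply/sqn_eq0; first exact: L2B.
  case: eP => _ _ _; apply; first exact: L2B.
  move=> i; rewrite innerBl//; apply/eqP; rewrite subr_eq0; apply/eqP.
  apply: ccvg_uniq (cvg2_inner _ Lg (onb_L2 i) pg); last by move=> k; exact: L2_proj.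
  apply: (@ccvg_near _ (fun=> inner mu f (e i)) _ _ i.+1); last exact: ccvg_cst.
  by move=> k ik; rewrite -[RHS]/(inner mu (proj k f) (e i)) inner_proj// ik.
apply: cvg2_ae pg => //; last exact: ae_equal_sym.
by move=> k; exact: L2_proj.
Qed.

Lemma op_eq_onb A B : bounded_op mu A -> bounded_op mu B ->
  (forall i, ae_equal mu (A (e i)) (B (e i))) -> op_eq mu A B.
Proof.
move=> bA bB AB f Lf; have Lp k := L2_proj k f.
have cA := bop_cvg2 bA Lp Lf (proj_cvg2 Lf); have cB := bop_cvg2 bB Lp Lf (proj_cvg2 Lf).
apply: (cvg2_uniq _ _ _ cA); [by move=> k; exact: bop_L2|exact: bop_L2|exact: bop_L2|].
have : forall k, ae_equal mu (A (proj k f)) (B (proj k f)).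
  move=> k; rewrite /proj.
  apply: ae_equal_trans (bop_lincomb bA _ _ _) _ => //.
  apply: ae_equal_sym; apply: ae_equal_trans (bop_lincomb bB _ _ _) _ => //.
  have : forall s : seq 'I_k, ae_equal mu (fun x => \sum_(i <- s) inner mu f (e i) * B (e i) x)
     (fun x => \sum_(i <- s) inner mu f (e i) * A (e i) x).
    elim=> [|i s IH].
      by apply: aeW => x _; rewrite !big_nil.
    by have := AB i; apply: filterS2 IH => x /= h1 h2 t; rewrite !big_cons h1// h2.
  by move=> /(_ (index_enum _)).
move=> ABp; rewrite /cvg2; rewrite (_ : (fun k => _) = (fun k => sqn mu (fun x => B (proj k f) x - B f x))) //.
apply/funext => k; apply: sqn_ae2; [by apply: L2B; exact: bop_L2|by apply: L2B; exact: bop_L2|].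
by apply: filterS (ABp k) => x /= h t; rewrite h.
Qed.

Lemma ccvg_onb_r (u : nat -> cfun R T) v (C : R) g : 0 <= C ->
  (forall k, L2 mu (u k)) -> L2 mu v -> (forall k, sqn mu (u k) <= C) -> sqn mu v <= C ->
  (forall j, ccvg (fun k => inner mu (u k) (e j)) (inner mu v (e j))) ->
  L2 mu g -> ccvg (fun k => inner mu (u k) g) (inner mu v g).
Proof.
move=> C0 Lu Lv uC vC ue Lg; apply: ccvg_approx => ep ep0.
have := proj_cvg2 Lg; rewrite /cvg2 cvg0P; last by move=> k; exact: sqn_ge0.
have C1 : 0 < C + 1 by rewrite ltr_wpDl.
move=> /(_ (ep / (C + 1))); rewrite divr_gt0// => /(_ isT)[N /(_ N (leqnn N)) hN].
have Lp := L2_proj N g.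
exists (fun k => inner mu (u k) (proj N g)), (inner mu v (proj N g)).
have key w : L2 mu w -> sqn mu w <= C -> nsq (inner mu w g - inner mu w (proj N g)) <= ep.
  move=> Lw wC; rewrite -innerBr//; apply: le_trans (inner_le Lw (L2B Lg Lp)) _.
  rewrite sqnBC; apply: (@le_trans _ _ ((C + 1) * (ep / (C + 1)))).
    apply: ler_pM => //; try exact: sqn_ge0.
    by apply: le_trans wC _; rewrite lerDl.
  by rewrite mulrC divfK// gt_eqF.
split=> [|k|]; [|exact: key|exact: key].
have E w : L2 mu w -> inner mu w (proj N g) = \sum_(i < N) (inner mu g (e i))^* * inner mu w (e i).
  move=> Lw; rewrite innerC//.
  rewrite (inner_combl _ (fun i : 'I_N => inner mu g (e i)) (F := fun i : 'I_N => e i))//.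
  rewrite rmorph_sum; apply: eq_bigr => i _; rewrite rmorphM/=; congr (_ * _).
  by rewrite [RHS]innerC.
rewrite E//; under eq_fun do rewrite E//.
by apply: (@ccvg_sum _ _ _ (fun (i : 'I_N) k => (inner mu g (e i))^* * inner mu (u k) (e i))
  (fun i : 'I_N => (inner mu g (e i))^* * inner mu v (e i))) => i; exact: ccvgZ.
Qed.

(** Along bounded sequences weak convergence is tested on matrix coefficients:
    first the second argument, then the first, is approximated by its
    expansion, uniformly in [k]. *)
Lemma wot_onb (Ak : nat -> op R T) A (C : R) : 0 <= C ->
  (forall k, bounded_op mu (Ak k)) -> (forall k, bop_le mu C (Ak k)) ->
  bounded_op mu A ->
  (forall i j, ccvg (fun k => inner mu (Ak k (e i)) (e j)) (inner mu (A (e i)) (e j))) ->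
  forall f g, L2 mu f -> L2 mu g ->
    ccvg (fun k => inner mu (Ak k f) g) (inner mu (A f) g).
Proof.
move=> C0 bAk hAk bA AkA f g Lf Lg.
have [D D0 hA] := bopP bA.
pose M := C + D; have M0 : 0 <= M by rewrite addr_ge0.
have hAk' k : bop_le mu M (Ak k).
  move=> h Lh; apply: le_trans (hAk k h Lh) _.
  by rewrite ler_wpM2r ?sqn_ge0// lerDl.
have hA' : bop_le mu M A.
  move=> h Lh; apply: le_trans (hA h Lh) _.
  by rewrite ler_wpM2r ?sqn_ge0// lerDr.
have step1 i : ccvg (fun k => inner mu (Ak k (e i)) g) (inner mu (A (e i)) g).
  apply: (@ccvg_onb_r _ _ (M * sqn mu (e i))) => //.
  - by rewrite mulr_ge0 ?sqn_ge0.
  - by move=> k; exact: bop_L2.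
  - exact: bop_L2.
  - by move=> k; exact: hAk'.
  - exact: hA'.
apply: ccvg_approx => ep ep0.
have := proj_cvg2 Lf; rewrite /cvg2 cvg0P; last by move=> k; exact: sqn_ge0.
have C1 : 0 < M * sqn mu g + 1 by rewrite ltr_wpDl// mulr_ge0 ?sqn_ge0.
move=> /(_ (ep / (M * sqn mu g + 1))); rewrite divr_gt0// => /(_ isT)[N /(_ N (leqnn N)) hN].
have Lp := L2_proj N f.
exists (fun k => inner mu (Ak k (proj N f)) g), (inner mu (A (proj N f)) g).
have key B : bounded_op mu B -> bop_le mu M B ->
    nsq (inner mu (B f) g - inner mu (B (proj N f)) g) <= ep.
  move=> bB hB; rewrite -innerBl//; try exact: bop_L2.
  rewrite -(inner_ael _ _ Lg (bop_B bB Lf Lp)); last 2 first.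
  - exact: bop_L2 (L2B Lf Lp).
  - by apply: L2B; exact: bop_L2.
  apply: le_trans (inner_le (bop_L2 bB (L2B Lf Lp)) Lg) _.
  apply: (@le_trans _ _ ((M * sqn mu g) * (ep / (M * sqn mu g + 1)))).
    rewrite mulrAC ler_wpM2r ?sqn_ge0//; apply: le_trans (hB _ (L2B Lf Lp)) _.
    by rewrite ler_wpM2l// sqnBC.
  rewrite mulrCA mulrC -[leRHS]mul1r ler_wpM2r ?(ltW ep0)// ler_pdivrMr// mul1r lerDl//.
split=> [|k|]; [|exact: key|exact: key].
have E B : bounded_op mu B ->
    inner mu (B (proj N f)) g = \sum_(i < N) inner mu f (e i) * inner mu (B (e i)) g.
  by move=> bB; exact: (bop_inner_comb bB _ (fun i : 'I_N => inner mu f (e i)) (F := fun i : 'I_N => e i)).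
rewrite E//; under eq_fun do rewrite E//.
by apply: (@ccvg_sum _ _ _ (fun (i : 'I_N) k => inner mu f (e i) * inner mu (Ak k (e i)) g)
  (fun i : 'I_N => inner mu f (e i) * inner mu (A (e i)) g)) => i; exact: ccvgZ.
Qed.

Lemma adjoint_onb A B : bounded_op mu A -> bounded_op mu B ->
  (forall i j, inner mu (A (e i)) (e j) = inner mu (e i) (B (e j))) -> is_adjoint mu A B.
Proof.
move=> bA bB AB; split=> // f g Lf Lg.
(* both sides are limits along the expansions of [f] and then of [g] *)
have step1 i : inner mu (A (e i)) g = inner mu (e i) (B g).
  have Lpg k := L2_proj k g.
  have c1 : ccvg (fun k => inner mu (proj k g) (A (e i))) (inner mu g (A (e i))).
    by apply: cvg2_inner (proj_cvg2 Lg) => //; exact: bop_L2.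
  have c2 : ccvg (fun k => inner mu (B (proj k g)) (e i)) (inner mu (B g) (e i)).
    apply: cvg2_inner => //; [by move=> k; exact: bop_L2|exact: bop_L2|].
    by apply: bop_cvg2 => //; exact: proj_cvg2.
  rewrite innerC//; last exact: bop_L2.
  rewrite [RHS]innerC//; last exact: bop_L2.
  apply: congr1; apply: ccvg_uniq c1 _.
  rewrite (_ : (fun k => inner mu (proj k g) (A (e i))) =
    (fun k => inner mu (B (proj k g)) (e i)))//.
  apply/funext => k.
  rewrite (bop_inner_comb bB _ (fun j : 'I_k => inner mu g (e j)) (F := fun j : 'I_k => e j))//.
  rewrite (inner_combl _ (fun j : 'I_k => inner mu g (e j)) (F := fun j : 'I_k => e j))//; last exact: bop_L2.
  apply: eq_bigr => j _; congr (_ * _).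
  by rewrite innerC ?AB -?innerC//; exact: bop_L2.
have Lpf k := L2_proj k f.
have c1 : ccvg (fun k => inner mu (A (proj k f)) g) (inner mu (A f) g).
  apply: cvg2_inner => //; [by move=> k; exact: bop_L2|exact: bop_L2|].
  by apply: bop_cvg2 => //; exact: proj_cvg2.
have c2 : ccvg (fun k => inner mu (proj k f) (B g)) (inner mu f (B g)).
  by apply: cvg2_inner (proj_cvg2 Lf) => //; exact: bop_L2.
apply: ccvg_uniq c1 _.
rewrite (_ : (fun k => inner mu (A (proj k f)) g) = (fun k => inner mu (proj k f) (B g)))//.
apply/funext => k.
rewrite (bop_inner_comb bA _ (fun j : 'I_k => inner mu f (e j)) (F := fun j : 'I_k => e j))//.
rewrite (inner_combl _ (fun j : 'I_k => inner mu f (e j)) (F := fun j : 'I_k => e j))//; last exact: bop_L2.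
by apply: eq_bigr => j _; rewrite step1.
Qed.

End expansion.
End orthonormal.

(** * Product measures, changes of variables and total sequences *)

Section parameter_integrals.
Context (R : realType) d1 d2 (X : measurableType d1) (Y : measurableType d2).
Context (mu : {sigma_finite_measure set X -> \bar R}).
Context (nu : {sigma_finite_measure set Y -> \bar R}).

Lemma measurable_param_integral (k : X * Y -> R) : measurable_fun setT k ->
  measurable_fun setT (fun x => \int[nu]_y (k (x, y))).
Proof.
move=> mk; have mk' : measurable_fun setT (EFin \o k) by exact/measurable_EFinP.
rewrite /Rintegral; apply: (measurableT_comp (fine_measurable measurableT)).
under eq_fun do rewrite integralE.
apply: emeasurable_funB.
  rewrite (_ : (fun x => _) = fubini_F nu (EFin \o k)^\+%E).
    apply: measurable_fun_fubini_tonelli_F; first exact: measurable_funepos.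
    by move=> x; exact: funepos_ge0.
  by apply/funext => x; apply: eq_integral => y _; rewrite !funeposE.
rewrite (_ : (fun x => _) = fubini_F nu (EFin \o k)^\-%E).
  apply: measurable_fun_fubini_tonelli_F; first exact: measurable_funeneg.
  by move=> x; exact: funeneg_ge0.
by apply/funext => x; apply: eq_integral => y _; rewrite !funenegE.
Qed.

Lemma cmeas_param_cint (k : cfun R (X * Y)%type) : cmeas k ->
  cmeas (fun x => cint nu (fun y => k (x, y))).
Proof.
move=> [k1 k2]; split => /=.
  exact: (@measurable_param_integral (fun p => complex.Re (k p))).
exact: (@measurable_param_integral (fun p => complex.Im (k p))).
Qed.

Lemma cmeas_slice (k : cfun R (X * Y)%type) x : cmeas k -> cmeas (fun y => k (x, y)).
Proof. by move=> mk; apply: (cmeas_comp (h := fun y => (x, y))) => //; exact: measurable_pair1. Qed.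

Lemma enorm2_sprod (f : cfun R (X * Y)%type) : cmeas f ->
  enorm2 (sprod mu nu) f = (\int[mu]_x enorm2 nu (fun y => f (x, y)))%E.
Proof.
move=> mf; rewrite /enorm2 /sprod fubini_tonelli1//; first exact: measurable_ensq.
by move=> x; rewrite lee_fin nsq_ge0.
Qed.

Lemma enorm2_sprod_r (f : cfun R (X * Y)%type) : cmeas f ->
  enorm2 (sprod mu nu) f = (\int[nu]_y enorm2 mu (fun x => f (x, y)))%E.
Proof.
move=> mf; rewrite /enorm2 /sprod fubini_tonelli2//; first exact: measurable_ensq.
by move=> x; rewrite lee_fin nsq_ge0.
Qed.

Lemma measurable_enorm2_slice (f : cfun R (X * Y)%type) : cmeas f ->
  measurable_fun setT (fun x => enorm2 nu (fun y => f (x, y))).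
Proof.
move=> mf; apply: (@measurable_fun_fubini_tonelli_F _ _ _ _ _ nu (fun p => (nsq (f p))%:E)).
  exact: measurable_ensq.
by move=> x; rewrite lee_fin nsq_ge0.
Qed.

Lemma measurable_enorm2_slice_r (f : cfun R (X * Y)%type) : cmeas f ->
  measurable_fun setT (fun y => enorm2 mu (fun x => f (x, y))).
Proof.
move=> mf; apply: (@measurable_fun_fubini_tonelli_G _ _ _ _ _ mu (fun p => (nsq (f p))%:E)).
  exact: measurable_ensq.
by move=> x; rewrite lee_fin nsq_ge0.
Qed.

Lemma L2_slice (f : cfun R (X * Y)%type) : L2 (sprod mu nu) f ->
  {ae mu, forall x, L2 nu (fun y => f (x, y))}.
Proof.
move=> /L2P[mf oo]; have mN := measurable_enorm2_slice mf.
have iN : mu.-integrable setT (fun x => enorm2 nu (fun y => f (x, y))).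
  apply/integrableP; split=> //; rewrite enorm2_sprod// in oo.
  by under eq_integral do rewrite gee0_abs ?enorm2_ge0//.
have := integrable_ae measurableT iN; apply: filterS => x /(_ I) h.
apply/L2P; split; first exact: cmeas_slice.
by rewrite -ge0_fin_numE ?enorm2_ge0.
Qed.

(** Tonelli: the norm is the integral of the norms of the slices. *)
Lemma ae_sprod_L2 (f : cfun R (X * Y)%type) : L2 (sprod mu nu) f ->
  {ae mu, forall x, ae_equal nu (fun y => f (x, y)) (fun=> 0)} ->
  ae_equal (sprod mu nu) f (fun=> 0).
Proof.
move=> Lf f0; apply/sqn_eq0 => //; rewrite sqnE// enorm2_sprod; last exact: (L2_cmeas Lf).
rewrite (ae_eq_integral (cst 0%E))//.
- by rewrite integral0.
- by apply: measurable_enorm2_slice; exact: (L2_cmeas Lf).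
have := L2_slice Lf; apply: filterS2 f0 => x h Lx _.
by rewrite enorm2E//; congr EFin; apply/sqn_eq0.
Qed.

Lemma Rintegral_fubini (k : X * Y -> R) : (sprod mu nu).-integrable setT (EFin \o k) ->
  \int[sprod mu nu]_p k p = \int[mu]_x \int[nu]_y k (x, y).
Proof.
move=> ik; rewrite {1}/Rintegral /sprod -integral12_prod_meas1// /Rintegral; congr fine.
have iF := integrable_fubini_F ik.
have mk : measurable_fun setT k by have /integrableP[/measurable_EFinP] := ik.
apply: ae_eq_integral => //.
- exact: measurable_int iF.
- by apply/measurable_EFinP; exact: measurable_param_integral.
have := integrable_ae measurableT iF; apply: filterS => x /(_ I) h _.
by rewrite fineK.
Qed.

Lemma cint_fubini (k : cfun R (X * Y)%type) : cintegrable (sprod mu nu) k ->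
  cint (sprod mu nu) k = cint mu (fun x => cint nu (fun y => k (x, y))).
Proof.
by move=> [k1 k2]; apply: complex_ext => /=; rewrite Rintegral_fubini.
Qed.

Lemma cmeas_ftens (f : cfun R X) (g : cfun R Y) : cmeas f -> cmeas g -> cmeas (ftens f g).
Proof.
move=> mf mg; apply: cmeasM.
  by apply: (cmeas_comp (h := fst)).
by apply: (cmeas_comp (h := snd)).
Qed.

Lemma enorm2_ftens (f : cfun R X) (g : cfun R Y) : L2 mu f -> L2 nu g ->
  enorm2 (sprod mu nu) (ftens f g) = (enorm2 mu f * enorm2 nu g)%E.
Proof.
move=> Lf Lg; have mf := L2_cmeas Lf; have mg := L2_cmeas Lg.
rewrite enorm2_sprod; last exact: cmeas_ftens.
rewrite /ftens /=; under eq_integral do rewrite enorm2Z//.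
rewrite enorm2E// ge0_integralZr ?lee_fin ?sqn_ge0//; first exact: measurable_ensq.
by move=> x _; rewrite lee_fin nsq_ge0.
Qed.

Lemma L2_ftens (f : cfun R X) (g : cfun R Y) : L2 mu f -> L2 nu g ->
  L2 (sprod mu nu) (ftens f g).
Proof.
move=> Lf Lg; apply/L2P; split.
  exact: cmeas_ftens (L2_cmeas Lf) (L2_cmeas Lg).
by rewrite enorm2_ftens// !enorm2E// -EFinM ltry.
Qed.

Lemma sqn_ftens (f : cfun R X) (g : cfun R Y) : L2 mu f -> L2 nu g ->
  sqn (sprod mu nu) (ftens f g) = sqn mu f * sqn nu g.
Proof.
by move=> Lf Lg; rewrite sqnE ?enorm2_ftens// ?enorm2E//; exact: L2_ftens.
Qed.

(** Fubini; so the totality of a product basis is tested one factor at a time. *)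
Lemma inner_ftens_slice (k : cfun R (X * Y)%type) (f : cfun R X) (g : cfun R Y) :
  L2 (sprod mu nu) k -> L2 mu f -> L2 nu g ->
  inner (sprod mu nu) k (ftens f g) =
  inner mu (fun x => inner nu (fun y => k (x, y)) g) f.
Proof.
move=> Lk Lf Lg; rewrite /inner cint_fubini; last first.
  by apply: cintegrable_inner => //; exact: L2_ftens.
have mk := L2_cmeas Lk; have mf := L2_cmeas Lf; have mg := L2_cmeas Lg.
apply: cint_ae.
- apply: (cmeas_param_cint (k := fun p => k p * (ftens f g p)^*)).
  by apply: cmeasM => //; apply: cmeasJ; exact: cmeas_ftens.
- apply: cmeasM; last exact: cmeasJ.
  apply: (cmeas_param_cint (k := fun p => k p * (g p.2)^*)).
  by apply: cmeasM => //; apply: cmeasJ; apply: (cmeas_comp (h := snd)).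
have := L2_slice Lk; apply: filterS => x Lx _.
rewrite [RHS]mulrC -cintZ; last exact: cintegrable_inner.
by congr cint; apply/funext => y; rewrite /ftens /= rmorphM/=; ring.
Qed.

Lemma inner_ftens (f f' : cfun R X) (g g' : cfun R Y) :
  L2 mu f -> L2 mu f' -> L2 nu g -> L2 nu g' ->
  inner (sprod mu nu) (ftens f g) (ftens f' g') = inner mu f f' * inner nu g g'.
Proof.
move=> Lf Lf' Lg Lg'; rewrite inner_ftens_slice//; last exact: L2_ftens.
rewrite mulrC -innerZl//; congr (inner _ _ _); apply/funext => x.
by rewrite /ftens /= innerZl// mulrC.
Qed.

End parameter_integrals.

Section change_of_variables.
Context (R : realType) d1 d2 (X : measurableType d1) (Y : measurableType d2).
Context (mu : {sigma_finite_measure set X -> \bar R}).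
Context (nu : {sigma_finite_measure set Y -> \bar R}).

(** The change of variables formula is stated for nonnegative functions only,
    since the signed and complex ones follow. *)
Definition transports (w : X -> R) (T : X -> Y) :=
  [/\ measurable_fun setT w, forall x, 0 <= w x, measurable_fun setT T
    & forall h : Y -> \bar R, measurable_fun setT h -> (forall y, 0 <= h y)%E ->
       (\int[mu]_x ((w x)%:E * h (T x)) = \int[nu]_y h y)%E].

Section transports.
Context (w : X -> R) (T : X -> Y) (wT : transports w T).

Lemma transports_Rintegral (h : Y -> R) : measurable_fun setT h ->
  \int[mu]_x (w x * h (T x)) = \int[nu]_y h y.
Proof.
case: wT => mw w0 mT wTh mh; rewrite /Rintegral; congr fine.
have mh' : measurable_fun setT (EFin \o h) by exact/measurable_EFinP.
rewrite [LHS]integralE [RHS]integralE -!wTh//.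
- congr (_ - _)%E; apply: eq_integral => x _.
    by rewrite !funeposE -!EFin_max -EFinM maxr_pMr ?mulr0.
  by rewrite !funenegE -!EFinN -!EFin_max -EFinM maxr_pMr ?mulr0 ?mulrN.
- exact: measurable_funeneg.
- exact: measurable_funepos.
Qed.

Lemma transports_cint (h : cfun R Y) : cmeas h ->
  cint mu (fun x => (w x)%:C%C * h (T x)) = cint nu h.
Proof.
move=> [h1 h2]; apply: complex_ext => /=; rewrite -transports_Rintegral//.
  by apply: eq_Rintegral => x _; rewrite cReM/= mul0r subr0.
by apply: eq_Rintegral => x _; rewrite cImM/= mul0r addr0.
Qed.

End transports.

Lemma transports_enorm2 (w : X -> R) (T : X -> Y) (m : cfun R X) (f : cfun R Y) :
  transports w T -> (forall x, nsq (m x) = w x) -> cmeas f ->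
  enorm2 mu (fun x => m x * f (T x)) = enorm2 nu f.
Proof.
move=> [mw w0 mT wTh] mE mf; rewrite /enorm2 -wTh//.
- by apply: eq_integral => x _; rewrite nsqM mE EFinM.
- exact: measurable_ensq.
- by move=> y; rewrite lee_fin nsq_ge0.
Qed.

End change_of_variables.
Arguments transports {R d1 d2 X Y} mu nu w T.

Section onb_constructions.
Context (R : realType).

Lemma onb_transport d1 d2 (X : measurableType d1) (Y : measurableType d2)
  (mu : {sigma_finite_measure set X -> \bar R}) (nu : {sigma_finite_measure set Y -> \bar R})
  (T : X -> Y) (S : Y -> X) (e : nat -> cfun R X) :
  transports mu nu (fun=> 1) T -> measurable_fun setT S -> cancel T S -> cancel S T ->
  onb mu e -> onb nu (fun i y => e i (S y)).
Proof.
move=> tT mS TS ST eP; have [_ _ mT _] := tT.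
have en f : cmeas f -> enorm2 mu (fun x => f (T x)) = enorm2 nu f.
  move=> mf; rewrite -(transports_enorm2 tT (m := fun=> 1))//; last by move=> x; rewrite nsq1.
  by rewrite /enorm2; apply: eq_integral => x _; rewrite mul1r.
have Lc f : cmeas f -> L2 mu (fun x => f (T x)) <-> L2 nu f.
  move=> mf; rewrite !L2P en//; split=> -[_ oo]; split=> //; exact: cmeas_comp.
have inn f g : cmeas f -> cmeas g -> inner mu (fun x => f (T x)) (fun x => g (T x)) = inner nu f g.
  move=> mf mg; rewrite /inner -(transports_cint tT); last exact: cmeasM mf (cmeasJ mg).
  by congr cint; apply/funext => x; rewrite mul1r.
have eE i : (fun x => e i (S (T x))) = e i by apply/funext => x; rewrite TS.
have me i : cmeas (fun y => e i (S y)) by exact: cmeas_comp mS (L2_cmeas (onb_L2 eP i)).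
case: (eP) => Le eo en1 et; split.
- by move=> i; apply/Lc => //; rewrite eE.
- by move=> i j ij; rewrite -inn// !eE eo.
- by move=> i; rewrite /sqn -inn// !eE; exact: en1.
move=> f Lf h; have mf := L2_cmeas Lf; apply/sqn_eq0 => //.
rewrite /sqn -inn//; apply/(sqn_eq0 (mu := mu)); first exact/Lc.
by apply: et; [exact/Lc|move=> i; have := inn f _ mf (me i); rewrite eE => ->].
Qed.

Section product.
Context d1 d2 (X : measurableType d1) (Y : measurableType d2).
Context (mu : {sigma_finite_measure set X -> \bar R}).
Context (nu : {sigma_finite_measure set Y -> \bar R}).
Context (e : nat -> cfun R X) (e' : nat -> cfun R Y).

(** Pairs are enumerated by their codes; the numbers that code no pair give
    zero vectors. *)
Definition onb_prod (k : nat) : cfun R (X * Y)%type :=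
  if @pickle_inv (nat * nat)%type k is Some p then ftens (e p.1) (e' p.2) else fun=> 0.

Lemma onb_prod_pickle i j : onb_prod (pickle (i, j)) = ftens (e i) (e' j).
Proof. by rewrite /onb_prod pickleK_inv. Qed.

(** Totality: if [f] is orthogonal to all [e i \otimes e' j], then for each [j]
    the function [x |-> inner (f (x, -)) (e' j)] is orthogonal to all [e i],
    hence almost everywhere zero; so almost all slices of [f] vanish. *)
Lemma onb_sprod : onb mu e -> onb nu e' -> onb (sprod mu nu) onb_prod.
Proof.
move=> eP eP'; have [Le eo en et] := eP; have [Le' eo' en' et'] := eP'; split.
- move=> k; rewrite /onb_prod; case: pickle_inv => [p|]; last exact: L2_0.
  exact: L2_ftens.
- move=> k k' kk'; rewrite /onb_prod.
  case Ek : pickle_inv => [p|]; last by rewrite inner0l.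
  case Ek' : pickle_inv => [p'|]; last first.
    by rewrite innerC ?inner0l ?rmorph0//; [exact: L2_0|exact: L2_ftens].
  rewrite inner_ftens//; have [pp|] := eqVneq p p'.
    have := pickle_invK (T := (nat * nat)%type) k; have := pickle_invK (T := (nat * nat)%type) k'.
    by rewrite /oapp Ek Ek' pp => -> /esym E; rewrite E eqxx in kk'.
  case: p p' {Ek Ek'} => i j [i' j'] /=; rewrite xpair_eqE negb_and => /orP[h|h].
    by rewrite eo// mul0r.
  by rewrite eo'// mulr0.
- move=> k; rewrite /onb_prod; case: pickle_inv => [p|]; last by left; rewrite sqn0.
  rewrite sqn_ftens//; case: (en p.1) => ->; first by left; rewrite mul0r.
  by rewrite mul1r; exact: en'.
move=> f Lf h; apply: ae_sprod_L2 => //.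
have hij i j : inner mu (fun x => inner nu (fun y => f (x, y)) (e' j)) (e i) = 0.
  by rewrite -inner_ftens_slice// -onb_prod_pickle h.
have Lj j : L2 mu (fun x => inner nu (fun y => f (x, y)) (e' j)).
  have mf := L2_cmeas Lf; have me := L2_cmeas (Le' j).
  have ms : cmeas (fun x => inner nu (fun y => f (x, y)) (e' j)).
    have mk : cmeas (fun p : X * Y => f p * (e' j p.2)^*).
      by apply: cmeasM => //; apply: cmeasJ; apply: (cmeas_comp (h := snd)).
    exact: (cmeas_param_cint nu mk).
  apply/L2P; split=> //.
  have /L2P[_ oo] := Lf; apply: le_lt_trans oo; rewrite enorm2_sprod//.
  apply: ae_ge0_le_integral => //.
  - by move=> x _; rewrite lee_fin nsq_ge0.
  - exact: measurable_ensq.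
  - by move=> x _; exact: enorm2_ge0.
  - exact: measurable_enorm2_slice.
  have := L2_slice Lf; apply: filterS => x Lx _.
  rewrite enorm2E// lee_fin; apply: le_trans (inner_le Lx (Le' j)) _.
  by case: (en' j) => ->; rewrite ?mulr0 ?mulr1// sqn_ge0.
have : {ae mu, forall x, forall j, inner nu (fun y => f (x, y)) (e' j) = 0}.
  by apply: ae_foralln => j; have := et _ (Lj j) (fun i => hij i j); apply: filterS => x; apply.
have := L2_slice Lf; apply: filterS2 => x Lx hx.
exact: et'.
Qed.

End product.

Section gram_schmidt.
Context d (T : measurableType d) (mu : {sigma_finite_measure set T -> \bar R}).
Context (v : nat -> cfun R T) (Lv : forall k, L2 mu (v k)).

(** As [0^-1 = 0], a vector of norm zero is sent to zero, so that the
    recursion below needs no case distinction. *)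
Definition normalize (r : cfun R T) : cfun R T :=
  fun x => ((Num.sqrt (sqn mu r))^-1)%:C%C * r x.

Fixpoint gs_seq k : seq (cfun R T) :=
  if k is j.+1 then
    rcons (gs_seq j)
      (normalize (fun x => v j x - \sum_(f <- gs_seq j) inner mu (v j) f * f x))
  else [::].

Definition gs k := nth (fun=> 0) (gs_seq k.+1) k.

Definition gs_res k : cfun R T := fun x => v k x - \sum_(i < k) inner mu (v k) (gs i) * gs i x.

Lemma size_gs_seq k : size (gs_seq k) = k.
Proof. by elim: k => //= k IH; rewrite size_rcons IH. Qed.

Lemma nth_gs_seq k i : (i < k)%N -> nth (fun=> 0) (gs_seq k) i = gs i.
Proof.
elim: k => // k IH; rewrite ltnS leq_eqVlt => /orP[/eqP ->//|ik].
by rewrite /= nth_rcons size_gs_seq ik IH.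
Qed.

Lemma gsE k : gs k = normalize (gs_res k).
Proof.
rewrite /gs /= nth_rcons size_gs_seq ltnn eqxx /gs_res; congr normalize.
apply/funext => x; rewrite (big_nth (fun=> 0)) size_gs_seq big_mkord; congr (_ - _).
by apply: eq_bigr => i _; rewrite nth_gs_seq.
Qed.

Lemma L2_normalize r : L2 mu r -> L2 mu (normalize r).
Proof. exact: L2Z. Qed.

Lemma sqn_normalize r : L2 mu r -> sqn mu (normalize r) = 0 \/ sqn mu (normalize r) = 1.
Proof.
move=> Lr; rewrite /normalize sqnZ// nsq_real exprVn sqr_sqrtr ?sqn_ge0//.
by have [->|r0] := eqVneq (sqn mu r) 0; [left; rewrite mulr0|right; rewrite mulVf].
Qed.

Lemma L2_gs k : L2 mu (gs k).
Proof.
elim/ltn_ind: k => k IH; rewrite gsE; apply: L2_normalize; apply: L2B => //.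
by apply: (L2_comb _ (fun i : 'I_k => inner mu (v k) (gs i)) (F := fun i : 'I_k => gs i)) => i; exact: IH.
Qed.

Lemma L2_gs_res k : L2 mu (gs_res k).
Proof.
apply: L2B => //.
by apply: (L2_comb _ (fun i : 'I_k => inner mu (v k) (gs i)) (F := fun i : 'I_k => gs i)) => i; exact: L2_gs.
Qed.

Lemma sqn_gs k : sqn mu (gs k) = 0 \/ sqn mu (gs k) = 1.
Proof. by rewrite gsE; apply: sqn_normalize; exact: L2_gs_res. Qed.

Lemma inner_sqn0 f g : L2 mu f -> L2 mu g -> sqn mu g = 0 -> inner mu f g = 0.
Proof.
move=> Lf Lg g0; apply: nsq_eq0; apply/eqP; rewrite eq_le nsq_ge0 andbT.
by apply: le_trans (inner_le Lf Lg) _; rewrite g0 mulr0.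
Qed.

Lemma gs_orth k j : (j < k)%N -> inner mu (gs k) (gs j) = 0.
Proof.
elim/ltn_ind: k j => k IH j jk; have Lj := L2_gs j; have Lk := L2_gs_res k.
rewrite gsE /normalize innerZl// /gs_res.
have Ls : L2 mu (fun x => \sum_(i < k) inner mu (v k) (gs i) * gs i x).
  by apply: (L2_comb _ (fun i : 'I_k => inner mu (v k) (gs i)) (F := fun i : 'I_k => gs i)) => i; exact: L2_gs.
rewrite innerBl// (inner_combl _ (fun i : 'I_k => inner mu (v k) (gs i)) (F := fun i : 'I_k => gs i))//; last first.
  by move=> i; exact: L2_gs.
rewrite (bigD1 (Ordinal jk))//= big1 ?addr0.
  rewrite inner_diag; case: (sqn_gs j) => [e0|->]; last by rewrite mulr1 subrr mulr0.
  by rewrite (inner_sqn0 (Lv k) Lj e0) mul0r subr0 mulr0.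
move=> i; rewrite -(inj_eq val_inj)/= neq_ltn => /orP[ij|ji].
  by rewrite (innerC (Lj) (L2_gs i)) IH ?rmorph0 ?mulr0.
by rewrite IH ?mulr0.
Qed.

(** Each [v k] is a combination of the [gs i] with [i <= k], up to a null function
    when the residue vanishes, so the [gs i] are total when the [v k] are. *)
Lemma onb_gs : (forall f, L2 mu f -> (forall k, inner mu f (v k) = 0) -> ae_equal mu f (fun=> 0)) ->
  onb mu gs.
Proof.
move=> tot; split; [exact: L2_gs| |exact: sqn_gs|].
  move=> i j; rewrite neq_ltn => /orP[ij|ji]; last exact: gs_orth.
  by rewrite innerC ?gs_orth ?rmorph0//; exact: L2_gs.
move=> f Lf h; apply: tot => // k; have Lk := L2_gs_res k.
have Ls : L2 mu (fun x => \sum_(i < k) inner mu (v k) (gs i) * gs i x).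
  by apply: (L2_comb _ (fun i : 'I_k => inner mu (v k) (gs i)) (F := fun i : 'I_k => gs i)) => i; exact: L2_gs.
have -> : v k = fun x => gs_res k x + \sum_(i < k) inner mu (v k) (gs i) * gs i x.
  by apply/funext => x; rewrite /gs_res subrK.
rewrite innerDr//.
have -> : inner mu f (fun x => \sum_(i < k) inner mu (v k) (gs i) * gs i x) = 0.
  rewrite innerC// (inner_combl _ (fun i : 'I_k => inner mu (v k) (gs i)) (F := fun i : 'I_k => gs i))//; last first.
    by move=> i; exact: L2_gs.
  rewrite big1 ?rmorph0// => i _.
  by rewrite (innerC Lf (L2_gs i)) h rmorph0 mulr0.
rewrite addr0; have [e0|e0] := eqVneq (sqn mu (gs_res k)) 0; first exact: inner_sqn0.
have s0 : Num.sqrt (sqn mu (gs_res k)) != 0 by rewrite sqrtr_eq0 -ltNge lt_neqAle eq_sym e0 sqn_ge0.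
have -> : gs_res k = fun x => (Num.sqrt (sqn mu (gs_res k)))%:C%C * gs k x.
  apply/funext => x; rewrite gsE /normalize mulrA -rmorphM/= mulfV// mul1r//.
by rewrite innerZr ?h ?mulr0//; exact: L2_gs.
Qed.

End gram_schmidt.

End onb_constructions.

(** * Tensor products of bounded operators *)

Section extension.
Context (R : realType) d (T : measurableType d).
Context (mu : {sigma_finite_measure set T -> \bar R}) (e : nat -> cfun R T) (eP : onb mu e).

(** The images under [G] of the partial expansions of [f] form a Cauchy sequence,
    whose limit is the value at [f].  The data are a relation rather than a
    function because sums of elementary tensors do not have unique
    expressions. *)
Lemma bounded_extension (G : cfun R T -> cfun R T -> Prop) (C : R) : 0 <= C ->
  G (fun=> 0) (fun=> 0) ->
  (forall (a : R[i]) f f' g g', G f f' -> G g g' ->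
     G (fun x => a * f x + g x) (fun x => a * f' x + g' x)) ->
  (forall f f', G f f' -> [/\ L2 mu f, L2 mu f' & sqn mu f' <= C * sqn mu f]) ->
  (forall k, exists f', G (e k) f') ->
  exists W, [/\ bounded_op mu W, bop_le mu (4 * C) W & forall f f', G f f' -> ae_equal mu (W f) f'].
Proof.
move=> C0 G0 Glin GL /choice[v Gv].
have Lv k : L2 mu (v k) by have [] := GL _ _ (Gv k).
pose s f k : cfun R T := fun x => \sum_(i < k) inner mu f (e i) * v i x.
have Ls f k : L2 mu (s f k).
  by apply: (L2_comb _ (fun i : 'I_k => inner mu f (e i)) (F := fun i : 'I_k => v i)).
have Gs f k : G (proj mu e k f) (s f k).
  elim: k => [|k IH].
    have -> : proj mu e 0 f = fun=> 0 by apply/funext => x; rewrite /proj big_ord0.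
    by have -> : s f 0%N = fun=> 0 by apply/funext => x; rewrite /s big_ord0.
  have := Glin (inner mu f (e k)) _ _ _ _ (Gv k) IH; congr G; apply/funext => x.
    by rewrite /proj big_ord_recr/= addrC.
  by rewrite /s big_ord_recr/= addrC.
have GB f f' g g' : G f f' -> G g g' -> G (fun x => f x - g x) (fun x => f' x - g' x).
  by move=> Gf Gg; have := Glin (-1) _ _ _ _ Gg Gf; congr G; apply/funext => x; ring.
have GBle f f' g g' : G f f' -> G g g' ->
    sqn mu (fun x => f' x - g' x) <= C * sqn mu (fun x => f x - g x).
  by move=> Gf Gg; have [] := GL _ _ (GB _ _ _ _ Gf Gg).
have ex f : L2 mu f -> exists g, L2 mu g /\ cvg2 mu (s f) g.
  move=> Lf; apply: cvg2_complete => // ep ep0.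
  have Lp k := L2_proj eP k f.
  have C1 : 0 < C + 1 by rewrite ltr_wpDl.
  have [N HN] := cvg2_cauchy Lp Lf (proj_cvg2 eP Lf) (divr_gt0 ep0 C1).
  exists N => j k Nj jk; apply: le_trans (GBle _ _ _ _ (Gs f j) (Gs f k)) _.
  apply: (@le_trans _ _ ((C + 1) * (ep / (C + 1)))); last by rewrite mulrC divfK// gt_eqF.
  apply: ler_pM => //; [exact: sqn_ge0|by rewrite lerDl|].
  by apply: HN => //; exact: leq_trans jk.
pose W : op R T := fun f => xget (fun=> 0) [set g | L2 mu g /\ cvg2 mu (s f) g].
have WP f : L2 mu f -> L2 mu (W f) /\ cvg2 mu (s f) (W f).
  move=> /ex[g hg]; rewrite /W.
  exact: (@xgetPex _ (fun=> 0) [set g | L2 mu g /\ cvg2 mu (s f) g] (ex_intro _ g hg)).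
have bW : bop_le mu (4 * C) W.
  move=> f Lf; have [LWf cf] := WP _ Lf; rewrite -mulrA.
  apply: (cvg2_sqn_le (Ls f)) => // k.
  have [_ _] := GL _ _ (Gs f k); move/le_trans; apply.
  by rewrite ler_wpM2l//; exact: sqn_proj_le.
exists W; split=> //.
  apply: (@bop_intro _ _ _ _ _ (4 * C)) => //; first by rewrite mulr_ge0.
  - by move=> f /WP[].
  - move=> a f g Lf Lg; have [LWf cf] := WP _ Lf; have [LWg cg] := WP _ Lg.
    have Lfg : L2 mu (fun x => a * f x + g x) by apply: L2D => //; exact: L2Z.
    have [LWh ch] := WP _ Lfg.
    apply: (cvg2_uniq (Ls _) _ _ ch) => //; first by apply: L2D => //; exact: L2Z.
    have := cvg2D _ _ _ _ (cvg2Z a (Ls f) LWf cf) cg.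
    have -> : s (fun x => a * f x + g x) = (fun k x => a * s f k x + s g k x).
      apply/funext => k; apply/funext => x; rewrite /s mulr_sumr -big_split/=.
      apply: eq_bigr => i _; have Le := onb_L2 eP i.
      by rewrite innerDl ?innerZl//; [ring|exact: L2Z].
    by apply => //; [move=> k; exact: L2Z|exact: L2Z].
move=> f f' Gf; have [Lf Lf' _] := GL _ _ Gf; have [LWf cf] := WP _ Lf.
apply: (cvg2_uniq (Ls f) _ _ cf) => //.
apply: (@cvg0_le _ _ (fun k => sqn mu (fun x => proj mu e k f x - f x)) C).
  by move=> k; rewrite sqn_ge0/=; exact: GBle (Gs f k) Gf.
exact: proj_cvg2.
Qed.

End extension.

Section tensor_ops.
Context (R : realType) d1 d2 (X : measurableType d1) (Y : measurableType d2).
Context (mu : {sigma_finite_measure set X -> \bar R}).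
Context (nu : {sigma_finite_measure set Y -> \bar R}).
Context (e : nat -> cfun R X) (e' : nat -> cfun R Y) (eP : onb mu e) (eP' : onb nu e').
Local Notation munu := (sprod mu nu).
Local Notation E := (onb_prod e e').

Let EP : onb munu E. Proof. exact: onb_sprod. Qed.

Lemma ftens_ae (f f' : cfun R X) (g g' : cfun R Y) :
  L2 mu f -> L2 mu f' -> L2 nu g -> L2 nu g' -> ae_equal mu f f' -> ae_equal nu g g' ->
  ae_equal munu (ftens f g) (ftens f' g').
Proof.
move=> Lf Lf' Lg Lg' ff gg; apply/sqnB_eq0; [exact: L2_ftens|exact: L2_ftens|].
have L1 := L2_ftens (L2B Lf Lf') Lg; have L2' := L2_ftens Lf' (L2B Lg Lg').
rewrite (_ : (fun x => _) = (fun x => ftens (fun x => f x - f' x) g x +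
   ftens f' (fun y => g y - g' y) x)); last by apply/funext => x; rewrite /ftens; ring.
apply/eqP; rewrite eq_le sqn_ge0 andbT; apply: le_trans (sqnD_le L1 L2') _.
rewrite !sqn_ftens//; [|exact: L2B|exact: L2B].
by rewrite (sqnB_eq0 Lf Lf').2// (sqnB_eq0 Lg Lg').2// mul0r !mulr0 addr0.
Qed.

Lemma onb_prod_ftens k : exists f g, [/\ L2 mu f, L2 nu g & E k = ftens f g].
Proof.
rewrite /onb_prod; case: pickle_inv => [p|].
  by exists (e p.1), (e' p.2); split=> //; [exact: (onb_L2 eP)|exact: (onb_L2 eP')].
exists (fun=> 0), (fun=> 0); split; [exact: L2_0|exact: L2_0|].
by apply/funext => x; rewrite /ftens mul0r.
Qed.

Lemma tens_ext (W W' : op R (X * Y)%type) : bounded_op munu W -> bounded_op munu W' ->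
  (forall f g, L2 mu f -> L2 nu g -> ae_equal munu (W (ftens f g)) (W' (ftens f g))) ->
  op_eq munu W W'.
Proof.
move=> bW bW' WW'; apply: (op_eq_onb EP) => // k.
by have [f [g [Lf Lg ->]]] := onb_prod_ftens k; exact: WW'.
Qed.

(** Sums of elementary tensors [k1], together with their images [k2] under
    [A \otimes 1] and [k3] under [A \otimes B].  The intermediate [k2] serves
    for the bound: it is compared with [k1] on one family of slices and with
    [k3] on the other. *)
Inductive tens_graph (A : op R X) (B : op R Y) :
    cfun R (X * Y)%type -> cfun R (X * Y)%type -> cfun R (X * Y)%type -> Prop :=
| tens_graph0 : tens_graph A B (fun=> 0) (fun=> 0) (fun=> 0)
| tens_graphS (a : R[i]) f g k1 k2 k3 : L2 mu f -> L2 nu g -> tens_graph A B k1 k2 k3 ->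
    tens_graph A B (fun p => a * ftens f g p + k1 p)
      (fun p => a * ftens (A f) g p + k2 p) (fun p => a * ftens (A f) (B g) p + k3 p).

Section existence.
Context (A : op R X) (B : op R Y) (bA : bounded_op mu A) (bB : bounded_op nu B).

Lemma tens_graph_lin b k1 k2 k3 h1 h2 h3 : tens_graph A B k1 k2 k3 -> tens_graph A B h1 h2 h3 ->
  tens_graph A B (fun p => b * k1 p + h1 p) (fun p => b * k2 p + h2 p) (fun p => b * k3 p + h3 p).
Proof.
move=> Gk Gh; elim: Gk => [|a f g k1' k2' k3' Lf Lg _ IH].
  by move: Gh; congr tens_graph; apply/funext => p; rewrite mulr0 add0r.
have := tens_graphS (b * a) Lf Lg IH.
by congr tens_graph; apply/funext => p; ring.
Qed.

Lemma tens_graph_L2 k1 k2 k3 : tens_graph A B k1 k2 k3 ->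
  [/\ L2 munu k1, L2 munu k2 & L2 munu k3].
Proof.
elim=> [|a f g k1' k2' k3' Lf Lg _ [l1 l2 l3]]; first by split; exact: L2_0.
have LAf := bop_L2 bA Lf; have LBg := bop_L2 bB Lg.
by split; apply: L2D => //; apply: L2Z; exact: L2_ftens.
Qed.

Lemma tens_graph_slice_l k1 k2 k3 : tens_graph A B k1 k2 k3 -> forall y,
  [/\ L2 mu (fun x => k1 (x, y)), L2 mu (fun x => k2 (x, y)) &
      ae_equal mu (fun x => k2 (x, y)) (A (fun x => k1 (x, y)))].
Proof.
move=> G y; elim: G => [|a f g k1' k2' k3' Lf Lg _ [l1 l2 h]].
  by split; [exact: L2_0|exact: L2_0|apply: ae_equal_sym; exact: bop_0].
have LAf := bop_L2 bA Lf.
have E1 (F : cfun R X) (k : cfun R (X * Y)%type) :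
    (fun x => a * ftens F g (x, y) + k (x, y)) = (fun x => (a * g y) * F x + k (x, y)).
  by apply/funext => x; rewrite /ftens /=; ring.
rewrite !E1; split; [by apply: L2D => //; exact: L2Z|by apply: L2D => //; exact: L2Z|].
apply: ae_equal_sym; apply: ae_equal_trans (bop_lin bA _ Lf l1) _.
by apply: filterS h => x /= hx t; rewrite hx.
Qed.

Lemma tens_graph_slice_r k1 k2 k3 : tens_graph A B k1 k2 k3 -> forall x,
  [/\ L2 nu (fun y => k2 (x, y)), L2 nu (fun y => k3 (x, y)) &
      ae_equal nu (fun y => k3 (x, y)) (B (fun y => k2 (x, y)))].
Proof.
move=> G x; elim: G => [|a f g k1' k2' k3' Lf Lg _ [l1 l2 h]].
  by split; [exact: L2_0|exact: L2_0|apply: ae_equal_sym; exact: bop_0].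
have LBg := bop_L2 bB Lg.
have E1 (F : cfun R Y) (k : cfun R (X * Y)%type) :
    (fun y => a * ftens (A f) F (x, y) + k (x, y)) = (fun y => (a * A f x) * F y + k (x, y)).
  by apply/funext => y; rewrite /ftens /=; ring.
rewrite !E1; split; [by apply: L2D => //; exact: L2Z|by apply: L2D => //; exact: L2Z|].
apply: ae_equal_sym; apply: ae_equal_trans (bop_lin bB _ Lg l1) _.
by apply: filterS h => y /= hy t; rewrite hy.
Qed.

Lemma tens_graph_bound C D : 0 <= C -> 0 <= D -> bop_le mu C A -> bop_le nu D B ->
  forall k1 k2 k3, tens_graph A B k1 k2 k3 -> sqn munu k3 <= (D * C) * sqn munu k1.
Proof.
move=> C0 D0 hC hD k1 k2 k3 G; have [l1 l2 l3] := tens_graph_L2 G.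
apply: (@le_trans _ _ (D * sqn munu k2)).
  rewrite -lee_fin EFinM -!enorm2E// !enorm2_sprod ?(L2_cmeas l3) ?(L2_cmeas l2)//; [|exact: L2_cmeas l2|exact: L2_cmeas l3].
  have m2 := measurable_enorm2_slice nu (L2_cmeas l2).
  have m3 := measurable_enorm2_slice nu (L2_cmeas l3).
  rewrite -ge0_integralZl_EFin//; last by move=> x _; exact: enorm2_ge0.
  apply: ge0_le_integral => //.
  - by move=> x _; exact: enorm2_ge0.
  - exact: measurable_funeM.
  move=> x _; have [s2 s3 h] := tens_graph_slice_r G x.
  rewrite !enorm2E// -EFinM lee_fin (sqn_ae2 s3 _ h); [exact: hD|exact: bop_L2].
rewrite -mulrA ler_wpM2l//.
rewrite -lee_fin EFinM -!enorm2E// !enorm2_sprod_r; [|exact: L2_cmeas l1|exact: L2_cmeas l2].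
have m1 := measurable_enorm2_slice_r mu (L2_cmeas l1).
have m2 := measurable_enorm2_slice_r mu (L2_cmeas l2).
rewrite -ge0_integralZl_EFin//; last by move=> x _; exact: enorm2_ge0.
apply: ge0_le_integral => //.
- by move=> x _; exact: enorm2_ge0.
- exact: measurable_funeM.
move=> y _; have [s1 s2 h] := tens_graph_slice_l G y.
rewrite !enorm2E// -EFinM lee_fin (sqn_ae2 s2 _ h); [exact: hC|exact: bop_L2].
Qed.

(** Boundedness of the algebraic tensor product is checked on slices: at each
    point of one factor it is the boundedness of the operator on the other. *)
Lemma is_tens_exists C D : 0 <= C -> 0 <= D -> bop_le mu C A -> bop_le nu D B ->
  exists2 W, is_tens mu nu A B W & bop_le munu (4 * (D * C)) W.
Proof.
move=> C0 D0 hC hD.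
pose G k1 k3 := exists k2, tens_graph A B k1 k2 k3.
have [||||W [bW bW4 WG]] := @bounded_extension _ _ _ munu E EP G (D * C) (mulr_ge0 D0 C0).
- by exists (fun=> 0); exact: tens_graph0.
- move=> a f f' g g' [k2 h] [k2' h']; exists (fun p => a * k2 p + k2' p).
  exact: tens_graph_lin.
- move=> f f' [k2 h]; have [l1 l2 l3] := tens_graph_L2 h; split=> //.
  exact: tens_graph_bound h.
- move=> k; have [f [g [Lf Lg ->]]] := onb_prod_ftens k.
  exists (ftens (A f) (B g)), (ftens (A f) g).
  have := tens_graphS 1 Lf Lg (tens_graph0 A B).
  by congr tens_graph; apply/funext => p; rewrite mul1r addr0.
exists W => //; split=> // f g Lf Lg; apply: WG; exists (ftens (A f) g).
have := tens_graphS 1 Lf Lg (tens_graph0 A B).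
by congr tens_graph; apply/funext => p; rewrite mul1r addr0.
Qed.

Lemma tensP : is_tens mu nu A B (tens mu nu A B).
Proof.
have [C C0 hC] := bopP bA; have [D D0 hD] := bopP bB.
have [W hW _] := is_tens_exists C0 D0 hC hD; exact: (@xgetPex _ _ [set W | is_tens mu nu A B W] (ex_intro _ W hW)).
Qed.

Lemma bop_tens : bounded_op munu (tens mu nu A B). Proof. by case: tensP. Qed.

Lemma tensE f g : L2 mu f -> L2 nu g ->
  ae_equal munu (tens mu nu A B (ftens f g)) (ftens (A f) (B g)).
Proof. by case: tensP => _; exact. Qed.

Lemma tens_unique W : bounded_op munu W ->
  (forall f g, L2 mu f -> L2 nu g -> ae_equal munu (W (ftens f g)) (ftens (A f) (B g))) ->
  op_eq munu (tens mu nu A B) W.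
Proof.
move=> bW hW; apply: tens_ext => //; first exact: bop_tens.
by move=> f g Lf Lg; apply: ae_equal_trans (tensE Lf Lg) (ae_equal_sym (hW f g Lf Lg)).
Qed.

Lemma tens_bound C D : 0 <= C -> 0 <= D -> bop_le mu C A -> bop_le nu D B ->
  bop_le munu (4 * (D * C)) (tens mu nu A B).
Proof.
move=> C0 D0 hC hD; have [W [bW hW] bW4] := is_tens_exists C0 D0 hC hD.
move=> k Lk; rewrite (sqn_ae2 _ _ (tens_unique bW hW Lk)); [exact: bW4| |exact: bop_L2].
by apply: bop_L2 => //; exact: bop_tens.
Qed.

End existence.

Lemma tens_comp A A' B B' : bounded_op mu A -> bounded_op mu A' ->
  bounded_op nu B -> bounded_op nu B' ->
  op_eq munu (tens mu nu (A \o A') (B \o B')) (tens mu nu A B \o tens mu nu A' B').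
Proof.
move=> bA bA' bB bB'; apply: tens_unique; [exact: bop_comp|exact: bop_comp| |].
  by apply: bop_comp; exact: bop_tens.
move=> f g Lf Lg /=; have LAf := bop_L2 bA' Lf; have LBg := bop_L2 bB' Lg.
apply: ae_equal_trans (tensE bA bB LAf LBg).
apply: (bop_ae (bop_tens bA bB)).
- by apply: bop_L2; [exact: bop_tens|exact: L2_ftens].
- exact: L2_ftens.
- exact: tensE.
Qed.

Lemma tens_eq A A' B B' : bounded_op mu A -> bounded_op mu A' ->
  bounded_op nu B -> bounded_op nu B' -> op_eq mu A A' -> op_eq nu B B' ->
  op_eq munu (tens mu nu A B) (tens mu nu A' B').
Proof.
move=> bA bA' bB bB' AA BB; apply: tens_unique => //; first exact: bop_tens.
move=> f g Lf Lg; apply: ae_equal_trans (tensE bA' bB' Lf Lg) _; apply: ae_equal_sym.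
by apply: ftens_ae; [exact: bop_L2|exact: bop_L2|exact: bop_L2|exact: bop_L2|exact: AA|exact: BB].
Qed.

Lemma tens_id : op_eq munu (tens mu nu id id) id.
Proof.
apply: tens_unique; try exact: bop_id.
by move=> f g _ _; exact: ae_equal_refl.
Qed.

(** On basis vectors, which are elementary tensors, the inner products
    factor. *)
Lemma adjoint_tens A A' B B' : bounded_op mu A -> bounded_op nu B ->
  is_adjoint mu A A' -> is_adjoint nu B B' ->
  is_adjoint munu (tens mu nu A B) (tens mu nu A' B').
Proof.
move=> bA bB [bA' hA] [bB' hB].
have bT := bop_tens bA bB; have bT' := bop_tens bA' bB'.
apply: (adjoint_onb EP bT bT') => i j.
have [f [g [Lf Lg Ei]]] := onb_prod_ftens i; have [f' [g' [Lf' Lg' Ej]]] := onb_prod_ftens j.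
have Lfg := L2_ftens Lf Lg; have Lfg' := L2_ftens Lf' Lg'.
have LAf := bop_L2 bA Lf; have LBg := bop_L2 bB Lg.
have LAf' := bop_L2 bA' Lf'; have LBg' := bop_L2 bB' Lg'.
rewrite Ei Ej (inner_ael (bop_L2 bT Lfg) (L2_ftens LAf LBg) Lfg' (tensE bA bB Lf Lg)).
rewrite [RHS]innerC//; last exact: bop_L2.
rewrite (inner_ael (bop_L2 bT' Lfg') (L2_ftens LAf' LBg') Lfg (tensE bA' bB' Lf' Lg')).
by rewrite !inner_ftens// hA// hB// rmorphM/= -!innerC.
Qed.

End tensor_ops.

(** * Normal homomorphisms on tensor products *)

Section bop_more.
Context (R : realType) d (T : measurableType d).
Context (mu : {sigma_finite_measure set T -> \bar R}).

Lemma bop_lincomb2 (a : R[i]) (A B : op R T) : bounded_op mu A -> bounded_op mu B ->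
  bounded_op mu (fun f p => a * A f p + B f p).
Proof.
move=> bA bB; have [C C0 hC] := bopP bA; have [D D0 hD] := bopP bB.
apply: (@bop_intro _ _ _ _ _ (2 * (nsq a * C) + 2 * D)).
- by rewrite addr_ge0// mulr_ge0// mulr_ge0// nsq_ge0.
- by move=> f Lf; apply: L2D; [apply: L2Z; exact: bop_L2|exact: bop_L2].
- move=> b f g Lf Lg; have hA := bop_lin bA b Lf Lg; have hB := bop_lin bB b Lf Lg.
  by apply: filterS2 hA hB => x /= h1 h2 t; rewrite h1// h2//; ring.
- move=> f Lf; have LA := bop_L2 bA Lf; have LB := bop_L2 bB Lf.
  apply: le_trans (sqnD_le (L2Z a LA) LB) _; rewrite sqnZ// mulrDl.
  have := ler_wpM2l (nsq_ge0 a) (hC f Lf); have := hD f Lf; rewrite mulrA => *; lra.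
Qed.

Lemma bop_zero : bounded_op mu (fun _ => fun=> 0).
Proof.
apply: (@bop_intro _ _ _ _ _ 0) => //.
- by move=> f _; exact: L2_0.
- by move=> a f g _ _; apply: aeW => x _; rewrite mulr0 addr0.
- by move=> f _; rewrite sqn0 mul0r.
Qed.

Lemma bop_comb I (s : seq I) (w : I -> R[i]) (W : I -> op R T) :
  (forall i, bounded_op mu (W i)) -> bounded_op mu (fun f p => \sum_(i <- s) w i * W i f p).
Proof.
move=> bW; elim: s => [|i s IH].
  rewrite (_ : (fun f p => _) = fun _ => fun=> 0); first exact: bop_zero.
  by apply/funext => f; apply/funext => p; rewrite big_nil.
rewrite (_ : (fun f p => _) = fun f p => w i * W i f p + \sum_(j <- s) w j * W j f p).
  exact: bop_lincomb2.
by apply/funext => f; apply/funext => p; rewrite big_cons.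
Qed.

Definition rank1 (u v : cfun R T) : op R T := fun f x => inner mu f u * v x.

Lemma bop_rank1 u v : L2 mu u -> L2 mu v -> bounded_op mu (rank1 u v).
Proof.
move=> Lu Lv; apply: (@bop_intro _ _ _ _ _ (sqn mu u * sqn mu v)).
- by rewrite mulr_ge0 ?sqn_ge0.
- by move=> f Lf; exact: L2Z.
- move=> a f g Lf Lg; apply: aeW => x _; rewrite /rank1 innerDl ?innerZl//; first by ring.
  exact: L2Z.
- move=> f Lf; rewrite /rank1 sqnZ// mulrAC ler_wpM2r ?sqn_ge0// mulrC.
  exact: inner_le.
Qed.

Lemma op_bounded_byP C (A : op R T) : 0 <= C -> op_bounded_by mu C A <->
  bounded_op mu A /\ bop_le mu (C ^+ 2) A.
Proof.
by move=> C0; split=> -[bA h]; split=> // f Lf; apply/norm2_leP => //; exact: h.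
Qed.

Lemma adjoint_id : is_adjoint mu id id.
Proof. by split; first exact: bop_id. Qed.

Lemma wot_cvgP (Ak : nat -> op R T) A : wot_cvg mu Ak A <->
  forall f g, L2 mu f -> L2 mu g -> ccvg (fun k => inner mu (Ak k f) g) (inner mu (A f) g).
Proof. by split=> h f g Lf Lg; apply/ccvgE; exact: h. Qed.

Lemma op_eq_inner_all (A B : op R T) : bounded_op mu A -> bounded_op mu B ->
  (forall f g, L2 mu f -> L2 mu g -> inner mu (A f) g = inner mu (B f) g) -> op_eq mu A B.
Proof.
move=> bA bB h f Lf; have LA := bop_L2 bA Lf; have LB := bop_L2 bB Lf.
by apply/sqnB_eq0 => //; rewrite /sqn innerBl ?h ?subrr//; exact: L2B.
Qed.

Section truncation.
Context (e : nat -> cfun R T) (eP : onb mu e).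

Lemma bop_proj k : bounded_op mu (proj mu e k).
Proof.
rewrite (_ : proj mu e k = fun f p => \sum_(i < k) 1 * rank1 (e i) (e i) f p).
  by apply: bop_comb => i; apply: bop_rank1; exact: onb_L2.
by apply/funext => f; apply/funext => p; apply: eq_bigr => i _; rewrite mul1r.
Qed.

Definition trunc k (W : op R T) : op R T := proj mu e k \o W \o proj mu e k.

Lemma bop_trunc k W : bounded_op mu W -> bounded_op mu (trunc k W).
Proof. by move=> bW; apply: bop_comp; [exact: bop_comp (bop_proj k) bW|exact: bop_proj]. Qed.

Lemma truncE k W f : bounded_op mu W -> L2 mu f -> trunc k W f =
  fun p => \sum_(j < k) 1 * \sum_(i < k) inner mu (W (e i)) (e j) * rank1 (e i) (e j) f p.
Proof.
move=> bW Lf; apply/funext => p; rewrite /trunc /= {1}/proj.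
apply: eq_bigr => j _; have Le := onb_L2 eP.
rewrite (bop_inner_comb bW _ (fun i : 'I_k => inner mu f (e i)) (F := fun i : 'I_k => e i))//.
rewrite mul1r mulr_suml; apply: eq_bigr => i _; rewrite /rank1; ring.
Qed.

Lemma trunc_bound k W C : bounded_op mu W -> 0 <= C -> bop_le mu C W -> bop_le mu C (trunc k W).
Proof.
move=> bW C0 hC f Lf; have Lp := L2_proj eP k f.
apply: le_trans (sqn_proj_le eP k (bop_L2 bW Lp)) _.
apply: le_trans (hC _ Lp) _; rewrite ler_wpM2l//; exact: sqn_proj_le.
Qed.

Lemma proj_e k i : (i < k)%N -> ae_equal mu (proj mu e k (e i)) (e i).
Proof.
move=> ik; have Le := onb_L2 eP; have Lp := L2_proj eP k (e i).
apply: ae_equal_sym; apply/sqnB_eq0 => //; rewrite sqn_proj_compl// sqn_proj//.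
rewrite (bigD1 (Ordinal ik))//= big1 ?addr0.
  by rewrite inner_diag nsq_real; have [_ _ /(_ i)[->|->] _] := eP; rewrite ?expr0n ?expr1n subrr.
by move=> j; have [_ h _ _] := eP; rewrite -(inj_eq val_inj)/= eq_sym => ij; rewrite h// nsq0.
Qed.

(** The matrix coefficients of the compressions are eventually constant. *)
Lemma trunc_wot W : bounded_op mu W -> wot_cvg mu (fun k => trunc k W) W.
Proof.
move=> bW; apply/wot_cvgP; have [C C0 hC] := bopP bW; have Le := onb_L2 eP.
apply: (wot_onb eP C0) => //.
- by move=> k; exact: bop_trunc.
- by move=> k; exact: trunc_bound.
move=> i j; apply: (@ccvg_near _ (fun=> inner mu (W (e i)) (e j)) _ _ (maxn i j).+1); last exact: ccvg_cst.
move=> k; rewrite gtn_max => /andP[ik jk]; rewrite /trunc /= inner_proj//; last first.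
  by apply: bop_L2 => //; exact: L2_proj.
rewrite jk; apply/esym; apply: inner_ael => //.
- by apply: bop_L2 => //; exact: L2_proj.
- exact: bop_L2.
by apply: bop_ae => //; [exact: L2_proj|exact: proj_e].
Qed.

End truncation.
End bop_more.

Lemma tens_homP (R : realType) (d1 d2 e1 e2 : measure_display)
  (S1 : measurableType d1) (S2 : measurableType d2)
  (T1 : measurableType e1) (T2 : measurableType e2)
  (mu1 : {sigma_finite_measure set S1 -> \bar R})
  (mu2 : {sigma_finite_measure set S2 -> \bar R})
  (nu1 : {sigma_finite_measure set T1 -> \bar R})
  (nu2 : {sigma_finite_measure set T2 -> \bar R}) rho1 rho2 Phi :
  is_tens_hom mu1 mu2 nu1 nu2 rho1 rho2 Phi ->
  is_tens_hom mu1 mu2 nu1 nu2 rho1 rho2 (tens_hom mu1 mu2 nu1 nu2 rho1 rho2).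
Proof.
move=> hPhi.
exact: (@xgetPex _ _ [set Phi | is_tens_hom mu1 mu2 nu1 nu2 rho1 rho2 Phi] (ex_intro _ Phi hPhi)).
Qed.

Section tens_hom_uniqueness.
Context (R : realType) (d1 d2 e1 e2 : measure_display).
Context (S1 : measurableType d1) (S2 : measurableType d2).
Context (T1 : measurableType e1) (T2 : measurableType e2).
Context (mu1 : {sigma_finite_measure set S1 -> \bar R}).
Context (mu2 : {sigma_finite_measure set S2 -> \bar R}).
Context (nu1 : {sigma_finite_measure set T1 -> \bar R}).
Context (nu2 : {sigma_finite_measure set T2 -> \bar R}).
Context (b1 : nat -> cfun R S1) (b2 : nat -> cfun R S2) (bP1 : onb mu1 b1) (bP2 : onb mu2 b2).
Local Notation mu := (sprod mu1 mu2).
Local Notation nu := (sprod nu1 nu2).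
Local Notation E := (onb_prod b1 b2).

Let EP : onb mu E. Proof. exact: onb_sprod. Qed.

(** So the matrix units of a product basis are elementary tensors. *)
Lemma rank1_tens a b c e : L2 mu1 a -> L2 mu2 b -> L2 mu1 c -> L2 mu2 e ->
  op_eq mu (tens mu1 mu2 (rank1 mu1 a c) (rank1 mu2 b e)) (rank1 mu (ftens a b) (ftens c e)).
Proof.
move=> La Lb Lc Le; apply: (tens_unique bP1 bP2); try exact: bop_rank1.
  by apply: bop_rank1; exact: L2_ftens.
move=> f g Lf Lg; apply: aeW => p _; rewrite /rank1 inner_ftens// /ftens; ring.
Qed.

Section agree.
Context (rho1 : op R S1 -> op R T1) (rho2 : op R S2 -> op R T2).
Context (Phi Phi' : op R (S1 * S2)%type -> op R (T1 * T2)%type).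
Hypothesis hPhi : is_tens_hom mu1 mu2 nu1 nu2 rho1 rho2 Phi.
Hypothesis hPhi' : is_tens_hom mu1 mu2 nu1 nu2 rho1 rho2 Phi'.

Local Notation agree W := (op_eq nu (Phi W) (Phi' W)).

Let agree_eq W W' : bounded_op mu W -> bounded_op mu W' -> op_eq mu W W' -> agree W -> agree W'.
Proof.
move=> bW bW' WW h.
have [[_ P _ _] _] := hPhi; have [[_ P' _ _] _] := hPhi'.
apply: op_eq_trans (op_eq_sym (P _ _ bW bW' WW)) _.
exact: op_eq_trans h (P' _ _ bW bW' WW).
Qed.

Let agree_lin a W W' : bounded_op mu W -> bounded_op mu W' -> agree W -> agree W' ->
  agree (fun f p => a * W f p + W' f p).
Proof.
move=> bW bW' h h'.
have [[_ _ P _] _] := hPhi; have [[_ _ P' _] _] := hPhi'.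
apply: op_eq_trans (P a _ _ bW bW') _; apply: op_eq_sym.
apply: op_eq_trans (P' a _ _ bW bW') _; move=> f Lf.
by have h1 := h f Lf; have h2 := h' f Lf; apply: filterS2 h1 h2 => x /= -> // -> //.
Qed.

Let agree_tens A B : bounded_op mu1 A -> bounded_op mu2 B -> agree (tens mu1 mu2 A B).
Proof.
move=> bA bB; have [_ P] := hPhi; have [_ P'] := hPhi'.
exact: op_eq_trans (P _ _ bA bB) (op_eq_sym (P' _ _ bA bB)).
Qed.

Let agree_zero : agree (fun _ => fun=> 0).
Proof.
have b1z := bop_zero mu1; have b2z := bop_zero mu2.
apply: agree_eq (agree_tens b1z b2z); [exact: (bop_tens bP1 bP2)|exact: bop_zero|].
apply: (tens_unique bP1 bP2) => //; first exact: bop_zero.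
by move=> f g _ _; apply: aeW => p _; rewrite /ftens mulr0.
Qed.

Let agree_comb I (s : seq I) (w : I -> R[i]) (W : I -> op R (S1 * S2)%type) :
  (forall i, bounded_op mu (W i)) -> (forall i, agree (W i)) ->
  agree (fun f p => \sum_(i <- s) w i * W i f p).
Proof.
move=> bW aW; elim: s => [|i s IH].
  rewrite (_ : (fun f p => _) = fun _ => fun=> 0); first exact: agree_zero.
  by apply/funext => f; apply/funext => p; rewrite big_nil.
rewrite (_ : (fun f p => _) = fun f p => w i * W i f p + \sum_(j <- s) w j * W j f p).
  by apply: agree_lin => //; exact: bop_comb.
by apply/funext => f; apply/funext => p; rewrite big_cons.
Qed.

Let agree_rank1 i j : agree (rank1 mu (E i) (E j)).
Proof.
have [f [g [Lf Lg ->]]] := onb_prod_ftens bP1 bP2 i.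
have [f' [g' [Lf' Lg' ->]]] := onb_prod_ftens bP1 bP2 j.
have r1 := bop_rank1 Lf Lf'; have r2 := bop_rank1 Lg Lg'.
apply: agree_eq (agree_tens r1 r2).
- exact: (bop_tens bP1 bP2).
- by apply: bop_rank1; exact: L2_ftens.
- exact: rank1_tens.
Qed.

(** The compressions of an operator to finitely many basis vectors are linear
    combinations of elementary tensors and converge weakly to it, so a normal
    homomorphism is determined by its values on elementary tensors. *)
Lemma tens_hom_unique W : bounded_op mu W -> op_eq nu (Phi W) (Phi' W).
Proof.
move=> bW; have [C C0 hC] := bopP bW.
have [[B1 _ _ [_ _ N1]] _] := hPhi; have [[B2 _ _ [_ _ N2]] _] := hPhi'.
have ag k : agree (trunc mu E k W).
  have Le := onb_L2 EP.
  pose V (j : 'I_k) : op R (S1 * S2)%type :=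
    fun f p => \sum_(i < k) inner mu (W (E i)) (E j) * rank1 mu (E i) (E j) f p.
  have bV j : bounded_op mu (V j).
    by apply: bop_comb => i; exact: bop_rank1.
  have aV j : agree (V j).
    by apply: agree_comb => i; [exact: bop_rank1|exact: agree_rank1].
  have := agree_comb (index_enum _) (fun=> 1) bV aV.
  apply: agree_eq; [exact: bop_comb|exact: bop_trunc|].
  by move=> f Lf; rewrite (truncE EP k bW Lf); apply: ae_equal_refl.
have bd k : op_bounded_by mu (Num.sqrt C) (trunc mu E k W).
  apply/op_bounded_byP; first exact: sqrtr_ge0.
  by rewrite sqr_sqrtr//; split; [exact: bop_trunc|exact: trunc_bound].
have tw := trunc_wot EP bW.
have c1 := N1 _ _ _ bd bW tw; have c2 := N2 _ _ _ bd bW tw.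
apply: op_eq_inner_all; [exact: B1|exact: B2|].
move=> f g Lf Lg; move/wot_cvgP/(_ f g Lf Lg) : c1; move/wot_cvgP/(_ f g Lf Lg) : c2.
have -> : (fun k => inner nu (Phi' (trunc mu E k W) f) g) = (fun k => inner nu (Phi (trunc mu E k W) f) g).
  apply/funext => k; apply: inner_ael => //.
  - by apply: bop_L2 => //; apply: B2; exact: bop_trunc.
  - by apply: bop_L2 => //; apply: B1; exact: bop_trunc.
  - by apply: ae_equal_sym; exact: ag.
by move=> c2 c1; exact: ccvg_uniq c1 c2.
Qed.

End agree.

Lemma tens_homE rho1 rho2 Phi W : is_tens_hom mu1 mu2 nu1 nu2 rho1 rho2 Phi ->
  bounded_op mu W -> op_eq nu (tens_hom mu1 mu2 nu1 nu2 rho1 rho2 W) (Phi W).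
Proof.
move=> hPhi bW; apply: (tens_hom_unique (rho1 := rho1) (rho2 := rho2)) => //.
exact: tens_homP hPhi.
Qed.

End tens_hom_uniqueness.

Section amplification.
Context (R : realType) (d1 d2 d3 : measure_display).
Context (S1 : measurableType d1) (S2 : measurableType d2) (T : measurableType d3).
Context (mu1 : {sigma_finite_measure set S1 -> \bar R}).
Context (mu2 : {sigma_finite_measure set S2 -> \bar R}).
Context (nu : {sigma_finite_measure set T -> \bar R}).
Context (b : nat -> cfun R (S1 * S2)%type) (c : nat -> cfun R T).
Local Notation mu := (sprod mu1 mu2).
Context (bP : onb mu b) (cP : onb nu c).

(** For the continuity, matrix coefficients in the product basis factor, and the
    amplified sequence is bounded. *)
Lemma amplify_l_normal : normal_star_hom mu1 mu2 mu nu (fun W => tens mu nu W id).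
Proof.
have bI := bop_id nu; split.
- by move=> A bA; exact: (bop_tens bP cP).
- by move=> A B bA bB AB; apply: (tens_eq bP cP) => //; exact: op_eq_refl.
- move=> a A B bA bB; have bAB := bop_lincomb2 a bA bB.
  apply: (tens_unique bP cP) => //.
    by apply: bop_lincomb2; exact: (bop_tens bP cP).
  move=> f g Lf Lg; have h1 := tensE bP cP bA bI Lf Lg; have h2 := tensE bP cP bB bI Lf Lg.
  by apply: filterS2 h1 h2 => x /= -> // -> // _; rewrite /ftens; ring.
split.
- by move=> A B bA bB; exact: (tens_comp bP cP bA bB bI bI).
- by move=> A B bA AB; exact: (adjoint_tens bP cP bA bI AB (adjoint_id nu)).
move=> Ak A C hA bA /wot_cvgP cA; apply/wot_cvgP.
have bAk k : bounded_op mu (Ak k) by have [] := hA k.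
have hAk k : bop_le mu (`|C| ^+ 2) (Ak k).
  move=> f Lf; apply/norm2_leP => //; have [_ /(_ f Lf) h] := hA k.
  by apply: le_trans h _; rewrite ler_wpM2r ?sqrtr_ge0// ler_norm.
have h1 : bop_le nu 1 id by move=> f _; rewrite mul1r.
apply: (wot_onb (onb_sprod bP cP) (C := 4 * (1 * `|C| ^+ 2))).
- by rewrite !mulr_ge0// sqr_ge0.
- by move=> k; exact: (bop_tens bP cP).
- by move=> k; apply: (tens_bound bP cP) => //; exact: sqr_ge0.
- exact: (bop_tens bP cP).
move=> i j; have [f [g [Lf Lg ->]]] := onb_prod_ftens bP cP i.
have [f' [g' [Lf' Lg' ->]]] := onb_prod_ftens bP cP j.
have key B : bounded_op mu B -> inner (sprod mu nu) (tens mu nu B id (ftens f g)) (ftens f' g') =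
    inner nu g g' * inner mu (B f) f'.
  move=> bB; have LBf := bop_L2 bB Lf.
  rewrite (inner_ael _ _ _ (tensE bP cP bB bI Lf Lg)); first by rewrite inner_ftens// mulrC.
  - exact: (bop_L2 (bop_tens bP cP bB bI) (L2_ftens Lf Lg)).
  - exact: L2_ftens.
  - exact: L2_ftens.
rewrite key//; under eq_fun do rewrite key//.
by apply: ccvgZ; exact: cA.
Qed.

Lemma amplify_r_normal : normal_star_hom mu1 mu2 nu mu (fun W => tens nu mu id W).
Proof.
have bI := bop_id nu; split.
- by move=> A bA; exact: (bop_tens cP bP).
- by move=> A B bA bB AB; apply: (tens_eq cP bP) => //; exact: op_eq_refl.
- move=> a A B bA bB; have bAB := bop_lincomb2 a bA bB.
  apply: (tens_unique cP bP) => //.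
    by apply: bop_lincomb2; exact: (bop_tens cP bP).
  move=> f g Lf Lg; have h1 := tensE cP bP bI bA Lf Lg; have h2 := tensE cP bP bI bB Lf Lg.
  by apply: filterS2 h1 h2 => x /= -> // -> // _; rewrite /ftens; ring.
split.
- by move=> A B bA bB; exact: (tens_comp cP bP bI bI bA bB).
- by move=> A B bA AB; exact: (adjoint_tens cP bP bI bA (adjoint_id nu) AB).
move=> Ak A C hA bA /wot_cvgP cA; apply/wot_cvgP.
have bAk k : bounded_op mu (Ak k) by have [] := hA k.
have hAk k : bop_le mu (`|C| ^+ 2) (Ak k).
  move=> f Lf; apply/norm2_leP => //; have [_ /(_ f Lf) h] := hA k.
  by apply: le_trans h _; rewrite ler_wpM2r ?sqrtr_ge0// ler_norm.
have h1 : bop_le nu 1 id by move=> f _; rewrite mul1r.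
apply: (wot_onb (onb_sprod cP bP) (C := 4 * (`|C| ^+ 2 * 1))).
- by rewrite !mulr_ge0// sqr_ge0.
- by move=> k; exact: (bop_tens cP bP).
- by move=> k; apply: (tens_bound cP bP) => //; exact: sqr_ge0.
- exact: (bop_tens cP bP).
move=> i j; have [f [g [Lf Lg ->]]] := onb_prod_ftens cP bP i.
have [f' [g' [Lf' Lg' ->]]] := onb_prod_ftens cP bP j.
have key B : bounded_op mu B -> inner (sprod nu mu) (tens nu mu id B (ftens f g)) (ftens f' g') =
    inner nu f f' * inner mu (B g) g'.
  move=> bB; have LBg := bop_L2 bB Lg.
  rewrite (inner_ael _ _ _ (tensE cP bP bI bB Lf Lg)); first by rewrite inner_ftens.
  - exact: (bop_L2 (bop_tens cP bP bI bB) (L2_ftens Lf Lg)).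
  - exact: L2_ftens.
  - exact: L2_ftens.
rewrite key//; under eq_fun do rewrite key//.
by apply: ccvgZ; exact: cA.
Qed.

End amplification.

Section unitaries.
Context (R : realType) d (T : measurableType d).
Context (mu : {sigma_finite_measure set T -> \bar R}).

Definition unitary (Q Q' : op R T) :=
  [/\ is_adjoint mu Q Q', is_adjoint mu Q' Q, op_eq mu (Q \o Q') id & op_eq mu (Q' \o Q) id].

Lemma unitary_bop Q Q' : unitary Q Q' -> bounded_op mu Q.
Proof. by case=> _ []. Qed.

Lemma unitary_sym Q Q' : unitary Q Q' -> unitary Q' Q.
Proof. by case. Qed.

(** Adjoints are unique up to [op_eq] only; this exchanges the chosen one for an
    explicit inverse. *)
Lemma adj_unitary Q Q' : unitary Q Q' -> op_eq mu (adj mu Q) Q' /\ bounded_op mu (adj mu Q).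
Proof.
move=> [aQ [bQ _] _ _]; have [bQ' hQ'] := aQ.
have [bA hA] : is_adjoint mu Q (adj mu Q).
  exact: (@xgetPex _ _ [set B | is_adjoint mu Q B] (ex_intro _ Q' aQ)).
split=> //; apply: op_eq_inner_all => // f g Lf Lg.
rewrite innerC//; last exact: bop_L2.
by rewrite -hA// hQ'// -innerC//; exact: bop_L2.
Qed.

End unitaries.

Lemma conj_normal (R : realType) (d1 d2 e1 e2 : measure_display)
  (S1 : measurableType d1) (S2 : measurableType d2)
  (T1 : measurableType e1) (T2 : measurableType e2)
  (mu1 : {sigma_finite_measure set S1 -> \bar R})
  (mu2 : {sigma_finite_measure set S2 -> \bar R})
  (nu1 : {sigma_finite_measure set T1 -> \bar R})
  (nu2 : {sigma_finite_measure set T2 -> \bar R})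
  (Phi : op R (S1 * S2)%type -> op R (T1 * T2)%type) Q Q' :
  unitary (sprod nu1 nu2) Q Q' -> normal_star_hom mu1 mu2 nu1 nu2 Phi ->
  normal_star_hom mu1 mu2 nu1 nu2 (fun W => Q \o Phi W \o Q').
Proof.
move=> uQ [P1 P2 P3 [P4 P5 P6]].
have bQ := unitary_bop uQ; have bQ' := unitary_bop (unitary_sym uQ).
have [[_ aQ] [_ aQ'] QQ Q'Q] := uQ.
have bC W : bounded_op (sprod mu1 mu2) W -> bounded_op (sprod nu1 nu2) (Q \o Phi W \o Q').
  by move=> bW; apply: bop_comp => //; apply: bop_comp => //; exact: P1.
split=> //.
- move=> A B bA bB AB f Lf /=; have Lf' := bop_L2 bQ' Lf.
  apply: bop_ae => //; [exact: (bop_L2 (P1 _ bA) Lf')|exact: (bop_L2 (P1 _ bB) Lf')|].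
  exact: P2.
- move=> a A B bA bB f Lf /=; have Lf' := bop_L2 bQ' Lf.
  have LA := bop_L2 (P1 _ bA) Lf'; have LB := bop_L2 (P1 _ bB) Lf'.
  have LAB := bop_L2 (P1 _ (bop_lincomb2 a bA bB)) Lf'.
  apply: ae_equal_trans (bop_lin bQ a LA LB).
  by apply: bop_ae => //; [apply: L2D => //; exact: L2Z|exact: P3].
split.
- move=> A B bA bB f Lf /=; have Lf' := bop_L2 bQ' Lf.
  have LB := bop_L2 (P1 _ bB) Lf'; have LQB := bop_L2 bQ LB.
  have LAB := bop_L2 (P1 _ (bop_comp bA bB)) Lf'.
  apply: bop_ae => //; first exact: (bop_L2 (P1 _ bA) (bop_L2 bQ' (bop_L2 bQ LB))).
  apply: ae_equal_trans (P4 _ _ bA bB _ Lf') _ => /=.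
  apply: (bop_ae (P1 _ bA)) => //; first exact: bop_L2.
  by apply: ae_equal_sym; exact: Q'Q.
- move=> A B bA AB; have [bPB hAB] := P5 _ _ bA AB; have bPA := P1 _ bA.
  split; first by apply: bop_comp => //; exact: bop_comp.
  move=> f g Lf Lg /=; have Lf' := bop_L2 bQ' Lf; have Lg' := bop_L2 bQ' Lg.
  rewrite aQ//; last exact: bop_L2.
  rewrite hAB// aQ'//; exact: bop_L2.
move=> Ak A C hA bA cA; have /wot_cvgP := P6 _ _ _ hA bA cA => cP; apply/wot_cvgP => f g Lf Lg.
have Lf' := bop_L2 bQ' Lf; have Lg' := bop_L2 bQ' Lg.
have bAk k : bounded_op (sprod mu1 mu2) (Ak k) by have [] := hA k.
have key B : bounded_op (sprod mu1 mu2) B ->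
    inner (sprod nu1 nu2) ((Q \o Phi B \o Q') f) g = inner (sprod nu1 nu2) (Phi B (Q' f)) (Q' g).
  by move=> bB /=; rewrite aQ//; exact: (bop_L2 (P1 _ bB) Lf').
rewrite key//; under eq_fun do rewrite key//.
exact: cP.
Qed.

(** * Weighted composition operators *)

Section transports_calculus.
Context (R : realType).

Lemma transports_id d (X : measurableType d) (mu : {sigma_finite_measure set X -> \bar R}) :
  transports mu mu (fun=> 1) id.
Proof.
split=> // h mh h0; apply: eq_integral => x _; by rewrite mul1e.
Qed.

Lemma transports_comp d1 d2 d3 (X : measurableType d1) (Y : measurableType d2) (Z : measurableType d3)
  (mu : {sigma_finite_measure set X -> \bar R}) (nu : {sigma_finite_measure set Y -> \bar R})
  (la : {sigma_finite_measure set Z -> \bar R}) w1 T1 w2 T2 :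
  transports mu nu w1 T1 -> transports nu la w2 T2 ->
  transports mu la (fun x => w1 x * w2 (T1 x)) (T2 \o T1).
Proof.
move=> [mw1 w10 mT1 h1] [mw2 w20 mT2 h2]; split.
- by apply: measurable_funM => //; exact: measurableT_comp.
- by move=> x; rewrite mulr_ge0.
- exact: measurableT_comp.
move=> h mh h0; rewrite -h2// -h1//.
- by apply: eq_integral => x _ /=; rewrite EFinM muleA.
- by apply: emeasurable_funM; [exact/measurable_EFinP|exact: measurableT_comp].
- by move=> y; rewrite mule_ge0// lee_fin.
Qed.

Lemma transports_eq d1 d2 (X : measurableType d1) (Y : measurableType d2)
  (mu : {sigma_finite_measure set X -> \bar R}) (nu : {sigma_finite_measure set Y -> \bar R})
  w w' T T' : w =1 w' -> T =1 T' -> transports mu nu w T -> transports mu nu w' T'.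
Proof. by move=> /funext -> /funext ->. Qed.

(** Tonelli: a map that acts on the second coordinate, depending on the first,
    may be checked for each value of the first. *)
Lemma transports_fiber_r d1 d2 d3 (X : measurableType d1) (Y : measurableType d2) (Z : measurableType d3)
  (mu : {sigma_finite_measure set X -> \bar R}) (nu : {sigma_finite_measure set Y -> \bar R})
  (la : {sigma_finite_measure set Z -> \bar R}) (w : X * Y -> R) (T : X * Y -> Z) :
  measurable_fun setT w -> measurable_fun setT T ->
  (forall x, transports nu la (fun y => w (x, y)) (fun y => T (x, y))) ->
  transports (sprod mu nu) (sprod mu la) w (fun p => (p.1, T p)).
Proof.
move=> mw mT wT; split=> //.
- by move=> [x y]; have [_ + _ _] := wT x; exact.
- exact/measurable_fun_pair.
move=> h mh h0.
have mT2 : measurable_fun setT (fun p : X * Y => (p.1, T p)) by exact/measurable_fun_pair.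
rewrite /sprod fubini_tonelli1//; last 2 first.
- by apply: emeasurable_funM; [exact/measurable_EFinP|exact: (measurableT_comp mh mT2)].
- by move=> [x y]; rewrite mule_ge0// lee_fin; have [_ + _ _] := wT x; exact.
rewrite fubini_tonelli1//; apply: eq_integral => x _; rewrite /fubini_F /=.
have [_ _ _] := wT x; apply => //.
by apply: (measurableT_comp mh); exact: measurable_pair1.
Qed.

Lemma transports_swap d1 d2 (X : measurableType d1) (Y : measurableType d2)
  (mu : {sigma_finite_measure set X -> \bar R}) (nu : {sigma_finite_measure set Y -> \bar R}) :
  transports (sprod mu nu) (sprod nu mu) (fun=> 1) (fun p => (p.2, p.1)).
Proof.
have ms : measurable_fun setT (fun p : X * Y => (p.2, p.1)) by exact/measurable_fun_pair.
split=> // h mh h0; under eq_integral do rewrite mul1e.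
rewrite /sprod fubini_tonelli1//; last exact: (measurableT_comp mh ms).
by rewrite fubini_tonelli2.
Qed.

Lemma transports_fiber_l d1 d2 d3 (X : measurableType d1) (Y : measurableType d2) (Z : measurableType d3)
  (mu : {sigma_finite_measure set X -> \bar R}) (nu : {sigma_finite_measure set Y -> \bar R})
  (la : {sigma_finite_measure set Z -> \bar R}) (w : X * Y -> R) (T : X * Y -> Z) :
  measurable_fun setT w -> measurable_fun setT T ->
  (forall y, transports mu la (fun x => w (x, y)) (fun x => T (x, y))) ->
  transports (sprod mu nu) (sprod la nu) w (fun p => (T p, p.2)).
Proof.
move=> mw mT wT.
have ms : measurable_fun setT (fun p : Y * X => (p.2, p.1)) by exact/measurable_fun_pair.
have := @transports_fiber_r _ _ _ Y X Z nu mu la (fun p => w (p.2, p.1)) (fun p => T (p.2, p.1))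
  (measurableT_comp mw ms) (measurableT_comp mT ms) wT.
move=> /(transports_comp (transports_swap mu nu)) /transports_comp /(_ (transports_swap nu la)).
by apply: transports_eq => -[x y] /=; rewrite ?mul1r ?mulr1.
Qed.

Lemma transports_prod d1 d2 d3 d4 (X : measurableType d1) (Y : measurableType d2)
  (Z : measurableType d3) (V : measurableType d4)
  (mu : {sigma_finite_measure set X -> \bar R}) (nu : {sigma_finite_measure set Y -> \bar R})
  (la : {sigma_finite_measure set Z -> \bar R}) (ka : {sigma_finite_measure set V -> \bar R})
  w1 T1 w2 T2 : transports mu la w1 T1 -> transports nu ka w2 T2 ->
  transports (sprod mu nu) (sprod la ka) (fun p => w1 p.1 * w2 p.2) (fun p => (T1 p.1, T2 p.2)).
Proof.
move=> t1 t2; have [mw1 _ mT1 _] := t1; have [mw2 _ mT2 _] := t2.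
have h1 : transports (sprod mu nu) (sprod la nu) (fun p => w1 p.1) (fun p => (T1 p.1, p.2)).
  apply: (@transports_fiber_l _ _ _ _ _ _ mu nu la (fun p => w1 p.1) (fun p => T1 p.1)).
  - exact: measurableT_comp.
  - exact: measurableT_comp.
  - by [].
have h2 : transports (sprod la nu) (sprod la ka) (fun p => w2 p.2) (fun p => (p.1, T2 p.2)).
  apply: (@transports_fiber_r _ _ _ _ _ _ la nu ka (fun p => w2 p.2) (fun p => T2 p.2)).
  - exact: measurableT_comp.
  - exact: measurableT_comp.
  - by [].
exact: transports_comp h1 h2.
Qed.

(** Since [w] is positive, [mu] and the measure of density [w] have the same null
    sets. *)
Lemma transports_ae d1 d2 (X : measurableType d1) (Y : measurableType d2)
  (mu : {sigma_finite_measure set X -> \bar R}) (nu : {sigma_finite_measure set Y -> \bar R}) w T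
  (P : Y -> Prop) : transports mu nu w T -> (forall x, 0 < w x) ->
  {ae nu, forall y, P y} -> {ae mu, forall x, P (T x)}.
Proof.
move=> [mw w0 mT h] wp [N [mN N0 PN]]; exists (T @^-1` N); split.
- by rewrite -[X in measurable X]setTI; exact: mT.
- have mTN : measurable (T @^-1` N) by rewrite -[X in measurable X]setTI; exact: mT.
  have m1 : measurable_fun setT (fun y => (\1_N y : R)%:E) by exact/measurable_EFinP.
  have hN : (\int[mu]_x ((w x)%:E * (\1_N (T x))%:E) = 0)%E.
    rewrite (h (fun y => (\1_N y)%:E)); [by rewrite integral_indic// setIT|exact: m1|].
    by move=> y; rewrite lee_fin indicE ler0n.
  have mf : measurable_fun setT (fun x => (w x)%:E * (\1_N (T x))%:E)%E.
    by apply: emeasurable_funM; [exact/measurable_EFinP|exact: (measurableT_comp m1 mT)].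
  have /(ae_eq_integral_abs mu measurableT mf) : (\int[mu]_x `|(w x)%:E * (\1_N (T x))%:E| = 0)%E.
    rewrite -hN; apply: eq_integral => x _; rewrite gee0_abs// mule_ge0// lee_fin//.
  move=> [M [mM M0 hM]]; apply/eqP; rewrite eq_le measure_ge0 andbT -M0.
  apply: le_measure; rewrite ?inE//; move=> x /= Nx; apply: hM => /= /(_ I).
  rewrite indicE mem_set// mule1 => -[] /eqP; apply/negP; exact: lt0r_neq0.
by move=> x /= nP; apply: PN.
Qed.

End transports_calculus.

Section lebesgue_affine.
Context (R : realType).
Local Notation leb := (@lebesgue_measure R).

(** Both sides are measures, compared on half-open intervals. *)
Lemma transports_leb_pos (c a : R) : 0 < c ->
  transports leb leb (fun=> c) (fun x => c * x + a : measurableTypeR R).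
Proof.
move=> c0; have mT : measurable_fun setT (fun x : measurableTypeR R => c * x + a : measurableTypeR R).
  by apply: measurable_funD => //; exact: measurable_funM.
split=> //; first by move=> x; exact: ltW.
move=> h mh h0.
pose k : {nonneg R} := NngNum (ltW c0).
rewrite ge0_integralZl_EFin ?(ltW c0)//; last exact: (measurableT_comp mh mT).
have := @ge0_integral_pushforward _ _ _ _ R _ mT leb setT h measurableT mh (fun y _ => h0 y).
rewrite preimage_setT => /= <-.
have := @ge0_integral_mscale _ _ R (pushforward leb (fun x : measurableTypeR R => c * x + a : measurableTypeR R)) setT measurableT k h mh (fun y _ => h0 y).
move=> /= <-; apply: eq_measure_integral => A mA _; apply/esym.
apply: lebesgue_measure_unique => //= _ [[p q]] _ <-.
rewrite /mscale /= /pushforward.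
have -> : (fun x : measurableTypeR R => c * x + a : measurableTypeR R) @^-1` `]p, q] = `](p - a) / c, (q - a) / c]%classic.
  apply/seteqP; split=> x /=; rewrite !in_itv/= ltr_pdivrMr// ler_pdivlMr// ltrBlDr lerBrDr (mulrC x).
    by [].
  by [].
rewrite !lebesgue_measure_itv/= !lte_fin ltr_pM2r ?invr_gt0// ltrD2r.
case: ifP => _; last by rewrite mule0.
by rewrite -!EFinB -EFinM; congr EFin; field; rewrite gt_eqF.
Qed.

Lemma transports_leb_opp : transports leb leb (fun=> 1) (fun x => - x : measurableTypeR R).
Proof.
have mT : measurable_fun setT (fun x : measurableTypeR R => - x : measurableTypeR R) by exact: measurableT_comp.
split=> // h mh h0; under eq_integral do rewrite mul1e.
have := @ge0_integral_pushforward _ _ _ _ R _ mT leb setT h measurableT mh (fun y _ => h0 y).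
rewrite preimage_setT => /= <-; apply: eq_measure_integral => A mA _.
exact: lebesgue_measureN.
Qed.

Lemma transports_leb_affine (c a : R) : c != 0 ->
  transports leb leb (fun=> `|c|) (fun x => c * x + a : measurableTypeR R).
Proof.
rewrite neq_lt => /orP[c0|c0]; last by rewrite gtr0_norm//; exact: transports_leb_pos.
have c1 : 0 < - c by rewrite oppr_gt0.
have := transports_comp transports_leb_opp (transports_leb_pos a c1).
by apply: transports_eq => x /=; rewrite ?mul1r ?ltr0_norm// mulrNN.
Qed.

End lebesgue_affine.

Section lebesgue_rV_affine.
Context (R : realType).
Local Notation leb := (@lebesgue_measure R).

Lemma transports_cons n :
  transports (sprod leb (lebesgue_rV R n)) (lebesgue_rV R n.+1) (fun=> 1) (@cons_rV R n).
Proof.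
split=> //; first exact: measurable_cons_rV.
move=> h mh h0; under eq_integral do rewrite mul1e.
have := @ge0_integral_pushforward _ _ _ _ R _ (@measurable_cons_rV R n)
  (sprod leb (lebesgue_rV R n)) setT h measurableT mh (fun y _ => h0 y).
by rewrite preimage_setT.
Qed.

Lemma transports_uncons n :
  transports (lebesgue_rV R n.+1) (sprod leb (lebesgue_rV R n)) (fun=> 1) (@uncons_rV R n).
Proof.
have [_ _ _ hc] := transports_cons n; have mu_ := @measurable_uncons_rV R n.
split=> // h mh h0; under eq_integral do rewrite mul1e.
rewrite -hc//; last exact: (measurableT_comp mh mu_).
by apply: eq_integral => p _; rewrite mul1e cons_rVK.
Qed.

Lemma rV0_eq (x y : 'rV[R]_0) : x = y.
Proof. by apply/rowP => -[]. Qed.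

Lemma measurable_affine_rV n (c : R) (a : 'rV[R]_n) : measurable_fun setT (fun x : 'rV[R]_n => c *: x + a).
Proof.
apply: measurable_fun_rV => i; under eq_fun do rewrite !mxE.
by apply: measurable_funD => //; apply: measurable_funM => //; exact: measurable_coor_rV.
Qed.

Lemma transports_rV_affine n (c : R) (a : 'rV[R]_n) : c != 0 ->
  transports (lebesgue_rV R n) (lebesgue_rV R n) (fun=> `|c| ^+ n) (fun x => c *: x + a).
Proof.
move=> c0; elim: n a => [|n IH] a.
  rewrite expr0; split=> //; first exact: measurable_affine_rV.
  move=> h mh h0; apply: eq_integral => x _; rewrite mul1e; congr h.
  exact: rV0_eq.
have := transports_prod (transports_leb_affine (a ord0 ord0) c0) (IH (\row_j a ord0 (lift ord0 j))).
move=> /(transports_comp (transports_uncons n)) /transports_comp /(_ (transports_cons n)).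
apply: transports_eq => x /=; first by rewrite mul1r mulr1 exprS.
by apply/rowP => i; rewrite /cons_rV mxE; case: unliftP => [j ->|->]; rewrite !mxE.
Qed.

Lemma transports_rV_scale n (c : R) : c != 0 ->
  transports (lebesgue_rV R n) (lebesgue_rV R n) (fun=> `|c| ^+ n) (fun x => c *: x).
Proof.
move=> c0; have := transports_rV_affine (0 : 'rV[R]_n) c0.
by apply: transports_eq => x //=; rewrite addr0.
Qed.

Lemma transports_rV_shift n (a : 'rV[R]_n) :
  transports (lebesgue_rV R n) (lebesgue_rV R n) (fun=> 1) (fun x => x + a).
Proof.
have := transports_rV_affine a (oner_neq0 R).
by apply: transports_eq => x /=; rewrite ?normr1 ?expr1n// scale1r.
Qed.

Lemma transports_leb_shift (a : R) : transports leb leb (fun=> 1) (fun x => x + a : measurableTypeR R).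
Proof.
have := transports_leb_affine a (oner_neq0 R).
by apply: transports_eq => x /=; rewrite ?normr1// mul1r.
Qed.

End lebesgue_rV_affine.

Section weighted_compositions.
Context (R : realType).

(** The operator [f |-> (p |-> wm p * f (wT p))] together with the data [wn], [wS] of
    its inverse: the inverse must be explicit for the identities between words
    in such operators and their adjoints to be computations. *)
Record wc (X : Type) := WC { wm : X -> R[i]; wT : X -> X; wn : X -> R[i]; wS : X -> X }.

Definition wact d (X : measurableType d) (W : wc X) : op R X := fun f p => wm W p * f (wT W p).
Definition winv X (W : wc X) : wc X := WC (wn W) (wS W) (wm W) (wT W).
Definition wcomp X (W V : wc X) : wc X :=
  WC (fun p => wm W p * wm V (wT W p)) (wT V \o wT W)
     (fun p => wn V p * wn W (wS V p)) (wS W \o wS V).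
Definition wleft X Y (W : wc X) : wc (X * Y) :=
  WC (fun p => wm W p.1) (fun p => (wT W p.1, p.2)) (fun p => wn W p.1) (fun p => (wS W p.1, p.2)).
Definition wright X Y (W : wc Y) : wc (X * Y) :=
  WC (fun p => wm W p.2) (fun p => (p.1, wT W p.2)) (fun p => wn W p.2) (fun p => (p.1, wS W p.2)).

Lemma wact_comp d (X : measurableType d) (W V : wc X) : wact (wcomp W V) = wact W \o wact V.
Proof. by apply/funext => f; apply/funext => p; rewrite /wact /= mulrA. Qed.

Lemma winv_comp X (W V : wc X) : winv (wcomp W V) = wcomp (winv V) (winv W).
Proof. by []. Qed.

Section validity.
Context d (X : measurableType d) (mu : {sigma_finite_measure set X -> \bar R}).

(** The conditions that make the operator unitary: [|wm|^2] is the Jacobian of the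
    bijection [wT]. *)
Definition wvalid (W : wc X) :=
  [/\ cmeas (wm W), cmeas (wn W), transports mu mu (fun p => nsq (wm W p)) (wT W),
      measurable_fun setT (wS W)
    & [/\ cancel (wT W) (wS W), cancel (wS W) (wT W) & forall p, wm W p * wn W (wT W p) = 1]].

Lemma wvalid_inv W : wvalid W -> wvalid (winv W).
Proof.
move=> [mm mn tT mS [TS ST mn1]]; have [_ _ mT h] := tT.
have nm1 q : wn W q * wm W (wS W q) = 1 by rewrite -{1}(ST q) mulrC mn1.
split=> //=; split=> //.
- exact: measurable_nsq.
- by move=> x; exact: nsq_ge0.
move=> k mk k0; rewrite -h//.
- apply: eq_integral => x _; rewrite TS muleA -EFinM -nsqM mn1 nsq1 mul1e//.
- apply: emeasurable_funM; first exact: measurable_ensq.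
  exact: measurableT_comp.
- by move=> x; rewrite mule_ge0// lee_fin nsq_ge0.
Qed.

Lemma wvalid_comp W V : wvalid W -> wvalid V -> wvalid (wcomp W V).
Proof.
move=> [mm mn tT mS [TS ST mn1]] [mm' mn' tT' mS' [TS' ST' mn1']].
have [_ _ mT _] := tT.
split=> /=.
- by apply: cmeasM => //; exact: cmeas_comp mT mm'.
- by apply: cmeasM => //; exact: cmeas_comp mS' mn.
- by have := transports_comp tT tT'; apply: transports_eq => p //=; rewrite nsqM.
- exact: measurableT_comp.
split; [exact: can_comp|exact: can_comp|].
move=> p; rewrite TS' -mulrA [wm V _ * _]mulrA mn1' mul1r//.
Qed.

Lemma wact_enorm2 W f : wvalid W -> cmeas f -> enorm2 mu (wact W f) = enorm2 mu f.
Proof.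
by move=> [mm mn tT mS _] mf; apply: (transports_enorm2 (m := wm W) tT).
Qed.

Lemma wact_bop W : wvalid W -> bounded_op mu (wact W).
Proof.
move=> vW; have [mm mn tT mS _] := vW; have [_ _ mT _] := tT.
have LW f : L2 mu f -> L2 mu (wact W f).
  move=> /L2P[mf oo]; apply/L2P; split; last by rewrite wact_enorm2.
  by apply: cmeasM => //; exact: cmeas_comp mT mf.
apply: (@bop_intro _ _ _ _ _ 1) => //.
- by move=> a f g _ _; apply: aeW => p _; rewrite /wact; ring.
- move=> f Lf; rewrite mul1r !sqnE//; last exact: LW.
  by rewrite wact_enorm2//; exact: L2_cmeas Lf.
Qed.

Lemma wact_adjoint W : wvalid W -> is_adjoint mu (wact W) (wact (winv W)).
Proof.
move=> vW; split; first exact/wact_bop/wvalid_inv.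
move=> f g Lf Lg; have [mm mn tT mS [TS ST mn1]] := vW.
have mk : cmeas (fun q => f q * (wact (winv W) g q)^*).
  apply: cmeasM; first exact: (L2_cmeas Lf).
  by apply: cmeasJ; apply: cmeasM => //; exact: cmeas_comp mS (L2_cmeas Lg).
rewrite /inner -[RHS](transports_cint tT mk).
congr cint; apply/funext => p; rewrite /wact /= TS -mulcJ rmorphM/=.
have E : (wm W p)^* * (wn W (wT W p))^* = 1 by rewrite -rmorphM/= mn1 rmorph1.
rewrite -[LHS]mulr1 -E; ring.
Qed.

Lemma wact_unitary W : wvalid W -> unitary mu (wact W) (wact (winv W)).
Proof.
move=> vW; have vi := wvalid_inv vW.
have [mm mn tT mS [TS ST mn1]] := vW.
have nm1 q : wn W q * wm W (wS W q) = 1 by rewrite -{1}(ST q) mulrC mn1.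
split; [exact: wact_adjoint|exact: (wact_adjoint vi)| |] => f Lf; apply: aeW => p _; rewrite /wact /=.
  by rewrite TS mulrA mn1 mul1r.
by rewrite ST mulrA nm1 mul1r.
Qed.

End validity.

Lemma wvalid_left d1 d2 (X : measurableType d1) (Y : measurableType d2)
  (mu : {sigma_finite_measure set X -> \bar R}) (nu : {sigma_finite_measure set Y -> \bar R}) W :
  wvalid mu W -> wvalid (sprod mu nu) (wleft Y W).
Proof.
move=> [mm mn tT mS [TS ST mn1]]; split=> /=.
- exact: (cmeas_comp (h := fst)).
- exact: (cmeas_comp (h := fst)).
- have := transports_prod tT (transports_id nu).
  by apply: transports_eq => p //=; rewrite mulr1.
- by apply/measurable_fun_pair => //; exact: measurableT_comp.
by split=> -[x y] /=; rewrite ?TS ?ST.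
Qed.

Lemma wvalid_right d1 d2 (X : measurableType d1) (Y : measurableType d2)
  (mu : {sigma_finite_measure set X -> \bar R}) (nu : {sigma_finite_measure set Y -> \bar R}) W :
  wvalid nu W -> wvalid (sprod mu nu) (wright X W).
Proof.
move=> [mm mn tT mS [TS ST mn1]]; split=> /=.
- exact: (cmeas_comp (h := snd)).
- exact: (cmeas_comp (h := snd)).
- have := transports_prod (transports_id mu) tT.
  by apply: transports_eq => p //=; rewrite mul1r.
- by apply/measurable_fun_pair => //; exact: measurableT_comp.
by split=> -[x y] /=; rewrite ?TS ?ST.
Qed.

Lemma tens_wact d1 d2 (X : measurableType d1) (Y : measurableType d2)
  (mu : {sigma_finite_measure set X -> \bar R}) (nu : {sigma_finite_measure set Y -> \bar R})
  e e' W V : onb mu e -> onb nu e' -> wvalid mu W -> wvalid nu V ->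
  op_eq (sprod mu nu) (tens mu nu (wact W) (wact V)) (wact (wcomp (wleft Y W) (wright X V))).
Proof.
move=> eP eP' vW vV; apply: (tens_unique eP eP'); try exact: wact_bop.
  by apply: wact_bop; apply: wvalid_comp; [exact: wvalid_left|exact: wvalid_right].
move=> f g _ _; apply: aeW => p _; rewrite /wact /ftens /=; ring.
Qed.

Lemma tens_wact_l d1 d2 (X : measurableType d1) (Y : measurableType d2)
  (mu : {sigma_finite_measure set X -> \bar R}) (nu : {sigma_finite_measure set Y -> \bar R})
  e e' W : onb mu e -> onb nu e' -> wvalid mu W ->
  op_eq (sprod mu nu) (tens mu nu (wact W) id) (wact (wleft Y W)).
Proof.
move=> eP eP' vW; apply: (tens_unique eP eP'); [exact: wact_bop|exact: bop_id| |].
  by apply: wact_bop; exact: wvalid_left.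
by move=> f g _ _; apply: aeW => p _; rewrite /wact /ftens /=; ring.
Qed.

Lemma tens_wact_r d1 d2 (X : measurableType d1) (Y : measurableType d2)
  (mu : {sigma_finite_measure set X -> \bar R}) (nu : {sigma_finite_measure set Y -> \bar R})
  e e' W : onb mu e -> onb nu e' -> wvalid nu W ->
  op_eq (sprod mu nu) (tens mu nu id (wact W)) (wact (wright X W)).
Proof.
move=> eP eP' vW; apply: (tens_unique eP eP'); [exact: bop_id|exact: wact_bop| |].
  by apply: wact_bop; exact: wvalid_right.
by move=> f g _ _; apply: aeW => p _; rewrite /wact /ftens /=; ring.
Qed.

End weighted_compositions.

(** * Orthonormal bases for Lebesgue measure *)

Section line_basis.
Context (R : realType).
Local Notation leb := (@lebesgue_measure R).

Definition cindic d (T : measurableType d) (A : set T) : cfun R T := fun x => (\1_A x)%:C%C.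

Lemma L2_cindic d (T : measurableType d) (mu : {sigma_finite_measure set T -> \bar R}) (A : set T) :
  measurable A -> (mu A < +oo)%E -> L2 mu (cindic A).
Proof.
move=> mA oo; apply/L2P; split; first exact: cmeas_real.
rewrite /enorm2 (_ : (fun x => _) = (fun x => (\1_A x)%:E)); last first.
  by apply/funext => x; rewrite nsq_real indicE; case: (x \in A) => /=; rewrite ?expr1n ?expr0n.
by rewrite integral_indic// setIT.
Qed.

(** For the differentiation theorem an interval around [x] need not be centred: it
    suffices that it lies in a ball around [x] of comparable measure, which
    leaves room for rational end points. *)
Lemma rational_nicely_shrinking (x : R) : exists pq : nat -> rat * rat,
  nicely_shrinking x (fun k => `](ratr (pq k).1 : R), (ratr (pq k).2 : R)[%classic).
Proof.
have h (k : nat) : exists pq : rat * rat,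
    [/\ x - k.+1%:R^-1 < ratr pq.1 :> R, ratr pq.1 < x - k.+1%:R^-1 / 2 :> R,
        x + k.+1%:R^-1 / 2 < ratr pq.2 :> R & ratr pq.2 < x + k.+1%:R^-1 :> R].
  have k0 : 0 < k.+1%:R^-1 :> R by rewrite invr_gt0.
  move: (k.+1%:R^-1) k0 => u u0.
  have [|p] := @rat_in_itvoo _ (x - u) (x - u / 2); first by lra.
  have [|q] := @rat_in_itvoo _ (x + u / 2) (x + u); first by lra.
  by rewrite !in_itv/= => /andP[q1 q2] /andP[p1 p2]; exists (p, q).
have [pq hpq] := choice h; exists pq; split; first by move=> k; exact: measurable_itv.
pose r k : {posnum R} := PosNum (@harmonic_gt0 R k).
exists (2, r); split=> //=.
- exact: cvg_harmonic.
- move=> k y /=; rewrite ball_itv/= !in_itv/= => /andP[y1 y2].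
  have [h1 h2 h3 h4] := hpq k; rewrite /= in h1 h4 *.
  by rewrite (lt_trans h1 y1) (lt_trans y2 h4).
move=> k; have k0 : 0 < k.+1%:R^-1 :> R by rewrite invr_gt0.
rewrite lebesgue_measure_ball//= lebesgue_measure_itv/= lte_fin.
have [] := hpq k; move: k0; rewrite /=.
move: (k.+1%:R^-1) (ratr _) (ratr _) => u a b u0 h1 h2 h3 h4.
rewrite ifT; last by lra.
by rewrite -EFinB -EFinM lee_fin; lra.
Qed.

(** At a Lebesgue point the value is the limit of the means over intervals with
    rational end points. *)
Lemma rational_intervals_total (h : R -> R) : locally_integrable setT h ->
  (forall p q : rat, \int[leb]_(x in `](ratr p : R), (ratr q : R)[) (h x)%:E = 0)%E ->
  {ae leb, forall x, h x = 0}.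
Proof.
move=> lh h0; have := lebesgue_differentiation lh.
apply: (@filterS _ _ (ae_filter_ringOfSetsType leb)) => x hx.
pose P y := sval (cid (rational_nicely_shrinking y)).
have hE y : nicely_shrinking y (fun k => `](ratr (P y k).1 : R), (ratr (P y k).2 : R)[%classic).
  by rewrite /P; case: cid.
have := nice_lebesgue_differentiation hE lh hx.
under eq_fun do rewrite h0 mule0.
move=> c; have E : 0%E = (h x)%:E.
  by apply: (cvg_unique (@ereal_hausdorff R) _ c); exact: cvg_cst.
by case: E.
Qed.

Lemma L2_locally_integrable (f : cfun R (measurableTypeR R)) : L2 leb f ->
  locally_integrable setT (fun x => complex.Re (f x)) /\
  locally_integrable setT (fun x => complex.Im (f x)).
Proof.
move=> Lf; have [m1 m2] := L2_cmeas Lf.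
have key (K : set R) : compact K -> measurable K /\ cintegrable leb (fun x => f x * cindic K x).
  move=> cK; have mK := compact_measurable cK; split=> //; apply: cintegrable_mul => //.
  apply: L2_cindic => //; exact: compact_finite_measure.
split; split=> //; try exact: openT.
- move=> K _ /key[mK [/integrableP[_ oo] _]].
  rewrite integral_mkcond; apply: le_lt_trans oo; apply: ge0_le_integral => //.
  + by move=> x _; rewrite patchE; case: ifP.
  + apply/(measurable_restrictT _ _).1 => //; apply: measurable_funTS; apply/measurable_EFinP.
    exact: measurableT_comp.
  + apply: measurableT_comp => //; apply/measurable_EFinP.
    have [//] := cmeasM (L2_cmeas Lf) (cmeas_real (measurable_indic mK)).
  + move=> x _; rewrite patchE; case: ifPn => [xK|_] /=; last by rewrite (_ : point = 0%E)// lee_fin.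
    by rewrite cReM/= indicE xK mulr1 mulr0 subr0.
- move=> K _ /key[mK [_ /integrableP[_ oo]]].
  rewrite integral_mkcond; apply: le_lt_trans oo; apply: ge0_le_integral => //.
  + by move=> x _; rewrite patchE; case: ifP.
  + apply/(measurable_restrictT _ _).1 => //; apply: measurable_funTS; apply/measurable_EFinP.
    exact: measurableT_comp.
  + apply: measurableT_comp => //; apply/measurable_EFinP.
    have [//] := cmeasM (L2_cmeas Lf) (cmeas_real (measurable_indic mK)).
  + move=> x _; rewrite patchE; case: ifPn => [xK|_] /=; last by rewrite (_ : point = 0%E)// lee_fin.
    by rewrite cImM/= indicE xK mulr1 mulr0 add0r.
Qed.

(** The intervals with rational end points, listed with zero functions in the
    gaps of the enumeration. *)
Definition itv_seq (k : nat) : cfun R (measurableTypeR R) :=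
  if unpickle k is Some (p, q) then cindic `](ratr p : R), (ratr q : R)[%classic else fun=> 0.

Lemma onb_leb : exists e, onb leb e.
Proof.
have Li (p q : rat) : L2 leb (cindic `](ratr p : R), (ratr q : R)[%classic : cfun R (measurableTypeR R)).
  apply: L2_cindic; first exact: measurable_itv.
  by rewrite /= lebesgue_measure_itv/=; case: ifP; rewrite -?EFinB ltry.
have Lv k : L2 leb (itv_seq k).
  by rewrite /itv_seq; case: unpickle => [[p q]|]; [exact: Li|exact: L2_0].
exists (gs leb itv_seq); apply: onb_gs => // f Lf h.
have [l1 l2] := L2_locally_integrable Lf.
have hf p q : cint leb (fun x => f x * cindic `](ratr p : R), (ratr q : R)[%classic x) = 0.
  rewrite -[RHS](h (pickle (p, q))) /inner /itv_seq pickleK; congr cint; apply/funext => x.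
  by congr (_ * _); apply: complex_ext; rewrite ?cReJ ?cImJ /= ?oppr0.
have fi p q := cintegrable_mul Lf (Li p q).
have [m1 m2] := L2_cmeas Lf.
have e1 : {ae leb, forall x, complex.Re (f x) = 0}.
  apply: rational_intervals_total => // p q.
  have [/integrable_fin_num-/(_ measurableT) fn _] := fi p q.
  have := congr1 (@complex.Re R) (hf p q); rewrite /= /Rintegral => E.
  rewrite integral_mkcond; rewrite -[RHS]/((0 : R)%:E) -E fineK//.
  apply: eq_integral => x _; rewrite patchE cReM/= mulr0 subr0 indicE.
  by case: ifP; rewrite ?mulr1 ?mulr0.
have e2 : {ae leb, forall x, complex.Im (f x) = 0}.
  apply: rational_intervals_total => // p q.
  have [_ /integrable_fin_num-/(_ measurableT) fn] := fi p q.
  have := congr1 (@complex.Im R) (hf p q); rewrite /= /Rintegral => E.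
  rewrite integral_mkcond; rewrite -[RHS]/((0 : R)%:E) -E fineK//.
  apply: eq_integral => x _; rewrite patchE cImM/= mulr0 add0r indicE.
  by case: ifP; rewrite ?mulr1 ?mulr0.
by apply: filterS2 e1 e2 => x h1 h2 _; exact: complex_ext.
Qed.

Lemma onb_rV n : exists e, onb (lebesgue_rV R n) e.
Proof.
elim: n => [|n [e eP]]; last first.
  have [e' eP'] := onb_leb.
  have := onb_transport (transports_cons R n) (@measurable_uncons_rV R n) (@cons_rVK R n) (@uncons_rVK R n) (onb_sprod eP' eP).
  by move=> h; eexists; exact: h.
(* dimension zero: the measure is a point mass, and [1] spans *)
have en f : cmeas f -> enorm2 (lebesgue_rV R 0) f = (nsq (f 0))%:E.
  move=> mf; rewrite /enorm2 /= integral_dirac ?diracT ?mul1e//.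
  exact: measurable_ensq.
have E0 (f : 'rV[R]_0 -> R[i]) : f = fun=> f 0 by apply/funext => x; rewrite (rV0_eq x 0).
have mf f : @cmeas R _ 'rV[R]_0 f by rewrite (E0 f); exact: cmeas_cst.
have Lf f : L2 (lebesgue_rV R 0) f by apply/L2P; split=> //; rewrite en// ltry.
have sq f : sqn (lebesgue_rV R 0) f = nsq (f 0) by rewrite sqnE// en.
exists (fun k => if k == 0%N then fun=> 1 else fun=> 0); split=> //.
- move=> i j; case: (eqVneq i 0%N) => [->|i0].
    rewrite eq_sym => /negbTE ->; rewrite innerC// inner0l// rmorph0//.
  by move=> _; rewrite inner0l.
- by move=> i; rewrite sq; case: ifP; rewrite ?nsq1 ?nsq0; [right|left].
move=> f _ /(_ 0%N) h; apply/sqn_eq0 => //; rewrite sq.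
have : inner (lebesgue_rV R 0) f (fun=> 1) = f 0.
  rewrite /inner (_ : (fun x => _) = f); last by apply/funext => x; rewrite rmorph1 mulr1.
  have [m1 m2] := mf f.
  rewrite /cint /Rintegral /= !integral_dirac//; try exact/measurable_EFinP.
  by rewrite !diracT !mul1e /=; case: (f 0).
by rewrite h => <-; rewrite nsq0.
Qed.

Lemma onb_mu1 n : exists e, onb (@mu1 R n) e.
Proof.
have [e eP] := onb_rV n; have [e' eP'] := onb_leb.
by eexists; exact: (onb_sprod (onb_sprod eP eP) eP').
Qed.

End line_basis.

(** * Operators acting as weighted compositions; phases and the function eta *)

Section representation.
Context (R : realType) d (X : measurableType d) (mu : {sigma_finite_measure set X -> \bar R}).

(** Operators built with [tens] and [adj] are known up to [op_eq] only; through
    this relation they are replaced by explicit formulas. *)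
Definition rep (A : op R X) (W : wc R X) :=
  [/\ op_eq mu A (wact W), bounded_op mu A & wvalid mu W].

Lemma rep_wact W : wvalid mu W -> rep (wact W) W.
Proof. by move=> vW; split=> //; [exact: op_eq_refl|exact: wact_bop]. Qed.

Lemma rep_comp A B W V : rep A W -> rep B V -> rep (A \o B) (wcomp W V).
Proof.
move=> [AW bA vW] [BV bB vV]; split; last exact: wvalid_comp.
  rewrite wact_comp; apply: op_eq_comp => //; exact: wact_bop.
exact: bop_comp.
Qed.

Lemma rep_adj A W : rep A W -> rep (adj mu A) (winv W).
Proof.
move=> [AW bA vW]; have [[b' h1] _ u1 u2] := wact_unitary vW.
have bW := wact_bop vW.
have uA : unitary mu A (wact (winv W)).
  split.
  - split=> // f g Lf Lg; rewrite -h1//; apply: inner_ael => //; [exact: bop_L2|exact: bop_L2|exact: AW].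
  - split=> // f g Lf Lg; have Lf' := bop_L2 b' Lf; have LA := bop_L2 bA Lg; have LW := bop_L2 bW Lg.
    rewrite [LHS]innerC// -h1// [RHS]innerC//; congr (_^*); apply: inner_ael => //.
    exact/ae_equal_sym/AW.
  - by apply: op_eq_trans u1; apply: op_eq_comp => //; exact: op_eq_refl.
  - by apply: op_eq_trans u2; apply: op_eq_comp => //; exact: op_eq_refl.
by have [h b] := adj_unitary uA; split=> //; exact: wvalid_inv.
Qed.

End representation.

Section representation_tens.
Context (R : realType) d1 d2 (X : measurableType d1) (Y : measurableType d2).
Context (mu : {sigma_finite_measure set X -> \bar R}) (nu : {sigma_finite_measure set Y -> \bar R}).
Context (e : nat -> cfun R X) (e' : nat -> cfun R Y) (eP : onb mu e) (eP' : onb nu e').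

Lemma rep_tens A B W V : rep mu A W -> rep nu B V ->
  rep (sprod mu nu) (tens mu nu A B) (wcomp (wleft Y W) (wright X V)).
Proof.
move=> [AW bA vW] [BV bB vV]; split.
- apply: op_eq_trans (tens_wact eP eP' vW vV).
  by apply: (tens_eq eP eP') => //; exact: wact_bop.
- exact: (bop_tens eP eP').
- by apply: wvalid_comp; [exact: wvalid_left|exact: wvalid_right].
Qed.

Lemma rep_left A W : rep mu A W -> rep (sprod mu nu) (tens mu nu A id) (wleft Y W).
Proof.
move=> [AW bA vW]; split; [|exact: (bop_tens eP eP' bA (bop_id nu))|exact: wvalid_left].
apply: op_eq_trans (tens_wact_l eP eP' vW).
by apply: (tens_eq eP eP') => //; [exact: wact_bop|exact: bop_id|exact: bop_id|exact: op_eq_refl].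
Qed.

Lemma rep_right B W : rep nu B W -> rep (sprod mu nu) (tens mu nu id B) (wright X W).
Proof.
move=> [AW bA vW]; split; [|exact: (bop_tens eP eP' (bop_id mu) bA)|exact: wvalid_right].
apply: op_eq_trans (tens_wact_r eP eP' vW).
by apply: (tens_eq eP eP') => //; [exact: bop_id|exact: bop_id|exact: wact_bop|exact: op_eq_refl].
Qed.

End representation_tens.

Section phases.
Context (R : realType) (n : nat).
Local Notation Rn := 'rV[R]_n.

Lemma betaDl (x y z : Rn) : beta (x + y) z = beta x z + beta y z.
Proof. by rewrite /beta -big_split/=; apply: eq_bigr => i _; rewrite mxE mulrDl. Qed.
Lemma betaDr (x y z : Rn) : beta z (x + y) = beta z x + beta z y.
Proof. by rewrite /beta -big_split/=; apply: eq_bigr => i _; rewrite mxE mulrDr. Qed.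
Lemma betaZl a (x z : Rn) : beta (a *: x) z = a * beta x z.
Proof. by rewrite /beta mulr_sumr; apply: eq_bigr => i _; rewrite mxE mulrA. Qed.
Lemma betaZr a (x z : Rn) : beta z (a *: x) = a * beta z x.
Proof. by rewrite /beta mulr_sumr; apply: eq_bigr => i _; rewrite mxE mulrCA. Qed.
Lemma betaNl (x z : Rn) : beta (- x) z = - beta x z.
Proof. by rewrite -scaleN1r betaZl mulN1r. Qed.
Lemma betaNr (x z : Rn) : beta z (- x) = - beta z x.
Proof. by rewrite -scaleN1r betaZr mulN1r. Qed.
Definition betaE := (betaDl, betaDr, betaZl, betaZr, betaNl, betaNr).

Lemma ephaseD (s t : R) : ephase (s + t) = ephase s * ephase t.
Proof. by apply: complex_ext; rewrite ?cReM ?cImM /= mulrDr ?cosD ?sinD// addrC. Qed.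
Lemma ephase0 : ephase 0 = 1 :> R[i].
Proof. by apply: complex_ext; rewrite /= mulr0 ?cos0 ?sin0. Qed.
Lemma ephaseJ (t : R) : (ephase t)^* = ephase (- t).
Proof. by apply: complex_ext; rewrite ?cReJ ?cImJ /= mulrN ?cosN ?sinN. Qed.
Lemma nsq_ephase (t : R) : nsq (ephase t) = 1.
Proof. by rewrite /nsq /= cos2Dsin2. Qed.

(** In this form products of weights are computed on moduli and arguments
    separately. *)
Definition polar (u t : R) : R[i] := u%:C%C * ephase t.

Lemma polarM u s v t : polar u s * polar v t = polar (u * v) (s + t).
Proof. by rewrite /polar ephaseD rmorphM/=; ring. Qed.
Lemma polar1 : polar 1 0 = 1. Proof. by rewrite /polar ephase0 mulr1. Qed.
Lemma nsq_polar u t : nsq (polar u t) = u ^+ 2.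
Proof. by rewrite /polar nsqM nsq_real nsq_ephase mulr1. Qed.

Lemma cmeas_ephase d (T : measurableType d) (t : T -> R) : measurable_fun setT t ->
  cmeas (fun x => ephase (t x)).
Proof.
move=> mt; have m2 : measurable_fun setT (fun x => 2 * pi * t x) by exact: measurable_funM.
split=> /=; first exact: (measurableT_comp (continuous_measurable_fun (@continuous_cos R)) m2).
exact: (measurableT_comp (continuous_measurable_fun (@continuous_sin R)) m2).
Qed.

Lemma cmeas_polar d (T : measurableType d) (u t : T -> R) : measurable_fun setT u ->
  measurable_fun setT t -> cmeas (fun x => polar (u x) (t x)).
Proof. by move=> mu mt; apply: cmeasM; [exact: cmeas_real|exact: cmeas_ephase]. Qed.

Section measurability.
Context d (T : measurableType d).
Implicit Types (v w : T -> Rn) (c : T -> R).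

Lemma mrV_scale c v : measurable_fun setT c -> measurable_fun setT v ->
  measurable_fun setT (fun p => c p *: v p).
Proof.
move=> mc mv; apply: measurable_fun_rV => i; under eq_fun do rewrite mxE.
by apply: measurable_funM => //; exact: (measurableT_comp (measurable_coor_rV i) mv).
Qed.

Lemma mrV_add v w : measurable_fun setT v -> measurable_fun setT w ->
  measurable_fun setT (fun p => v p + w p).
Proof.
move=> mv mw; apply: measurable_fun_rV => i; under eq_fun do rewrite mxE.
by apply: measurable_funD; exact: (measurableT_comp (measurable_coor_rV i) _).
Qed.

Lemma mrV_opp v : measurable_fun setT v -> measurable_fun setT (fun p => - v p).
Proof.
move=> mv; under eq_fun do rewrite -scaleN1r; exact: mrV_scale.
Qed.

Lemma measurable_beta v w : measurable_fun setT v -> measurable_fun setT w ->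
  measurable_fun setT (fun p => beta (v p) (w p)).
Proof.
move=> mv mw; apply: measurable_sum => i; apply: measurable_funM.
  exact: (measurableT_comp (measurable_coor_rV i) mv).
exact: (measurableT_comp (measurable_coor_rV i) mw).
Qed.

Lemma measurable_expRl (l : R) c : measurable_fun setT c ->
  measurable_fun setT (fun p => expR (l * c p)).
Proof. by move=> mc; apply: (measurableT_comp (@measurable_expR R)); exact: measurable_funM. Qed.

Lemma measurable_eta (l : R) c : measurable_fun setT c -> measurable_fun setT (fun p => eta l (c p)).
Proof.
move=> mc; rewrite /eta; case: (l == 0) => //; apply: measurable_funM => //.
apply: measurable_funB => //; exact: measurable_expRl.
Qed.

End measurability.

Lemma eta0 (l : R) : eta l 0 = 0.
Proof. by rewrite /eta; case: ifP => // _; rewrite mulr0 expR0 subrr mul0r. Qed.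

(** [eta] is an additive cocycle for the scaling action of the line by
    [expR (l * r) ^+ 2]; the identities between phases below rest on it. *)
Lemma etaD (l r s : R) : eta l (r + s) = eta l r + expR (l * r) ^+ 2 * eta l s.
Proof.
rewrite /eta; case: eqP => [->|/eqP l0]; first by rewrite mul0r expR0 expr1n mul1r.
have E t : expR (2 * l * t) = expR (l * t) ^+ 2 by rewrite -mulrA expRM_natl.
by rewrite !E mulrDr expRD; field.
Qed.

Lemma etaN (l r : R) : eta l (- r) = - (expR (l * r))^-1 ^+ 2 * eta l r.
Proof.
have := etaD l (- r) r; rewrite addNr eta0 mulrN expRN => /eqP.
by rewrite eq_sym addr_eq0 => /eqP ->; rewrite mulNr.
Qed.

End phases.

(** * Permutations of the legs *)

Lemma integral_sprod (R : realType) (Y Z : measure_display) (A : measurableType Y) (B : measurableType Z)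
  (a : {sigma_finite_measure set A -> \bar R}) (b : {sigma_finite_measure set B -> \bar R})
  (h : A * B -> \bar R) : measurable_fun setT h -> (forall p, 0 <= h p)%E ->
  (\int[sprod a b]_p h p = \int[a]_x \int[b]_y h (x, y))%E.
Proof. by move=> mh h0; rewrite /sprod fubini_tonelli1. Qed.

Lemma measurable_inner_integral (R : realType) (Y Z : measure_display) (A : measurableType Y) (B : measurableType Z)
  (b : {sigma_finite_measure set B -> \bar R})
  (h : A * B -> \bar R) : measurable_fun setT h -> (forall p, 0 <= h p)%E ->
  measurable_fun setT (fun x => \int[b]_y h (x, y))%E.
Proof. by move=> mh h0; apply: (@measurable_fun_fubini_tonelli_F _ _ _ _ _ b h). Qed.

Lemma integral_4 (R : realType) d1 d2 d3 d4 (X1 : measurableType d1) (X2 : measurableType d2)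
  (X3 : measurableType d3) (X4 : measurableType d4)
  (m1 : {sigma_finite_measure set X1 -> \bar R}) (m2 : {sigma_finite_measure set X2 -> \bar R})
  (m3 : {sigma_finite_measure set X3 -> \bar R}) (m4 : {sigma_finite_measure set X4 -> \bar R})
  (h : (X1 * X2) * (X3 * X4) -> \bar R) : measurable_fun setT h -> (forall p, 0 <= h p)%E ->
  (\int[sprod (sprod m1 m2) (sprod m3 m4)]_p h p =
   \int[m1]_x \int[m2]_y \int[m3]_z \int[m4]_t h ((x, y), (z, t)))%E.
Proof.
move=> mh h0; have mH := measurable_inner_integral (sprod m3 m4) mh h0.
have H0 p : (0 <= \int[sprod m3 m4]_q h (p, q))%E by exact: integral_ge0.
rewrite (integral_sprod (sprod m1 m2) (sprod m3 m4) mh h0) (integral_sprod m1 m2 mH H0).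
apply: eq_integral => x _; apply: eq_integral => y _.
apply: (integral_sprod m3 m4 (h := fun q => h ((x, y), q))) => //.
by apply: (measurableT_comp mh); exact: measurable_pair1.
Qed.

(** Both sides are four-fold iterated integrals, and the two in the middle may be
    exchanged. *)
Lemma integral_middle4 (R : realType) d1 d2 d3 d4 (X1 : measurableType d1) (X2 : measurableType d2)
  (X3 : measurableType d3) (X4 : measurableType d4)
  (m1 : {sigma_finite_measure set X1 -> \bar R}) (m2 : {sigma_finite_measure set X2 -> \bar R})
  (m3 : {sigma_finite_measure set X3 -> \bar R}) (m4 : {sigma_finite_measure set X4 -> \bar R})
  (h : (X1 * X3) * (X2 * X4) -> \bar R) : measurable_fun setT h -> (forall p, 0 <= h p)%E ->
  (\int[sprod (sprod m1 m2) (sprod m3 m4)]_p h ((p.1.1, p.2.1), (p.1.2, p.2.2)) =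
   \int[sprod (sprod m1 m3) (sprod m2 m4)]_p h p)%E.
Proof.
move=> mh h0; rewrite !integral_4//=; last first.
  apply: (measurableT_comp mh); apply/measurable_fun_pair; apply/measurable_fun_pair; first
  [ exact: (measurableT_comp measurable_fst measurable_fst)
  | exact: (measurableT_comp measurable_fst measurable_snd)
  | exact: (measurableT_comp measurable_snd measurable_fst)
  | exact: (measurableT_comp measurable_snd measurable_snd)].
apply: eq_integral => x _.
have mH : measurable_fun setT (fun p : X2 * X3 => \int[m4]_t h ((x, p.2), (p.1, t)))%E.
  apply: (@measurable_inner_integral R _ _ (X2 * X3)%type X4 m4 (fun p => h ((x, p.1.2), (p.1.1, p.2)))) => //.
  apply: (measurableT_comp mh); apply/measurable_fun_pair; apply/measurable_fun_pair => //.
  - exact: (measurableT_comp measurable_snd measurable_fst).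
  - exact: (measurableT_comp measurable_fst measurable_fst).
have H0 (p : X2 * X3) : (0 <= \int[m4]_t h ((x, p.2), (p.1, t)))%E by exact: integral_ge0.
rewrite -(integral_sprod m2 m3 mH H0) /sprod fubini_tonelli2//.
Qed.

Section swaps.
Context (R : realType) d (T : measurableType d) (m : {sigma_finite_measure set T -> \bar R}).
Local Notation m2 := (sprod m m).
Local Notation m4 := (sprod m2 m2).

Definition flipw : wc R (T * T) := WC (fun=> 1) (fun p => (p.2, p.1)) (fun=> 1) (fun p => (p.2, p.1)).

Definition f23w : wc R ((T * T) * (T * T)) :=
  let s (p : (T * T) * (T * T)) := ((p.1.1, p.2.1), (p.1.2, p.2.2)) in WC (fun=> 1) s (fun=> 1) s.

Definition w12 (W : wc R (T * T)) : wc R ((T * T) * (T * T)) := wleft (T * T)%type W.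
Definition w34 (W : wc R (T * T)) : wc R ((T * T) * (T * T)) := wright (T * T)%type W.
Definition w13 W := wcomp (wcomp f23w (w12 W)) f23w.
Definition w24 W := wcomp (wcomp f23w (w34 W)) f23w.

Lemma flip_valid : wvalid m2 flipw.
Proof.
have ms : measurable_fun setT (fun p : T * T => (p.2, p.1)) by exact/measurable_fun_pair.
split; [exact: cmeas_cst|exact: cmeas_cst| |exact: ms|].
  by have := transports_swap m m; apply: transports_eq => p //=; rewrite nsq1.
by split=> [[p q]|[p q]|p] //=; rewrite mulr1.
Qed.

Lemma f23_valid : wvalid m4 f23w.
Proof.
have ms : measurable_fun setT (fun p : (T * T) * (T * T) => ((p.1.1, p.2.1), (p.1.2, p.2.2))).
  apply/measurable_fun_pair; apply/measurable_fun_pair; first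
  [ exact: (measurableT_comp measurable_fst measurable_fst)
  | exact: (measurableT_comp measurable_fst measurable_snd)
  | exact: (measurableT_comp measurable_snd measurable_fst)
  | exact: (measurableT_comp measurable_snd measurable_snd)].
split; [exact: cmeas_cst|exact: cmeas_cst| |exact: ms|]; last first.
  by split=> [[[? ?] [? ?]]|[[? ?] [? ?]]|p] //=; rewrite mulr1.
suff : transports m4 m4 (fun=> 1) (wT f23w) by apply: transports_eq => p //=; rewrite nsq1.
split; [exact: measurable_cst|by []|exact: ms|].
by move=> h mh h0; under eq_integral do rewrite mul1e; exact: integral_middle4.
Qed.

End swaps.

(** * Conjugation by weighted compositions *)

Section conjugation.
Context (R : realType) d (X : measurableType d) (mu : {sigma_finite_measure set X -> \bar R}).

Lemma op_eq_comp3 (A A' B B' C C' : op R X) : bounded_op mu A' -> bounded_op mu B -> bounded_op mu B' ->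
  bounded_op mu C -> bounded_op mu C' -> op_eq mu A A' -> op_eq mu B B' -> op_eq mu C C' ->
  op_eq mu (A \o B \o C) (A' \o B' \o C').
Proof.
move=> bA' bB bB' bC bC' hA hB hC.
exact (op_eq_comp (bop_comp bA' bB') bC bC' (op_eq_comp bA' bB bB' hA hB) hC).
Qed.

Definition wconj (W : wc R X) (A : op R X) : op R X := wact W \o A \o wact (winv W).

Lemma wconj_comp (W V : wc R X) A : wconj (wcomp W V) A = wconj W (wconj V A).
Proof. by rewrite /wconj winv_comp !wact_comp. Qed.

Section valid.
Context (W : wc R X) (vW : wvalid mu W).

Let bW : bounded_op mu (wact W). Proof. exact: wact_bop. Qed.
Let bW' : bounded_op mu (wact (winv W)). Proof. exact/wact_bop/wvalid_inv. Qed.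

Lemma bop_wconj A : bounded_op mu A -> bounded_op mu (wconj W A).
Proof. by move=> bA; exact (bop_comp (bop_comp bW bA) bW'). Qed.

Lemma wconj_eq A B : bounded_op mu A -> bounded_op mu B -> op_eq mu A B ->
  op_eq mu (wconj W A) (wconj W B).
Proof.
move=> bA bB AB.
exact (op_eq_comp3 bW bA bB bW' bW' (@op_eq_refl _ _ _ mu _) AB (@op_eq_refl _ _ _ mu _)).
Qed.

Lemma wconj_mul A B : bounded_op mu A -> bounded_op mu B ->
  op_eq mu (wconj W (A \o B)) (wconj W A \o wconj W B).
Proof.
move=> bA bB f Lf /=; rewrite /wconj /=.
have Lf' := bop_L2 bW' Lf; have LB := bop_L2 bB Lf'.
have [_ _ _ u] := wact_unitary vW.
have LL : L2 mu (wact (winv W) (wact W (B (wact (winv W) f)))) := bop_L2 bW' (bop_L2 bW LB).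
apply: (bop_ae bW); [exact: bop_L2|exact: bop_L2|].
apply: (bop_ae bA) => //; apply: ae_equal_sym; exact: u.
Qed.

(** The way in which operators are shown to be fixed by conjugations below. *)
Lemma wconj_commute A : bounded_op mu A -> op_eq mu (A \o wact W) (wact W \o A) ->
  op_eq mu (wconj W A) A.
Proof.
move=> bA AW f Lf; rewrite /wconj /=; have Lf' := bop_L2 bW' Lf.
apply: ae_equal_trans (ae_equal_sym (AW _ Lf')) _ => /=.
have [_ _ u _] := wact_unitary vW.
by apply: (bop_ae bA) => //; [exact: bop_L2|exact: u].
Qed.

Lemma wconjVK A : bounded_op mu A -> op_eq mu (wconj (winv W) (wconj W A)) A.
Proof.
move=> bA f Lf; rewrite /wconj /=.
have [_ _ _ u] := wact_unitary vW.
have -> : wact (winv (winv W)) f = wact W f by [].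
have LW := bop_L2 bW Lf; have L1 := bop_L2 bW' LW.
apply: ae_equal_trans (u _ (bop_L2 bA L1)) _ => /=.
by apply: (bop_ae bA) => //; exact: u.
Qed.

End valid.

Lemma wconj_fixV W A : wvalid mu W -> bounded_op mu A -> op_eq mu (wconj W A) A ->
  op_eq mu (wconj (winv W) A) A.
Proof.
move=> vW bA h; apply: op_eq_trans (wconjVK vW bA); apply: op_eq_sym.
by apply: wconj_eq => //; [exact: wvalid_inv|exact: bop_wconj].
Qed.

Lemma wconj_rep Q W A : rep mu Q W -> bounded_op mu A ->
  op_eq mu (Q \o A \o adj mu Q) (wconj W A).
Proof.
move=> rQ bA; have [QW bQ vW] := rQ; have [QW' bQ' vW'] := rep_adj rQ.
have bW := wact_bop vW; have bWi := wact_bop vW'.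
exact (op_eq_comp3 bW bA bA bQ' bWi QW (@op_eq_refl _ _ _ mu _) QW').
Qed.

Lemma wconj_repV Q W A : rep mu Q W -> bounded_op mu A ->
  op_eq mu (adj mu Q \o A \o Q) (wconj (winv W) A).
Proof.
move=> rQ bA; have [QW bQ vW] := rQ; have [QW' bQ' vW'] := rep_adj rQ.
have bW := wact_bop vW; have bWi := wact_bop vW'.
exact (op_eq_comp3 bWi bA bA bQ bW QW' (@op_eq_refl _ _ _ mu _) QW).
Qed.

End conjugation.

Section conjugation_tens.
Context (R : realType) d1 d2 (X : measurableType d1) (Y : measurableType d2).
Context (mu : {sigma_finite_measure set X -> \bar R}) (nu : {sigma_finite_measure set Y -> \bar R}).
Context (e : nat -> cfun R X) (e' : nat -> cfun R Y) (eP : onb mu e) (eP' : onb nu e').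
Local Notation T := (tens mu nu).
Local Notation munu := (sprod mu nu).

Lemma tens_mul A A' B B' : bounded_op mu A -> bounded_op mu A' -> bounded_op nu B -> bounded_op nu B' ->
  op_eq munu (T A B \o T A' B') (T (A \o A') (B \o B')).
Proof. by move=> bA bA' bB bB'; exact (op_eq_sym (tens_comp eP eP' bA bA' bB bB')). Qed.

Lemma tens_mul3 A A' A'' B B' B'' : bounded_op mu A -> bounded_op mu A' -> bounded_op mu A'' ->
  bounded_op nu B -> bounded_op nu B' -> bounded_op nu B'' ->
  op_eq munu (T A B \o T A' B' \o T A'' B'') (T (A \o A' \o A'') (B \o B' \o B'')).
Proof.
move=> bA bA' bA'' bB bB' bB''.
have b1 := bop_comp bA bA'; have b2 := bop_comp bB bB'.
have b3 := bop_tens eP eP' bA'' bB''; have b4 := bop_tens eP eP' b1 b2.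
apply: (op_eq_trans (op_eq_comp b4 b3 b3 (tens_mul bA bA' bB bB') (@op_eq_refl _ _ _ munu _))).
exact (tens_mul b1 bA'' b2 bB'').
Qed.

Lemma tens_sandwich L L' A B C D C' D' : bounded_op mu A -> bounded_op nu B ->
  bounded_op mu C -> bounded_op nu D -> bounded_op mu C' -> bounded_op nu D' ->
  bounded_op munu L' -> op_eq munu (T C D) L -> op_eq munu (T C' D') L' ->
  op_eq munu (L \o T A B \o L') (T (C \o A \o C') (D \o B \o D')).
Proof.
move=> bA bB bC bD bC' bD' bL' h h'.
have bT := bop_tens eP eP' bA bB; have b1 := bop_tens eP eP' bC bD; have b2 := bop_tens eP eP' bC' bD'.
apply: (op_eq_trans (op_eq_comp3 b1 bT bT bL' b2 (op_eq_sym h) (@op_eq_refl _ _ _ munu _) (op_eq_sym h'))).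
exact (tens_mul3 bC bA bC' bD bB bD').
Qed.

Lemma wconj_tens W V A B : wvalid mu W -> wvalid nu V -> bounded_op mu A -> bounded_op nu B ->
  op_eq munu (wconj (wcomp (wleft Y W) (wright X V)) (T A B)) (T (wconj W A) (wconj V B)).
Proof.
move=> vW vV bA bB; have vWi := wvalid_inv vW; have vVi := wvalid_inv vV.
have vL := wvalid_comp (wvalid_left nu vW) (wvalid_right mu vV).
have h2 : op_eq munu (T (wact (winv W)) (wact (winv V))) (wact (winv (wcomp (wleft Y W) (wright X V)))).
  apply: op_eq_trans (tens_wact eP eP' vWi vVi) _.
  by move=> f Lf; apply: aeW => p _; rewrite /wact /=; congr (_ * _); exact: mulrC.
exact (tens_sandwich bA bB (wact_bop vW) (wact_bop vV) (wact_bop vWi) (wact_bop vVi)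
  (wact_bop (wvalid_inv vL)) (tens_wact eP eP' vW vV) h2).
Qed.

Lemma wconj_left W A B : wvalid mu W -> bounded_op mu A -> bounded_op nu B ->
  op_eq munu (wconj (wleft Y W) (T A B)) (T (wconj W A) B).
Proof.
move=> vW bA bB; have vi := wvalid_inv vW; have i2 := bop_id nu.
exact (tens_sandwich bA bB (wact_bop vW) i2 (wact_bop vi) i2 (wact_bop (wvalid_left nu vi))
  (tens_wact_l eP eP' vW) (tens_wact_l eP eP' vi)).
Qed.

Lemma wconj_right W A B : wvalid nu W -> bounded_op mu A -> bounded_op nu B ->
  op_eq munu (wconj (wright X W) (T A B)) (T A (wconj W B)).
Proof.
move=> vW bA bB; have vi := wvalid_inv vW; have i1 := bop_id mu.
exact (tens_sandwich bA bB i1 (wact_bop vW) i1 (wact_bop vi) (wact_bop (wvalid_right mu vi))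
  (tens_wact_r eP eP' vW) (tens_wact_r eP eP' vi)).
Qed.

Lemma wconj_id W : wvalid mu W -> op_eq mu (wconj W id) id.
Proof. by move=> vW; have [_ _ u _] := wact_unitary vW. Qed.

End conjugation_tens.

(** * The calculus of the quantum double on four legs *)

Section fixed_points.
Context (R : realType) d1 d2 (X : measurableType d1) (Y : measurableType d2).
Context (mu : {sigma_finite_measure set X -> \bar R}) (nu : {sigma_finite_measure set Y -> \bar R}).
Context (e : nat -> cfun R X) (e' : nat -> cfun R Y) (eP : onb mu e) (eP' : onb nu e').

Lemma wconj_left_fix W B : wvalid mu W -> bounded_op nu B ->
  op_eq (sprod mu nu) (wconj (wleft Y W) (tens mu nu id B)) (tens mu nu id B).
Proof.
move=> vW bB; have i1 := bop_id mu.
apply: (op_eq_trans (wconj_left eP eP' vW i1 bB)).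
exact (tens_eq eP eP' (bop_wconj vW i1) i1 bB bB (wconj_id vW) (@op_eq_refl _ _ _ nu _)).
Qed.

Lemma wconj_right_fix W A : wvalid nu W -> bounded_op mu A ->
  op_eq (sprod mu nu) (wconj (wright X W) (tens mu nu A id)) (tens mu nu A id).
Proof.
move=> vW bA; have i2 := bop_id nu.
apply: (op_eq_trans (wconj_right eP eP' vW bA i2)).
exact (tens_eq eP eP' bA bA (bop_wconj vW i2) i2 (@op_eq_refl _ _ _ mu _) (wconj_id vW)).
Qed.

End fixed_points.

Lemma onb_prod_cases (R : realType) d1 d2 (X : measurableType d1) (Y : measurableType d2)
  (e : nat -> cfun R X) (e' : nat -> cfun R Y) k :
  (exists p, onb_prod e e' k = ftens (e p.1) (e' p.2)) \/ onb_prod e e' k = fun=> 0.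
Proof. by rewrite /onb_prod; case: pickle_inv => [p|]; [left; exists p|right]. Qed.

Section four_legs.
Context (R : realType) d (T : measurableType d) (m : {sigma_finite_measure set T -> \bar R}).
Local Notation m2 := (sprod m m).
Local Notation m4 := (sprod m2 m2).
Local Notation f23 := (f23w R T).
Local Notation T2 := (tens m m).
Local Notation T4 := (tens m2 m2).
Context (e : nat -> cfun R T) (eP : onb m e).

Let EP : onb m2 (onb_prod e e). Proof. exact (onb_sprod eP eP). Qed.
Let i1 : bounded_op m id. Proof. exact (bop_id m). Qed.
Let i2 : bounded_op m2 id. Proof. exact (bop_id m2). Qed.
Let bT2 A B (bA : bounded_op m A) (bB : bounded_op m B) : bounded_op m2 (T2 A B).
Proof. exact (bop_tens eP eP bA bB). Qed.
Let bT4 A B (bA : bounded_op m2 A) (bB : bounded_op m2 B) : bounded_op m4 (T4 A B).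
Proof. exact (bop_tens EP EP bA bB). Qed.
Let r2 A : op_eq m2 A A. Proof. exact (@op_eq_refl _ _ _ m2 A). Qed.
Let vf : wvalid m4 f23. Proof. exact (f23_valid m). Qed.
Let v12 W (vW : wvalid m2 W) : wvalid m4 (w12 W). Proof. exact (wvalid_left m2 vW). Qed.
Let v34 W (vW : wvalid m2 W) : wvalid m4 (w34 W). Proof. exact (wvalid_right m2 vW). Qed.
Let v24 W (vW : wvalid m2 W) : wvalid m4 (w24 W).
Proof. exact (wvalid_comp (wvalid_comp vf (v34 vW)) vf). Qed.
Lemma flip_tens A B : bounded_op m A -> bounded_op m B ->
  op_eq m2 (wconj (flipw R T) (T2 A B)) (T2 B A).
Proof.
move=> bA bB; have vfl := flip_valid m; have bfl := wact_bop vfl.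
apply: op_eq_sym; apply: (tens_unique eP eP bB bA (bop_wconj vfl (bT2 bA bB))).
move=> f g Lf Lg.
have E (h k : cfun R T) : wact (flipw R T) (ftens h k) = ftens k h.
  by apply/funext => p; rewrite /wact /ftens /= mul1r mulrC.
have -> : wconj (flipw R T) (T2 A B) (ftens f g) = wact (flipw R T) (T2 A B (ftens g f)) by rewrite -(E f g).
rewrite -(E (A g) (B f)); have Lgf := L2_ftens Lg Lf.
exact (bop_ae bfl (bop_L2 (bT2 bA bB) Lgf) (L2_ftens (bop_L2 bA Lg) (bop_L2 bB Lf)) (tensE eP eP bA bB Lg Lf)).
Qed.

Section elementary.
Context (A B C D : op R T) (bA : bounded_op m A) (bB : bounded_op m B)
  (bC : bounded_op m C) (bD : bounded_op m D).

Lemma tens4E f g h k : L2 m f -> L2 m g -> L2 m h -> L2 m k ->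
  ae_equal m4 (T4 (T2 A B) (T2 C D) (ftens (ftens f g) (ftens h k)))
    (ftens (ftens (A f) (B g)) (ftens (C h) (D k))).
Proof.
move=> Lf Lg Lh Lk; have L1 := L2_ftens Lf Lg; have L2' := L2_ftens Lh Lk.
apply: (ae_equal_trans (tensE EP EP (bT2 bA bB) (bT2 bC bD) L1 L2')).
exact (ftens_ae (bop_L2 (bT2 bA bB) L1) (L2_ftens (bop_L2 bA Lf) (bop_L2 bB Lg))
  (bop_L2 (bT2 bC bD) L2') (L2_ftens (bop_L2 bC Lh) (bop_L2 bD Lk))
  (tensE eP eP bA bB Lf Lg) (tensE eP eP bC bD Lh Lk)).
Qed.

End elementary.

(** The basis of the four-fold product consists of four-fold elementary
    tensors. *)
Lemma tens4_ext (W W' : op R ((T * T) * (T * T))%type) : bounded_op m4 W -> bounded_op m4 W' ->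
  (forall f g h k, L2 m f -> L2 m g -> L2 m h -> L2 m k ->
    ae_equal m4 (W (ftens (ftens f g) (ftens h k))) (W' (ftens (ftens f g) (ftens h k)))) ->
  op_eq m4 W W'.
Proof.
move=> bW bW' h; apply: (op_eq_onb (onb_sprod EP EP) bW bW') => j.
have [[p ->]|->] := onb_prod_cases (onb_prod e e) (onb_prod e e) j.
  have [f [g [Lf Lg ->]]] := onb_prod_ftens eP eP p.1.
  by have [f' [g' [Lf' Lg' ->]]] := onb_prod_ftens eP eP p.2; exact: h.
exact (ae_equal_trans (bop_0 bW) (ae_equal_sym (bop_0 bW'))).
Qed.

Lemma flip23_tens4 A B C D : bounded_op m A -> bounded_op m B -> bounded_op m C -> bounded_op m D ->
  op_eq m4 (wconj f23 (T4 (T2 A B) (T2 C D))) (T4 (T2 A C) (T2 B D)).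
Proof.
move=> bA bB bC bD; have bT := bT4 (bT2 bA bB) (bT2 bC bD); have bf := wact_bop vf.
apply: (tens4_ext (bop_wconj vf bT) (bT4 (bT2 bA bC) (bT2 bB bD))).
move=> f g h k Lf Lg Lh Lk.
have E (k1 k2 k3 k4 : cfun R T) : wact f23 (ftens (ftens k1 k2) (ftens k3 k4)) = ftens (ftens k1 k3) (ftens k2 k4).
  by apply/funext => p; rewrite /wact /ftens /=; ring.
apply: (ae_equal_trans _ (ae_equal_sym (tens4E bA bC bB bD Lf Lg Lh Lk))).
have -> : wconj f23 (T4 (T2 A B) (T2 C D)) (ftens (ftens f g) (ftens h k)) =
    wact f23 (T4 (T2 A B) (T2 C D) (ftens (ftens f h) (ftens g k))) by rewrite -(E f g h k).
rewrite -(E (A f) (B h) (C g) (D k)); have h4 := tens4E bA bB bC bD Lf Lh Lg Lk.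
apply: (bop_ae bf _ _ h4).
  exact (bop_L2 bT (L2_ftens (L2_ftens Lf Lh) (L2_ftens Lg Lk))).
exact (L2_ftens (L2_ftens (bop_L2 bA Lf) (bop_L2 bB Lh)) (L2_ftens (bop_L2 bC Lg) (bop_L2 bD Lk))).
Qed.

Lemma flip23_tens_r C D : bounded_op m C -> bounded_op m D ->
  op_eq m4 (wconj f23 (T4 id (T2 C D))) (T4 (T2 id C) (T2 id D)).
Proof.
move=> bC bD; have bCD := bT2 bC bD; have bI := bT2 i1 i1.
apply: (op_eq_trans _ (flip23_tens4 i1 i1 bC bD)).
apply: (wconj_eq vf (bT4 i2 bCD) (bT4 bI bCD)).
exact (tens_eq EP EP i2 bI bCD bCD (op_eq_sym (tens_id eP eP)) (r2 _)).
Qed.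

Lemma flip23_tens_l A B : bounded_op m A -> bounded_op m B ->
  op_eq m4 (wconj f23 (T4 (T2 A B) id)) (T4 (T2 A id) (T2 B id)).
Proof.
move=> bA bB; have bAB := bT2 bA bB; have bI := bT2 i1 i1.
apply: (op_eq_trans _ (flip23_tens4 bA bB i1 i1)).
apply: (wconj_eq vf (bT4 bAB i2) (bT4 bAB bI)).
exact (tens_eq EP EP bAB bAB i2 bI (r2 _) (op_eq_sym (tens_id eP eP))).
Qed.

Section third_leg.
Context (b : op R T) (bb : bounded_op m b).
Local Notation b3 := (T4 id (T2 b id)).
Local Notation b2 := (T4 (T2 id b) id).

Let bb1 : bounded_op m2 (T2 b id). Proof. exact (bT2 bb i1). Qed.
Let bb2 : bounded_op m2 (T2 id b). Proof. exact (bT2 i1 bb). Qed.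
Let bb3 : bounded_op m4 b3. Proof. exact (bT4 i2 bb1). Qed.
Let bb4 : bounded_op m4 b2. Proof. exact (bT4 bb2 i2). Qed.

Lemma flip23_b3 : op_eq m4 (wconj f23 b3) b2.
Proof.
apply: (op_eq_trans (flip23_tens_r bb i1)).
exact (tens_eq EP EP bb2 bb2 (bT2 i1 i1) i2 (r2 _) (tens_id eP eP)).
Qed.

Lemma flip23_b2 : op_eq m4 (wconj f23 b2) b3.
Proof.
apply: (op_eq_trans (wconj_eq vf bb4 (bop_wconj vf bb3) (op_eq_sym flip23_b3))).
exact (wconjVK vf bb3).
Qed.

Lemma wconj_w12_b3 W : wvalid m2 W -> op_eq m4 (wconj (w12 W) b3) b3.
Proof. by move=> vW; exact (wconj_left_fix EP EP vW bb1). Qed.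

Lemma wconj_w24_b3 W : wvalid m2 W -> op_eq m4 (wconj (w24 W) b3) b3.
Proof.
move=> vW; rewrite /w24 !wconj_comp.
apply: (op_eq_trans (wconj_eq vf (bop_wconj (v34 vW) (bop_wconj vf bb3)) (bop_wconj (v34 vW) bb4)
  (wconj_eq (v34 vW) (bop_wconj vf bb3) bb4 flip23_b3))).
apply: (op_eq_trans (wconj_eq vf (bop_wconj (v34 vW) bb4) bb4 (wconj_right_fix EP EP vW bb2))).
exact flip23_b2.
Qed.

End third_leg.

End four_legs.

Section quantum_double_calculus.
Context (R : realType) d (T : measurableType d) (m : {sigma_finite_measure set T -> \bar R}).
Local Notation m2 := (sprod m m).
Local Notation m4 := (sprod m2 m2).
Local Notation f23 := (f23w R T).
Local Notation T2 := (tens m m).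
Local Notation T4 := (tens m2 m2).
Context (e : nat -> cfun R T) (eP : onb m e).
(* Only the form of the four operators is used here, so that the two identities
   that depend on their weights remain as hypotheses on [a]. *)
Context (U Y X Z : op R (T * T)%type) (u y x z : wc R (T * T)).
Hypotheses (rU : rep m2 U u) (rY : rep m2 Y y) (rX : rep m2 X x) (rZ : rep m2 Z z).

Local Notation leg12 W := (T4 W id).
Local Notation leg34 W := (T4 id W).
Local Notation leg13 W := (wact f23 \o leg12 W \o wact f23).
Local Notation leg24 W := (wact f23 \o leg34 W \o wact f23).
Local Notation rho' := (fun b : op R T => T2 b id).
Local Notation rho := (fun a : op R T => Z \o T2 id a \o adj m2 Z).
Local Notation Delta a := (U \o T2 a id \o adj m2 U).
Local Notation Deltahat b := (adj m2 X \o T2 id b \o X).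
Local Notation V := (leg12 Z \o leg24 Y \o adj m4 (leg12 Z) \o leg13 X).
Local Notation DeltaD c := (adj m4 V \o leg34 c \o V).

Definition double_w := wcomp (wcomp (wcomp (w12 z) (w24 y)) (winv (w12 z))) (w13 x).
(** [Z \otimes Z], for the grouping of the legs into two copies of the double. *)
Definition double_q := wcomp (w12 z) (w34 z).

(** The word [Y_24 Z_34^* Z_12^* V_D^* Z_34].  The equality
    [Delta_D (pi a) = (pi \otimes pi) (Delta a)] says that conjugation by it fixes
    [a] in the fourth leg, provided that [Delta a = Y^* (1 \otimes a) Y]. *)
Definition double_intertwiner := wcomp (w24 y) (wcomp (winv double_q) (wcomp (winv double_w) (w34 z))).

(** The word [Y U Sigma].  The equality [Delta a = Y^* (1 \otimes a) Y] says that
    conjugation by it fixes [1 \otimes a]. *)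
Definition comult_intertwiner := wcomp y (wcomp u (flipw R T)).

Let EP : onb m2 (onb_prod e e). Proof. exact (onb_sprod eP eP). Qed.
Let i1 : bounded_op m id. Proof. exact (bop_id m). Qed.
Let i2 : bounded_op m2 id. Proof. exact (bop_id m2). Qed.
Let bT2 A B (bA : bounded_op m A) (bB : bounded_op m B) : bounded_op m2 (T2 A B).
Proof. exact (bop_tens eP eP bA bB). Qed.
Let bT4 A B (bA : bounded_op m2 A) (bB : bounded_op m2 B) : bounded_op m4 (T4 A B).
Proof. exact (bop_tens EP EP bA bB). Qed.
Let r2 A : op_eq m2 A A. Proof. exact (@op_eq_refl _ _ _ m2 A). Qed.
Let vu : wvalid m2 u. Proof. by case: rU. Qed.
Let vy : wvalid m2 y. Proof. by case: rY. Qed.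
Let vx : wvalid m2 x. Proof. by case: rX. Qed.
Let vz : wvalid m2 z. Proof. by case: rZ. Qed.
Let vf : wvalid m4 f23. Proof. exact (f23_valid m). Qed.
Let v12 W (vW : wvalid m2 W) : wvalid m4 (w12 W). Proof. exact (wvalid_left m2 vW). Qed.
Let v34 W (vW : wvalid m2 W) : wvalid m4 (w34 W). Proof. exact (wvalid_right m2 vW). Qed.
Let v13 W (vW : wvalid m2 W) : wvalid m4 (w13 W).
Proof. exact (wvalid_comp (wvalid_comp vf (v12 vW)) vf). Qed.
Let v24 W (vW : wvalid m2 W) : wvalid m4 (w24 W).
Proof. exact (wvalid_comp (wvalid_comp vf (v34 vW)) vf). Qed.
Let vQ : wvalid m4 double_q. Proof. exact (wvalid_comp (v12 vz) (v34 vz)). Qed.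
Let vV : wvalid m4 double_w.
Proof. exact (wvalid_comp (wvalid_comp (wvalid_comp (v12 vz) (v24 vy)) (wvalid_inv (v12 vz))) (v13 vx)). Qed.

Lemma double_intertwiner_valid : wvalid m4 double_intertwiner.
Proof.
exact (wvalid_comp (v24 vy) (wvalid_comp (wvalid_inv vQ) (wvalid_comp (wvalid_inv vV) (v34 vz)))).
Qed.

Lemma comult_intertwiner_valid : wvalid m2 comult_intertwiner.
Proof. exact (wvalid_comp vy (wvalid_comp vu (flip_valid m))). Qed.

Lemma rep_double : rep m4 V double_w.
Proof.
have rf := rep_wact vf; have r12 := rep_left EP EP rZ.
have r24 := rep_comp (rep_comp rf (rep_right EP EP rY)) rf.
have r13 := rep_comp (rep_comp rf (rep_left EP EP rX)) rf.
exact (rep_comp (rep_comp (rep_comp r12 r24) (rep_adj r12)) r13).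
Qed.

(** The homomorphism is [W |-> W_13]: the flip of the two middle legs sends
    [a \otimes b \otimes 1 \otimes 1] to [(a \otimes 1) \otimes (b \otimes 1)]. *)
Lemma is_tens_hom_pi' : is_tens_hom m m m2 m2 rho' rho' (fun W => wconj f23 (T4 W id)).
Proof.
split; first exact (conj_normal (wact_unitary vf) (amplify_l_normal EP EP)).
by move=> a b ba bb; exact (flip23_tens_l eP ba bb).
Qed.

Lemma tens_hom_pi' W : bounded_op m2 W ->
  op_eq m4 (tens_hom m m m2 m2 rho' rho' W) (wconj f23 (T4 W id)).
Proof. by move=> bW; exact (tens_homE eP eP is_tens_hom_pi' bW). Qed.

Lemma bop_tens_hom_pi' W : bounded_op m2 W -> bounded_op m4 (tens_hom m m m2 m2 rho' rho' W).
Proof. by move=> bW; have [[h _ _ _] _] := tens_homP is_tens_hom_pi'; exact (h W bW). Qed.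

Lemma pi_E a : bounded_op m a -> op_eq m2 (rho a) (wconj z (T2 id a)).
Proof. by move=> ba; exact (wconj_rep rZ (bT2 i1 ba)). Qed.

Lemma bop_pi_ a : bounded_op m a -> bounded_op m2 (rho a).
Proof.
move=> ba; have [_ bZ _] := rZ; have [_ bZ' _] := rep_adj rZ.
exact (bop_comp (bop_comp bZ (bT2 i1 ba)) bZ').
Qed.

(** Here [W_24] is conjugated by [Z_12 Z_34], which acts on each of the two pairs
    of legs as [pi] prescribes. *)
Lemma is_tens_hom_pi_ : is_tens_hom m m m2 m2 rho rho
  (fun W => wconj double_q (wconj f23 (T4 id W))).
Proof.
split.
  exact (conj_normal (wact_unitary vQ) (conj_normal (wact_unitary vf) (amplify_r_normal EP EP))).
move=> a b ba bb; have b1 := bT2 i1 ba; have b2 := bT2 i1 bb.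
apply: (op_eq_trans (wconj_eq vQ (bop_wconj vf (bT4 i2 (bT2 ba bb))) (bT4 b1 b2) (flip23_tens_r eP ba bb))).
apply: (op_eq_trans (wconj_tens EP EP vz vz b1 b2)).
exact (tens_eq EP EP (bop_wconj vz b1) (bop_pi_ ba) (bop_wconj vz b2) (bop_pi_ bb)
  (op_eq_sym (pi_E ba)) (op_eq_sym (pi_E bb))).
Qed.

Lemma tens_hom_pi_ W : bounded_op m2 W ->
  op_eq m4 (tens_hom m m m2 m2 rho rho W) (wconj double_q (wconj f23 (T4 id W))).
Proof. by move=> bW; exact (tens_homE eP eP is_tens_hom_pi_ bW). Qed.

Lemma bop_tens_hom_pi_ W : bounded_op m2 W -> bounded_op m4 (tens_hom m m m2 m2 rho rho W).
Proof. by move=> bW; have [[h _ _ _] _] := tens_homP is_tens_hom_pi_; exact (h W bW). Qed.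

Lemma DeltaDE c : bounded_op m2 c -> op_eq m4 (DeltaD c) (wconj (winv double_w) (T4 id c)).
Proof. by move=> bc; exact (wconj_repV rep_double (bT4 i2 bc)). Qed.

Lemma bop_DeltaD c : bounded_op m2 c -> bounded_op m4 (DeltaD c).
Proof.
move=> bc; have [_ b _] := rep_double; have [_ b' _] := rep_adj rep_double.
exact (bop_comp (bop_comp b' (bT4 i2 bc)) b).
Qed.

Lemma DeltaD_mul c c' : bounded_op m2 c -> bounded_op m2 c' ->
  op_eq m4 (DeltaD (c \o c')) (DeltaD c \o DeltaD c').
Proof.
move=> bc bc'; have vi := wvalid_inv vV; have b1 := bT4 i2 bc; have b2 := bT4 i2 bc'.
apply: (op_eq_trans (DeltaDE (bop_comp bc bc'))).
apply: (op_eq_trans (wconj_eq vi (bT4 i2 (bop_comp bc bc')) (bop_comp b1 b2) (tens_comp EP EP i2 i2 bc bc'))).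
apply: (op_eq_trans (wconj_mul vi b1 b2)); apply: op_eq_sym.
exact (op_eq_comp (bop_wconj vi b1) (bop_DeltaD bc') (bop_wconj vi b2) (DeltaDE bc) (DeltaDE bc')).
Qed.

Section dual_leg.
Context (b : op R T) (bb : bounded_op m b).
Local Notation b3 := (T4 id (T2 b id)).
Local Notation b2 := (T4 (T2 id b) id).

Let bb1 : bounded_op m2 (T2 b id). Proof. exact (bT2 bb i1). Qed.
Let bb2 : bounded_op m2 (T2 id b). Proof. exact (bT2 i1 bb). Qed.
Let bb3 : bounded_op m4 b3. Proof. exact (bT4 i2 bb1). Qed.
Let bb4 : bounded_op m4 b2. Proof. exact (bT4 bb2 i2). Qed.

Lemma bop_Deltahat : bounded_op m2 (Deltahat b).
Proof.
have [_ bX _] := rX; have [_ bX' _] := rep_adj (rX).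
exact (bop_comp (bop_comp bX' bb2) bX).
Qed.

(** [b_3] commutes with [Z_12 Y_24 Z_12^*], so that only [X_13] is left of [V_D] *)
Lemma DeltaD_pi' : op_eq m4 (DeltaD (T2 b id)) (tens_hom m m m2 m2 rho' rho' (Deltahat b)).
Proof.
have vXi := wvalid_inv vx; have bD := bop_Deltahat.
have bw := bop_wconj vXi bb2.
have rhs : op_eq m4 (tens_hom m m m2 m2 rho' rho' (Deltahat b)) (wconj f23 (wconj (w12 (winv x)) b2)).
  apply: (op_eq_trans (tens_hom_pi' bD)).
  apply: (wconj_eq vf (bT4 bD i2) (bop_wconj (v12 vXi) bb4)).
  apply: (op_eq_trans (tens_eq EP EP bD bw i2 i2 (wconj_repV (rX) bb2) (r2 _))).
  exact (op_eq_sym (wconj_left EP EP vXi bb2 i2)).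
apply: (op_eq_trans _ (op_eq_sym rhs)); apply: (op_eq_trans (DeltaDE bb1)).
pose M := wcomp (wcomp (w12 z) (w24 y)) (winv (w12 z)).
have vM : wvalid m4 M := wvalid_comp (wvalid_comp (v12 vz) (v24 vy)) (wvalid_inv (v12 vz)).
have vZi := wvalid_inv (v12 vz).
(* [M] is [Z_12 Y_24 Z_12^*], whose factors do not touch the third leg *)
have fixM : op_eq m4 (wconj M b3) b3.
  rewrite /M (wconj_comp (wcomp (w12 z) (w24 y))) (wconj_comp (w12 z) (w24 y)).
  have h1 := wconj_fixV (v12 vz) bb3 (wconj_w12_b3 eP bb vz).
  have h2 := op_eq_trans (wconj_eq (v24 vy) (bop_wconj vZi bb3) bb3 h1) (wconj_w24_b3 eP bb vy).
  exact (op_eq_trans (wconj_eq (v12 vz) (bop_wconj (v24 vy) (bop_wconj vZi bb3)) bb3 h2) (wconj_w12_b3 eP bb vz)).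
have -> : winv double_w = wcomp (wcomp f23 (wcomp (w12 (winv x)) f23)) (winv M) by [].
rewrite (wconj_comp (wcomp f23 (wcomp (w12 (winv x)) f23)) (winv M)) (wconj_comp f23) (wconj_comp (w12 (winv x))).
have vXi4 := v12 vXi.
have h3 : op_eq m4 (wconj f23 (wconj (winv M) b3)) b2.
  apply: (op_eq_trans (wconj_eq vf (bop_wconj (wvalid_inv vM) bb3) bb3 (wconj_fixV vM bb3 fixM))).
  exact (flip23_b3 eP bb).
have bm := bop_wconj vf (bop_wconj (wvalid_inv vM) bb3).
exact (wconj_eq vf (bop_wconj vXi4 bm) (bop_wconj vXi4 bb4) (wconj_eq vXi4 bm bb4 h3)).
Qed.

End dual_leg.

Section convolution_leg.
Context (a : op R T) (ba : bounded_op m a).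
Hypothesis fix2 : op_eq m2 (wconj comult_intertwiner (T2 id a)) (T2 id a).
Hypothesis fix4 : op_eq m4 (wconj double_intertwiner (T4 id (T2 id a))) (T4 id (T2 id a)).

Let ba2 : bounded_op m2 (T2 id a). Proof. exact (bT2 i1 ba). Qed.
Let ba4 : bounded_op m4 (T4 id (T2 id a)). Proof. exact (bT4 i2 ba2). Qed.

Lemma Delta_Y : op_eq m2 (Delta a) (wconj (winv y) (T2 id a)).
Proof.
have vfl := flip_valid m.
have bai := bT2 ba i1; have bfa := bop_wconj vfl ba2; have bUa := bop_wconj vu bfa.
apply: (op_eq_trans (wconj_rep rU bai)).
apply: (op_eq_trans (wconj_eq vu bai bfa (op_eq_sym (flip_tens eP i1 ba)))).
apply: (op_eq_trans (op_eq_sym (wconjVK vy bUa))).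
apply: (wconj_eq (wvalid_inv vy) (bop_wconj vy bUa) ba2).
by have := fix2; rewrite /comult_intertwiner !wconj_comp.
Qed.

Lemma bop_Delta : bounded_op m2 (Delta a).
Proof.
have [_ bUA _] := rU; have [_ bUA' _] := rep_adj rU.
exact (bop_comp (bop_comp bUA (bT2 ba i1)) bUA').
Qed.

(** Both sides are conjugates of [a_4]; the hypothesis [fix4] is exactly the
    statement that the two conjugating unitaries have the same effect. *)
Lemma DeltaD_pi_ : op_eq m4 (DeltaD (rho a)) (tens_hom m m m2 m2 rho rho (Delta a)).
Proof.
have bD := bop_Delta.
have vVi := wvalid_inv vV; have vYi := wvalid_inv vy; have v24i := wvalid_inv (v24 vy).
have vQi := wvalid_inv vQ.
have bpa := bop_pi_ ba; have bZa := bop_wconj vz ba2; have bYa := bop_wconj vYi ba2.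
have b34 := bop_wconj (v34 vz) ba4; have bV34 := bop_wconj vVi b34.
have bi24 := bop_wconj v24i ba4.
have lhs : op_eq m4 (DeltaD (rho a)) (wconj (winv double_w) (wconj (w34 z) (T4 id (T2 id a)))).
  apply: (op_eq_trans (DeltaDE bpa)); apply: (wconj_eq vVi (bT4 i2 bpa) b34).
  apply: (op_eq_trans (tens_eq EP EP i2 i2 bpa bZa (r2 _) (pi_E ba))).
  exact (op_eq_sym (wconj_right EP EP vz i2 ba2)).
have fa : op_eq m4 (wconj f23 (T4 id (T2 id a))) (T4 id (T2 id a)).
  apply: (op_eq_trans (flip23_tens_r eP i1 ba)).
  exact (tens_eq EP EP (bT2 i1 i1) i2 ba2 ba2 (tens_id eP eP) (r2 _)).
have rhs : op_eq m4 (tens_hom m m m2 m2 rho rho (Delta a)) (wconj double_q (wconj (winv (w24 y)) (T4 id (T2 id a)))).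
  apply: (op_eq_trans (tens_hom_pi_ bD)).
  apply: (wconj_eq vQ (bop_wconj vf (bT4 i2 bD)) bi24).
  have -> : winv (w24 y) = wcomp f23 (wcomp (w34 (winv y)) f23) by [].
  rewrite !wconj_comp.
  apply: (wconj_eq vf (bT4 i2 bD) (bop_wconj (v34 vYi) (bop_wconj vf ba4))).
  apply: (op_eq_trans (tens_eq EP EP i2 i2 bD bYa (r2 _) Delta_Y)).
  apply: (op_eq_trans (op_eq_sym (wconj_right EP EP vYi i2 ba2))).
  exact (wconj_eq (v34 vYi) ba4 (bop_wconj vf ba4) (op_eq_sym fa)).
apply: (op_eq_trans lhs); apply: (op_eq_trans _ (op_eq_sym rhs)).
have bq := bop_wconj vQi bV34; have b24 := bop_wconj (v24 vy) bq.
have key : op_eq m4 (wconj (w24 y) (wconj (winv double_q) (wconj (winv double_w) (wconj (w34 z) (T4 id (T2 id a)))))) (T4 id (T2 id a)).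
  by have := fix4; rewrite /double_intertwiner !(wconj_comp (w24 y)) !(wconj_comp (winv double_q)) !(wconj_comp (winv double_w)).
apply: (op_eq_trans (op_eq_sym (wconjVK vQi bV34))).
apply: (wconj_eq vQ bq bi24).
apply: (op_eq_trans (op_eq_sym (wconjVK (v24 vy) bq))).
exact (wconj_eq v24i b24 ba4 key).
Qed.

Lemma double_comultiplication b : bounded_op m b ->
  op_eq m4 (DeltaD (rho' b \o rho a))
    (tens_hom m m m2 m2 rho' rho' (Deltahat b) \o tens_hom m m m2 m2 rho rho (Delta a)).
Proof.
move=> bb; have b1 : bounded_op m2 (rho' b) := bT2 bb i1; have b2 := bop_pi_ ba.
apply: (op_eq_trans (DeltaD_mul b1 b2)).
exact (op_eq_comp (bop_tens_hom_pi' (bop_Deltahat bb)) (bop_DeltaD b2)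
  (bop_tens_hom_pi_ bop_Delta) (DeltaD_pi' bb) DeltaD_pi_).
Qed.

End convolution_leg.

End quantum_double_calculus.

(** * The structural unitaries as weighted compositions *)

Section legs.
Context (R : realType) (n : nat) (l : R).
Local Notation Rn := 'rV[R]_n.
Local Notation pt := (Rn * Rn * measurableTypeR R)%type.
Local Notation mu1 := (@mu1 R n).
Local Notation mu2 := (@mu2 R n).
Local Notation eta := (eta l).
Local Notation ex r := (expR (l * r)).

(** [jw] and [UAw] transcribe the formulas of [jop] and [UA]; [Yw] and [Zw] are the
    results of multiplying out the words that define [Y] and [Z]. *)
Definition jw : wc R pt :=
  let m (p : pt) := let: (x, y, r) := p in
    polar (ex r ^+ n) (eta (- r) * beta (ex r *: x) (ex r *: y)) in
  let s (p : pt) : pt := let: (x, y, r) := p in (- (ex r *: x), - (ex r *: y), - r) in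
  WC m s m s.

Definition UAw : wc R (pt * pt) :=
  WC (fun p => let: ((x, y, r), (x', y', r')) := p in
       polar ((ex r')^-1 ^+ n) (- (eta r' * beta ((ex r')^-1 *: x) (y' - (ex r')^-1 *: y))))
     (fun p => let: ((x, y, r), (x', y', r')) := p in
       (((ex r')^-1 *: x, (ex r')^-1 *: y, r + r'),
        (x' - (ex r')^-1 *: x, y' - (ex r')^-1 *: y, r')))
     (fun p => let: ((x, y, r), (x', y', r')) := p in
       polar (ex r' ^+ n) (eta r' * beta x y'))
     (fun p => let: ((x, y, r), (x', y', r')) := p in
       ((ex r' *: x, ex r' *: y, r - r'), (x' + x, y' + y, r'))).

Definition Yw : wc R (pt * pt) :=
  WC (fun p => let: ((x, y, r), (x', y', r')) := p in
       ephase (eta r * ex (r' - r) * beta x' y))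
     (fun p => let: ((x, y, r), (x', y', r')) := p in
       ((x + ex (r' - r) *: x', y + ex (r' - r) *: y', r), (x', y', r' - r)))
     (fun p => let: ((x, y, r), (x', y', r')) := p in
       ephase (- (eta r * ex r' * beta x' (y - ex r' *: y'))))
     (fun p => let: ((x, y, r), (x', y', r')) := p in
       ((x - ex r' *: x', y - ex r' *: y', r), (x', y', r' + r))).

Definition Zw : wc R (pt * pt) :=
  WC (fun p => let: ((x, y, r), (x', y', r')) := p in
       polar (ex r ^+ n) (- (eta r * (ex r' * beta x' y - ex r' ^+ 2 * beta x' y' - beta x y' + ex r' * beta x' y'))))
     (fun p => let: ((x, y, r), (x', y', r')) := p in
       ((x + (1 - ex r') *: x', y + (1 - ex r') *: y', r), (ex r *: x', ex r *: y', r')))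
     (fun p => let: ((x, y, r), (x', y', r')) := p in
       polar ((ex r)^-1 ^+ n) (eta r * (ex r)^-1 * (ex r' * beta x' y - beta x y' +
         (1 - ex r') * (ex r)^-1 * beta x' y')))
     (fun p => let: ((x, y, r), (x', y', r')) := p in
       ((x - ((1 - ex r') * (ex r)^-1) *: x', y - ((1 - ex r') * (ex r)^-1) *: y', r),
        ((ex r)^-1 *: x', (ex r)^-1 *: y', r'))).

Lemma exN r : ex (- r) = (ex r)^-1. Proof. by rewrite mulrN expRN. Qed.
Lemma exD r s : ex (r + s) = ex r * ex s. Proof. by rewrite mulrDr expRD. Qed.
Lemma ex_neq0 r : ex r != 0. Proof. by rewrite gt_eqF// expR_gt0. Qed.

Let mx d (T : measurableType d) (f : T -> pt) : measurable_fun setT f ->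
  [/\ measurable_fun setT (fun p => (f p).1.1), measurable_fun setT (fun p => (f p).1.2)
    & measurable_fun setT (fun p => (f p).2)].
Proof.
move=> mf; split; [|
 |exact: (measurableT_comp (measurable_snd) mf)].
  exact: (measurableT_comp measurable_fst (measurableT_comp measurable_fst mf)).
exact: (measurableT_comp measurable_snd (measurableT_comp measurable_fst mf)).
Qed.

Section measurable_coordinates.
Context d (T : measurableType d) (x y x' y' : T -> Rn) (r r' : T -> measurableTypeR R).
Hypotheses (hx : measurable_fun setT x) (hy : measurable_fun setT y) (hr : measurable_fun setT r).
Hypotheses (hx' : measurable_fun setT x') (hy' : measurable_fun setT y') (hr' : measurable_fun setT r').

Lemma measurable_triple : measurable_fun setT (fun p => (x p, y p, r p) : pt).
Proof. by apply/measurable_fun_pair => //; exact/measurable_fun_pair. Qed.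

Lemma measurable_exV : measurable_fun setT (fun p => (ex (r p))^-1).
Proof. by under eq_fun do rewrite -exN; apply: measurable_expRl; exact: measurableT_comp. Qed.

Lemma jw_cmeas : cmeas (fun p => polar (ex (r p) ^+ n) (eta (- r p) * beta (ex (r p) *: x p) (ex (r p) *: y p))).
Proof.
have he : measurable_fun setT (fun p => ex (r p)) by exact: measurable_expRl.
apply: cmeas_polar; first exact: measurable_funX.
apply: measurable_funM; first by apply: measurable_eta; exact: measurableT_comp.
by apply: measurable_beta; exact: mrV_scale.
Qed.

Lemma jw_measurable : measurable_fun setT (fun p => (- (ex (r p) *: x p), - (ex (r p) *: y p))).
Proof.
by apply/measurable_fun_pair; apply: mrV_opp; apply: mrV_scale => //; exact: measurable_expRl.
Qed.

Lemma UAw_cmeas : cmeas (fun p => polar ((ex (r' p))^-1 ^+ n)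
   (- (eta (r' p) * beta ((ex (r' p))^-1 *: x p) (y' p - (ex (r' p))^-1 *: y p)))).
Proof.
have hV : measurable_fun setT (fun p => (ex (r' p))^-1).
  by under eq_fun do rewrite -exN; apply: measurable_expRl; exact: measurableT_comp.
apply: cmeas_polar; first exact: measurable_funX.
apply: measurableT_comp => //; apply: measurable_funM; first exact: measurable_eta.
apply: measurable_beta; first exact: mrV_scale.
by apply: mrV_add => //; apply: mrV_opp; exact: mrV_scale.
Qed.

Lemma UAw_cmeas_inv : cmeas (fun p => polar (ex (r' p) ^+ n) (eta (r' p) * beta (x p) (y' p))).
Proof.
apply: cmeas_polar; first by apply: measurable_funX; exact: measurable_expRl.
by apply: measurable_funM; [exact: measurable_eta|exact: measurable_beta].
Qed.

End measurable_coordinates.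

Lemma wc_ext X (W V : wc R X) : wm W =1 wm V -> wT W =1 wT V -> wn W =1 wn V -> wS W =1 wS V -> W = V.
Proof.
by case: W V => [a b c e] [a' b' c' e'] /= /funext -> /funext -> /funext -> /funext ->.
Qed.

Lemma flipE : @flip R n = wact (flipw R pt).
Proof. by apply/funext => f; apply/funext => -[p q]; rewrite /wact /= mul1r. Qed.

Lemma flip23E : @flip23 R n = wact (f23w R pt).
Proof. by apply/funext => f; apply/funext => -[[? ?] [? ?]]; rewrite /wact /= mul1r. Qed.

Lemma jopE : @jop R n l = wact jw.
Proof.
apply/funext => f; apply/funext => -[[x y] r]; rewrite /jop /Jhatop /Jop /wact /= /polar.
by rewrite rmorphM/= conjCK /ebar ephaseJ opprK mulrA.
Qed.

Lemma UAE : @UA R n l = wact UAw.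
Proof.
apply/funext => f; apply/funext => -[[[x y] r] [[x' y'] r']]; rewrite /UA /wact /= /polar /ebar.
by rewrite mulNr expRN.
Qed.

Lemma jw_valid : wvalid mu1 jw.
Proof.
have [m1 m2 m3] := mx (@measurable_id _ pt setT).
have mT1 := jw_measurable m1 m2 m3.
have mT : measurable_fun setT (wT jw).
  rewrite (_ : wT jw = (fun p => ((- (ex p.2 *: p.1.1), - (ex p.2 *: p.1.2)), - p.2))).
    by apply/measurable_fun_pair; [exact: mT1|exact: measurableT_comp].
  by apply/funext => -[[x y] r].
have mm : cmeas (wm jw).
  have := jw_cmeas m1 m2 m3; congr cmeas; by apply/funext => -[[x y] r].
have TT : cancel (wT jw) (wT jw).
  by move=> [[x y] r] /=; rewrite exN opprK !scalerN !opprK !scalerA mulVf ?ex_neq0// !scale1r.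
split; [exact: mm|exact: mm| |exact: mT|]; last first.
  split; [exact: TT|exact: TT|] => -[[x y] r] /=; rewrite exN polarM -polar1; congr polar.
    by rewrite -exprMn mulfV ?ex_neq0// expr1n.
  by rewrite !betaE opprK etaN; field; exact: ex_neq0.
pose w (q : pt) : R := (`|- ex q.2| ^+ n * `|- ex q.2| ^+ n).
have mw : measurable_fun setT w.
  have h : measurable_fun setT (fun q : pt => `|- ex q.2|).
    apply: measurableT_comp; first exact: normr_measurable.
    by apply: measurableT_comp; [exact: oppr_measurable|exact: measurable_expRl].
  by apply: measurable_funM; exact: measurable_funX.
have h1 : transports mu1 mu1 w (fun q => ((- (ex q.2 *: q.1.1), - (ex q.2 *: q.1.2)), q.2)).
  apply: (@transports_fiber_l _ _ _ _ _ _ _ (sprod (lebesgue_rV R n) (lebesgue_rV R n))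
    (@lebesgue_measure R) (sprod (lebesgue_rV R n) (lebesgue_rV R n)) w _ mw mT1) => r.
  have c0 : - ex r != 0 by rewrite oppr_eq0 ex_neq0.
  have := transports_prod (transports_rV_scale n c0) (transports_rV_scale n c0).
  by apply: transports_eq => -[x y] //=; rewrite !scaleNr.
have h2 : transports mu1 mu1 (fun=> 1) (fun q : pt => (q.1, - q.2)).
  have := transports_prod (transports_id (sprod (lebesgue_rV R n) (lebesgue_rV R n))) (transports_leb_opp R).
  by apply: transports_eq => -[x y] //=; rewrite mulr1.
have := transports_comp h1 h2; apply: transports_eq => -[[x y] r] //=.
by rewrite mulr1 /w nsq_polar /= normrN gtr0_norm ?expR_gt0// expr2.
Qed.

Lemma UAw_valid : wvalid mu2 UAw.
Proof.
have [m1 m2 m3] := mx (@measurable_fst _ _ pt pt).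
have [m1' m2' m3'] := mx (@measurable_snd _ _ pt pt).
have mE : measurable_fun setT (fun p : pt * pt => ex p.2.2) by exact: measurable_expRl.
have mV := measurable_exV m3'.
have mx1 := mrV_scale mV m1; have mx2 := mrV_scale mV m2.
have mT1 := measurable_triple mx1 mx2 (measurable_funD m3 m3').
have mT2 := measurable_triple (mrV_add m1' (mrV_opp m1)) (mrV_add m2' (mrV_opp m2)) m3'.
pose w (q : pt * pt) : R := `|(ex q.2.2)^-1| ^+ n * `|(ex q.2.2)^-1| ^+ n.
have mw : measurable_fun setT w.
  have h : measurable_fun setT (fun q : pt * pt => `|(ex q.2.2)^-1|).
    by apply: measurableT_comp; [exact: normr_measurable|exact: mV].
  by apply: measurable_funM; exact: measurable_funX.
split.
- have := UAw_cmeas m1 m2 m2' m3'; congr cmeas; by apply/funext => -[[[x y] r] [[x' y'] r']].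
- have := UAw_cmeas_inv m1 m2' m3'; congr cmeas; by apply/funext => -[[[x y] r] [[x' y'] r']].
- have h1 : transports mu2 mu2 w (fun p => (((ex p.2.2)^-1 *: p.1.1.1, (ex p.2.2)^-1 *: p.1.1.2, p.1.2 + p.2.2), p.2)).
    apply: (@transports_fiber_l _ _ _ _ _ _ _ mu1 mu1 mu1 w _ mw mT1) => -[[x' y'] r'].
    have c0 : (ex r')^-1 != 0 by rewrite invr_eq0 ex_neq0.
    have := transports_prod (transports_prod (transports_rV_scale n c0) (transports_rV_scale n c0)) (transports_leb_shift r').
    by apply: transports_eq => -[[x y] r] //=; rewrite mulr1.
  have h2 : transports mu2 mu2 (fun=> 1) (fun p => (p.1, (p.2.1.1 - p.1.1.1, p.2.1.2 - p.1.1.2, p.2.2))).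
    have mc : measurable_fun setT (fun _ : pt * pt => 1 : R) by exact: measurable_cst.
    apply: (@transports_fiber_r _ _ _ _ _ _ _ mu1 mu1 mu1 _ _ mc mT2) => -[[x y] r].
    have := transports_prod (transports_prod (transports_rV_shift (- x)) (transports_rV_shift (- y))) (transports_id (@lebesgue_measure R)).
    by apply: transports_eq => -[[x' y'] r'] //=; rewrite !mulr1.
  have := transports_comp h1 h2; apply: transports_eq => -[[[x y] r] [[x' y'] r']] /=.
    by rewrite mulr1 /w nsq_polar /= gtr0_norm ?invr_gt0 ?expR_gt0// expr2.
  by [].
- rewrite (_ : wS _ = fun p => ((ex p.2.2 *: p.1.1.1, ex p.2.2 *: p.1.1.2, p.1.2 - p.2.2),
      (p.2.1.1 + p.1.1.1, p.2.1.2 + p.1.1.2, p.2.2))); last by apply/funext => -[[[x y] r] [[x' y'] r']].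
  apply/measurable_fun_pair.
    exact: (measurable_triple (mrV_scale mE m1) (mrV_scale mE m2) (measurable_funB m3 m3')).
  exact: (measurable_triple (mrV_add m1' m1) (mrV_add m2' m2) m3').
split=> -[[[x y] r] [[x' y'] r']] /=.
- by rewrite !scalerA mulfV ?ex_neq0// !scale1r addrK !subrK.
- by rewrite !scalerA mulVf ?ex_neq0// !scale1r subrK !addrK.
rewrite polarM -polar1; congr polar; first by rewrite -exprMn mulVf ?ex_neq0// expr1n.
by rewrite addNr.
Qed.

Lemma polarE (t : R) : ephase t = polar 1 t. Proof. by rewrite /polar mul1r. Qed.

(** The moduli of the factors cancel, and the phases are compared after expanding
    [beta] and reducing [eta] by its cocycle identity; here and in [ZwE] both the
    operator and its inverse are computed. *)
Lemma YwE : wcomp (wcomp (wcomp (wcomp (flipw R pt) (wleft pt jw)) UAw) (wleft pt jw)) (flipw R pt) = Yw.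
Proof.
apply: wc_ext => -[[[x y] r] [[x' y'] r']] /=; have e0 := ex_neq0 r; have e1 := ex_neq0 r'.
- rewrite !mul1r mulr1 !polarE !polarM; congr polar.
    by rewrite !exD !exN -!exprMn -[RHS](expr1n _ n); congr (_ ^+ _); field; rewrite e0 e1.
  rewrite (_ : - (- r' + r) = r' - r); last by rewrite opprD opprK.
  by rewrite !betaE !(etaN, etaD, exD, exN); field; rewrite e0 e1.
- congr (_, _, _, (_, _, _)); try (apply/rowP => i; rewrite !mxE ?(exD, exN); field; by rewrite ?e0 ?e1).
  by rewrite opprD opprK.
- rewrite !mul1r mulr1 !polarE !polarM; congr polar.
    by rewrite !exD !exN -!exprMn -[RHS](expr1n _ n); congr (_ ^+ _); field; rewrite e0 e1.
  rewrite (_ : - (- r' - r) = r' + r); last by rewrite opprD !opprK.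
  by rewrite !betaE !(etaN, etaD, exD, exN); field; rewrite e0 e1.
- congr (_, _, _, (_, _, _)); try (apply/rowP => i; rewrite !mxE ?(exD, exN); field; by rewrite ?e0 ?e1).
  by rewrite opprD !opprK.
Qed.

Lemma ZwE : wcomp (winv Yw) (wcomp (wcomp (wcomp (wleft pt jw) (wright pt jw)) Yw) (wcomp (wleft pt jw) (wright pt jw))) = Zw.
Proof.
apply: wc_ext => -[[[x y] r] [[x' y'] r']] /=; have e0 := ex_neq0 r; have e1 := ex_neq0 r'.
- rewrite !polarE !polarM; congr polar.
    by rewrite !(exD, exN, invrK, mul1r, mulr1) -!exprMn; congr (_ ^+ _); field; rewrite e0 e1.
  by rewrite !betaE !(etaN, etaD, exD, exN, invrK); field; rewrite e0 e1.
- congr (_, _, _, (_, _, _)); try (apply/rowP => i; rewrite !mxE !(exD, exN, invrK); field; by rewrite ?e0 ?e1).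
  + by rewrite opprK.
  + by rewrite -!opprD !opprK addrK.
- rewrite !polarE !polarM; congr polar.
    by rewrite !(exD, exN, invrK, mul1r, mulr1) -!exprMn; congr (_ ^+ _); field; rewrite e0 e1.
  by rewrite !betaE !(etaN, etaD, exD, exN, invrK); field; rewrite e0 e1.
- congr (_, _, _, (_, _, _)); try (apply/rowP => i; rewrite !mxE !(exD, exN, invrK); field; by rewrite ?e0 ?e1).
  + by rewrite opprK.
  + by rewrite !opprD !opprK addrK.
Qed.

Lemma rep_flip : rep mu2 (@flip R n) (flipw R pt).
Proof. by rewrite flipE; exact/rep_wact/flip_valid. Qed.

Lemma rep_jop : rep mu1 (@jop R n l) jw.
Proof. by rewrite jopE; exact/rep_wact/jw_valid. Qed.

Lemma rep_UA : rep mu2 (@UA R n l) UAw.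
Proof. by rewrite UAE; exact/rep_wact/UAw_valid. Qed.

Context (e : nat -> cfun R pt) (eP : onb mu1 e).

Lemma rep_Y : rep mu2 (@Yop R n l) Yw.
Proof.
rewrite -YwE; have r1 := rep_flip; have rj := rep_left eP eP rep_jop; have rU := rep_UA.
exact: (rep_comp (rep_comp (rep_comp (rep_comp r1 rj) rU) rj) r1).
Qed.

Definition Xw : wc R (pt * pt) := wcomp (wcomp (flipw R pt) (winv Yw)) (flipw R pt).

Lemma rep_X : rep mu2 (@Xop R n l) Xw.
Proof. exact: (rep_comp (rep_comp rep_flip (rep_adj rep_Y)) rep_flip). Qed.

Lemma rep_Z : rep mu2 (@Zop R n l) Zw.
Proof.
rewrite -ZwE; have rj := rep_tens eP eP rep_jop rep_jop.
exact: (rep_comp (rep_adj rep_Y) (rep_comp (rep_comp rj rep_Y) rj)).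
Qed.

End legs.

(** * Fibrewise operators and Young's inequality *)

Section fibrewise_operators.
Context (R : realType) d1 d2 (X : measurableType d1) (Y : measurableType d2).
Context (mu : {sigma_finite_measure set X -> \bar R}) (nu : {sigma_finite_measure set Y -> \bar R}).

Lemma ae_sprod_eq (f g : cfun R (X * Y)%type) : L2 (sprod mu nu) f -> L2 (sprod mu nu) g ->
  {ae mu, forall x, ae_equal nu (fun y => f (x, y)) (fun y => g (x, y))} ->
  ae_equal (sprod mu nu) f g.
Proof.
move=> Lf Lg h; have := ae_sprod_L2 (L2B Lf Lg).
have h' : {ae mu, forall x, ae_equal nu (fun y => f (x, y) - g (x, y)) (fun=> 0)}.
  by apply: filterS h => x; apply: filterS => y + t; move=> ->//; rewrite subrr.
by move=> /(_ h'); apply: filterS => p + t; move=> /(_ t) /eqP; rewrite subr_eq0 => /eqP.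
Qed.

(** [1 \otimes A] when [A] is given by a formula that makes sense for
    functions, not only for their classes modulo null sets ([tens_fiber]). *)
Definition fiber (A : op R Y) : op R (X * Y)%type := fun f p => A (fun y => f (p.1, y)) p.2.

(** The condition under which [fiber A] maps measurable functions to measurable
    ones. *)
Definition parametric (A : op R Y) := forall d (S : measurableType d) (k : cfun R (S * Y)%type),
  cmeas k -> cmeas (fun p => A (fun y => k (p.1, y)) p.2).

Context (A : op R Y) (pA : parametric A) (bA : bounded_op nu A).

Lemma bop_fiber : bounded_op (sprod mu nu) (fiber A).
Proof.
have [C C0 hC] := bopP bA.
have key f : L2 (sprod mu nu) f -> (enorm2 (sprod mu nu) (fiber A f) <= C%:E * enorm2 (sprod mu nu) f)%E.
  move=> Lf; have mf := L2_cmeas Lf; have mF : cmeas (fiber A f) by exact: pA.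
  rewrite !enorm2_sprod// -ge0_integralZl_EFin//; last 2 first.
  - by move=> x _; exact: enorm2_ge0.
  - exact: measurable_enorm2_slice.
  apply: ae_ge0_le_integral => //.
  - by move=> x _; exact: enorm2_ge0.
  - exact: measurable_enorm2_slice.
  - by move=> x _; rewrite mule_ge0 ?lee_fin// enorm2_ge0.
  - by apply: measurable_funeM; exact: measurable_enorm2_slice.
  have := L2_slice Lf; apply: filterS => x Lx _; rewrite /fiber /=.
  by rewrite !enorm2E//; [rewrite -EFinM lee_fin; exact: hC|exact: bop_L2].
have LF f : L2 (sprod mu nu) f -> L2 (sprod mu nu) (fiber A f).
  move=> Lf; apply/L2P; split; first by apply: pA; exact: (L2_cmeas Lf).
  by apply: le_lt_trans (key f Lf) _; rewrite enorm2E// -EFinM ltry.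
apply: (@bop_intro _ _ _ _ _ C) => //.
- move=> a f g Lf Lg; apply: ae_sprod_eq.
  + by apply: LF; apply: L2D => //; exact: L2Z.
  + by apply: L2D; [apply: L2Z|]; exact: LF.
  have l1 := L2_slice Lf; have l2 := L2_slice Lg.
  by apply: filterS2 l1 l2 => x Lx Lx'; exact: (bop_lin bA a Lx Lx').
- move=> f Lf; have := key f Lf; rewrite !enorm2E//; exact: LF.
Qed.

Lemma tens_fiber e e' : onb mu e -> onb nu e' ->
  op_eq (sprod mu nu) (tens mu nu id A) (fiber A).
Proof.
move=> eP eP'; apply: (tens_unique eP eP') => //; [exact: bop_id|exact: bop_fiber|].
move=> f g Lf Lg; have Lfg := L2_ftens Lf Lg; apply: ae_sprod_eq.
- by apply: bop_L2 Lfg; exact: bop_fiber.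
- by apply: L2_ftens => //; exact: bop_L2.
by apply: aeW => x; rewrite /ftens /fiber /=; exact: bop_Z.
Qed.

End fibrewise_operators.

Lemma parametric_fiber (R : realType) d1 d2 (X : measurableType d1) (Y : measurableType d2) (A : op R Y) :
  parametric A -> parametric (@fiber _ _ _ X Y A).
Proof.
move=> pA d S k mk.
have m1 : measurable_fun setT (fun q : (S * X) * Y => (q.1.1, (q.1.2, q.2))).
  apply/measurable_fun_pair; first exact: (measurableT_comp measurable_fst measurable_fst).
  by apply/measurable_fun_pair => //; exact: (measurableT_comp measurable_snd measurable_fst).
have h := pA _ _ _ (cmeas_comp m1 mk).
have m2 : measurable_fun setT (fun q : S * (X * Y) => ((q.1, q.2.1), q.2.2)).
  apply/measurable_fun_pair; last exact: (measurableT_comp measurable_snd measurable_snd).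
  by apply/measurable_fun_pair => //; exact: (measurableT_comp measurable_fst measurable_snd).
exact: (cmeas_comp m2 h).
Qed.

Section young.
Context (R : realType) d1 d2 (Z : measurableType d1) (E : measurableType d2).
Context (mu : {sigma_finite_measure set Z -> \bar R}) (tau : {sigma_finite_measure set E -> \bar R}).
(* [sg (z, t)] is the translate of [z] by [t]; the kernel is dominated by [g]
   uniformly in [z]. *)
Context (k : cfun R (Z * E)%type) (sg : Z * E -> Z) (g : E -> R).
Hypothesis mk : cmeas k.
Hypothesis msg : measurable_fun setT sg.
Hypothesis tsg : forall t, transports mu mu (fun=> 1) (fun z => sg (z, t)).
Hypothesis mg : measurable_fun setT g.
Hypothesis g0 : forall t, 0 < g t.
Hypothesis kg : forall z t, nsq (k (z, t)) <= g t ^+ 2.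
Hypothesis goo : (\int[tau]_t (g t)%:E < +oo)%E.

Definition conv (f : cfun R Z) : cfun R Z := fun z => cint tau (fun t => k (z, t) * f (sg (z, t))).

Lemma conv_cmeas f : cmeas f -> cmeas (conv f).
Proof.
move=> mf; apply: (cmeas_param_cint tau (k := fun p => k p * f (sg p))).
by apply: cmeasM => //; exact: cmeas_comp msg mf.
Qed.

Let G := fine (\int[tau]_t (g t)%:E).
Let GE : (\int[tau]_t (g t)%:E)%E = G%:E.
Proof. by rewrite fineK// ge0_fin_numE//; apply: integral_ge0 => t _; rewrite lee_fin ltW. Qed.
Let G0 : 0 <= G.
Proof. by rewrite -lee_fin -GE; apply: integral_ge0 => t _; rewrite lee_fin ltW. Qed.

Let N f z := (\int[tau]_t (g t * nsq (f (sg (z, t))))%:E)%E.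

Let N0 f z : (0 <= N f z)%E.
Proof. by apply: integral_ge0 => t _; rewrite lee_fin mulr_ge0 ?nsq_ge0// ltW. Qed.

Let mN0 f : cmeas f -> measurable_fun setT (fun p : Z * E => (g p.2 * nsq (f (sg p)))%:E).
Proof.
move=> mf; apply/measurable_EFinP; apply: measurable_funM; first exact: measurableT_comp.
by apply: measurable_nsq; exact: cmeas_comp msg mf.
Qed.

Let mN f : cmeas f -> measurable_fun setT (N f).
Proof.
move=> mf; apply: (measurable_inner_integral tau (mN0 mf)) => p.
by rewrite lee_fin mulr_ge0 ?nsq_ge0// ltW.
Qed.

Let intN f : cmeas f -> (\int[mu]_z N f z = G%:E * enorm2 mu f)%E.
Proof.
move=> mf; have h0 (p : Z * E) : (0 <= (g p.2 * nsq (f (sg p)))%:E)%E.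
  by rewrite lee_fin mulr_ge0 ?nsq_ge0// ltW.
rewrite -(integral_sprod mu tau (mN0 mf) h0) /sprod fubini_tonelli2; [|exact: mN0|exact: h0].
rewrite -GE -ge0_integralZr//; [|exact/measurable_EFinP|by move=> t _; rewrite lee_fin ltW|exact: enorm2_ge0].
apply: eq_integral => t _; rewrite /fubini_G /=.
have mf2 : measurable_fun setT (fun z => (nsq (f z))%:E) by exact: measurable_ensq.
have [_ _ mt ht] := tsg t.
have := ht _ mf2 (fun z => _); rewrite /enorm2 => <-; last by move=> z; rewrite lee_fin nsq_ge0.
under [in RHS]eq_integral do rewrite mul1e.
rewrite -ge0_integralZl_EFin//; [by move=> z _; rewrite lee_fin nsq_ge0| |by rewrite ltW].
exact: (measurableT_comp mf2 mt).
Qed.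

Let N_fin f : L2 mu f -> {ae mu, forall z, (N f z < +oo)%E}.
Proof.
move=> Lf; have iN : mu.-integrable setT (N f).
  apply/integrableP; split; first exact: mN (L2_cmeas Lf).
  under eq_integral do rewrite gee0_abs//.
  by rewrite intN ?enorm2E// -?EFinM ?ltry//; exact: (L2_cmeas Lf).
by have := integrable_ae measurableT iN; apply: filterS => x /(_ I); rewrite ge0_fin_numE.
Qed.

(** The factorization [k f = (k / sqrt g) (sqrt g f)] to which Cauchy-Schwarz is
    applied: the first factor is bounded by [sqrt g], the second is square
    integrable in [t] for almost all [z]. *)
Let split_k f z : cmeas f -> (N f z < +oo)%E ->
  exists u v, [/\ L2 tau u, L2 tau v, sqn tau u <= G, (sqn tau v)%:E = N f z &
    forall t, k (z, t) * f (sg (z, t)) = u t * v t].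
Proof.
move=> mf Noo.
pose s t := Num.sqrt (g t).
have s0 t : s t != 0 by rewrite gt_eqF// sqrtr_gt0.
have s2 t : s t ^+ 2 = g t by rewrite sqr_sqrtr// ltW.
have ms : measurable_fun setT s.
  by apply: measurableT_comp => //; apply: continuous_measurable_fun; exact: sqrt_continuous.
have msV : measurable_fun setT (fun t => (s t)^-1).
  rewrite (_ : (fun t => _) = (@powR R ^~ (-1)) \o s); first exact: measurableT_comp.
  by apply/funext => t /=; rewrite powRN powRr1// sqrtr_ge0.
pose u t := ((s t)^-1)%:C%C * k (z, t); pose v t := (s t)%:C%C * f (sg (z, t)).
have mkz : cmeas (fun t => k (z, t)) by exact: cmeas_slice.
have mfz : cmeas (fun t => f (sg (z, t))).
  by apply: (cmeas_slice (k := fun p => f (sg p)) z); exact: cmeas_comp msg mf.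
have mu_ : cmeas u by apply: cmeasM => //; exact: cmeas_real.
have mv_ : cmeas v by apply: cmeasM => //; exact: cmeas_real.
have ub : (enorm2 tau u <= G%:E)%E.
  rewrite -GE; apply: ge0_le_integral => //.
  - by move=> t _; rewrite lee_fin nsq_ge0.
  - exact: measurable_ensq.
  - exact/measurable_EFinP.
  move=> t _; rewrite lee_fin nsqM nsq_real exprVn s2 mulrC ler_pdivrMr// -expr2; exact: kg.
have vb : enorm2 tau v = N f z.
  by apply: eq_integral => t _; rewrite nsqM nsq_real s2.
have Lu : L2 tau u by apply/L2P; split=> //; apply: le_lt_trans ub _; exact: ltry.
have Lv : L2 tau v by apply/L2P; split=> //; rewrite vb.
exists u, v; split=> //.
- by rewrite -lee_fin -enorm2E.
- by rewrite -enorm2E.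
move=> t; rewrite /u /v mulrACA -rmorphM/= mulVf// mul1r//.
Qed.

Lemma conv_integrable f : L2 mu f ->
  {ae mu, forall z, cintegrable tau (fun t => k (z, t) * f (sg (z, t)))}.
Proof.
move=> Lf; have := N_fin Lf; apply: filterS => z hz.
have [u [v [Lu Lv _ _ E1]]] := split_k (L2_cmeas Lf) hz.
by under eq_fun do rewrite E1; exact: cintegrable_mul.
Qed.

(** Young's inequality, in the form of Schur's test: the translations preserve the
    measure, so Tonelli bounds the norm by the integral of [g]. *)
Lemma conv_bop : bounded_op mu conv.
Proof.
have key f : L2 mu f -> (enorm2 mu (conv f) <= (G * G * sqn mu f)%:E)%E.
  move=> Lf; have mf := L2_cmeas Lf.
  apply: (@le_trans _ _ (\int[mu]_z (G%:E * N f z))%E); last first.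
    by rewrite ge0_integralZl_EFin// ?intN// ?enorm2E -?EFinM ?mulrA//; exact: mN.
  apply: ae_ge0_le_integral => //.
  - by move=> z _; rewrite lee_fin nsq_ge0.
  - by apply: measurable_ensq; exact: conv_cmeas.
  - by move=> z _; rewrite mule_ge0 ?lee_fin.
  - by apply: measurable_funeM; exact: mN.
  have := N_fin Lf; apply: filterS => z hz _.
  have [u [v [Lu Lv uG vN E1]]] := split_k mf hz.
  rewrite -vN -EFinM lee_fin /conv; under eq_fun do rewrite E1.
  have -> : cint tau (fun t => u t * v t) = inner tau u (fun t => (v t)^*).
    by congr cint; apply/funext => t; rewrite conjCK.
  apply: le_trans (inner_le Lu (L2J Lv)) _.
  have -> : sqn tau (fun t => (v t)^*) = sqn tau v.
    rewrite !sqnE//; last exact: L2J.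
    by congr fine; apply: eq_integral => t _; rewrite nsq_conj.
  by rewrite ler_wpM2r ?sqn_ge0.
have LC f : L2 mu f -> L2 mu (conv f).
  move=> Lf; apply/L2P; split; first exact: conv_cmeas (L2_cmeas Lf).
  by apply: le_lt_trans (key f Lf) _; exact: ltry.
apply: (@bop_intro _ _ _ _ _ (G * G)) => //.
- by rewrite mulr_ge0.
- move=> a f h Lf Lh; have l1 := conv_integrable Lf; have l2 := conv_integrable Lh.
  apply: filterS2 l1 l2 => z i1 i2 _; rewrite /conv -cintZ// -cintD//; last exact: cintegrableZ.
  by congr cint; apply/funext => t; ring.
- by move=> f Lf; have := key f Lf; rewrite enorm2E ?lee_fin//; exact: LC.
Qed.

End young.

(** * Measurability and decay of Schwartz functions *)

Section countable_factor.

Lemma measurable_countable_factor (R : realType) d (T : measurableType d) (K : countType)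
  (c : T -> K) (h : K -> R) :
  (forall v, measurable (c @^-1` [set v])) -> measurable_fun setT (fun p => h (c p)).
Proof.
move=> mc _ B mB; rewrite setTI.
rewrite (_ : _ @^-1` B = \bigcup_(v : K) (if pselect (B (h v)) then c @^-1` [set v] else set0)).
  apply: countable_bigcupT_measurable; first exact: countableP.
  by move=> v; case: pselect => ?; [exact: mc|exact: measurable0].
apply/seteqP; split=> [p /= Bp|p [v _]] /=; last by case: pselect => //= Bv; move=> ->.
by exists (c p) => //; case: pselect.
Qed.

End countable_factor.

Section continuity_and_measurability.
Context (R : realType) (n : nat).
Local Notation Rn := 'rV[R]_n.
Local Notation V := (Rn * Rn * R)%type.
Local Notation pt := (Rn * Rn * measurableTypeR R)%type.

Lemma rV_norm_le (x : Rn) (c : R) : 0 <= c -> (forall i, `|x ord0 i| <= c) -> `|x| <= c.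
Proof.
move=> c0 h; rewrite [leLHS]/Num.norm/= mx_normrE; apply: bigmax_le => // -[i j] _ /=.
by rewrite (ord1 i); exact: h.
Qed.

Lemma coord_norm_le (x : Rn) i : `|x ord0 i| <= `|x|.
Proof.
rewrite [leRHS]/Num.norm/= mx_normrE.
exact: (@le_bigmax_cond _ _ _ _ (ord0, i) xpredT (fun ij : 'I_1 * 'I_n => `|x ij.1 ij.2|)).
Qed.

Definition grid k (t : R) : int := Num.floor (k.+1%:R * t).
Definition grid_pt k (z : int) : R := z%:~R / k.+1%:R.

Lemma grid_near k t : `|t - grid_pt k (grid k t)| <= k.+1%:R^-1.
Proof.
have /andP[h1 h2] := floor_itv (k.+1%:R * t); rewrite /grid_pt /grid.
have k0 : 0 < k.+1%:R :> R by [].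
move: (Num.floor _) h1 h2 => z h1 h2; rewrite intrD in h2.
move: (k.+1%:R) k0 h1 h2 => u u0 h1 h2.
have -> : t - z%:~R / u = (u * t - z%:~R) / u by field; rewrite gt_eqF.
rewrite normrM normfV (gtr0_norm u0) ger0_norm ?subr_ge0//.
by rewrite ler_pdivrMr// mulVf ?gt_eqF//; rewrite lerBlDr addrC ltW.
Qed.

Lemma measurable_grid k (z : int) : measurable [set t : measurableTypeR R | grid k t = z].
Proof.
have k0 : 0 < k.+1%:R :> R by [].
rewrite (_ : [set _ | _] = `[z%:~R / k.+1%:R, (z + 1)%:~R / k.+1%:R[%classic); first exact: measurable_itv.
apply/seteqP; split=> t /=; rewrite in_itv/= ler_pdivrMr// ltr_pdivlMr// (mulrC t).
  by move=> <-; exact: floor_itv.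
by move=> h; apply/eqP; rewrite floor_eq.
Qed.

Let cell k (p : pt) : 'rV[int]_n * 'rV[int]_n * int :=
  (map_mx (grid k) p.1.1, map_mx (grid k) p.1.2, grid k p.2).

Let corner k (c : 'rV[int]_n * 'rV[int]_n * int) : V :=
  (map_mx (grid_pt k) c.1.1, map_mx (grid_pt k) c.1.2, grid_pt k c.2).

Let measurable_cell_rV k (a : 'rV[int]_n) : measurable [set x : Rn | map_mx (grid k) x = a].
Proof.
rewrite (_ : [set _ | _] = \bigcap_(i : 'I_n) [set x : Rn | grid k (x ord0 i) = a ord0 i]).
  apply: fin_bigcap_measurable => // i _.
  have := @measurable_coor_rV R n i measurableT _ (measurable_grid k (a ord0 i)).
  by rewrite setTI.
apply/seteqP; split=> x /=; first by move=> <- i _ /=; rewrite mxE.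
by move=> h; apply/rowP => i; rewrite mxE; exact: h.
Qed.

Let measurable_cell k c : measurable (cell k @^-1` [set c]).
Proof.
case: c => [[a b] z].
rewrite (_ : _ @^-1` _ = ([set x | map_mx (grid k) x = a] `*` [set x | map_mx (grid k) x = b]) `*` [set t | grid k t = z]).
  apply: measurableX; [apply: measurableX|exact: measurable_grid]; exact: measurable_cell_rV.
by apply/seteqP; split=> -[[x y] t] /=; [case=> <- <- <-|move=> [[/= <- <-] <-]].
Qed.

Let corner_near k (p : V) : `|p - corner k (cell k p)| <= k.+1%:R^-1.
Proof.
have rVc (x : Rn) : `|x - map_mx (grid_pt k) (map_mx (grid k) x)| <= k.+1%:R^-1.
  by apply: rV_norm_le => // i; rewrite !mxE; exact: grid_near.
by rewrite !prod_normE /= !ge_max !rVc grid_near.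
Qed.

(** A continuous function is the pointwise limit of its values at the corners
    of finer and finer grids, each of which is a function of countably many cells. *)
Lemma continuous_measurable_pt (u : V -> R) : (forall p, {for p, continuous u}) ->
  measurable_fun setT (u : pt -> R).
Proof.
move=> cu; apply: (@measurable_fun_cvg _ _ _ _ (fun k p => u (corner k (cell k p)))).
  by move=> k; apply: (measurable_countable_factor (fun c => u (corner k c))) => c; exact: measurable_cell.
move=> p _; apply: (cvg_comp (fun k => corner k (cell k p)) u _ (cu p)).
apply/cvgrPdist_le => /= e e0; near=> k.
apply: le_trans (corner_near k p) _; near: k.
have /cvgrPdist_le/(_ _ e0) := @cvg_harmonic R; apply: filterS => k /=.
by rewrite sub0r normrN ger0_norm.
Unshelve. all: by end_near. Qed.

End continuity_and_measurability.

Section decay.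
Context (R : realType).
Local Notation leb := (@lebesgue_measure R).
Local Notation q := (fun t : R => (oneDsqr t)^-1).

Lemma oneDsqr_pos (t : R) : 0 < oneDsqr t.
Proof. exact: lt_le_trans ltr01 (oneDsqr_ge1 t). Qed.

Lemma q_gt0 (t : R) : 0 < q t. Proof. by rewrite invr_gt0 oneDsqr_pos. Qed.

Lemma measurable_q : measurable_fun setT (q : measurableTypeR R -> R).
Proof. by apply: continuous_measurable_fun; exact: continuous_oneDsqrV. Qed.

(** The half line is known to have integral [pi / 2]; the other half is its
    reflection. *)
Lemma integral_q : (\int[leb]_t (q t)%:E < +oo)%E.
Proof.
pose h (t : R) : \bar R := ((q t)%:E * (\1_`[0%R, +oo[ t)%:E)%E.
have mI : measurable (`[0%R, +oo[%classic : set (measurableTypeR R)) by exact: measurable_itv.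
have mh : measurable_fun setT (h : measurableTypeR R -> \bar R).
  apply: emeasurable_funM; apply/measurable_EFinP; [exact: measurable_q|exact: measurable_indic].
have h0 t : (0 <= h t)%E by apply: mule_ge0; rewrite lee_fin; [exact/ltW/q_gt0|rewrite indicE ler0n].
have hoo : (\int[leb]_t h t < +oo)%E.
  have := integral0y_oneDsqr R; rewrite integral_mkcond => E.
  rewrite (_ : (\int[leb]_t h t)%E = (pi / 2)%:E) ?ltry// -E; apply: eq_integral => t _.
  rewrite patchE /h indicE; by case: ifP; rewrite ?mule1 ?mule0.
have [_ _ mN hN] := transports_leb_opp R.
apply: (@le_lt_trans _ _ (\int[leb]_t (h t + h (- t)%R))%E); last first.
  rewrite ge0_integralD//; last exact: (measurableT_comp mh mN).
  rewrite lte_add_pinfty//; apply: le_lt_trans hoo; rewrite -[leRHS](hN _ mh h0).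
  by rewrite le_eqVlt; apply/orP; left; apply/eqP/eq_integral => t _; rewrite mul1e.
apply: ge0_le_integral => //.
- by apply/measurable_EFinP; exact: measurable_q.
- by apply: emeasurable_funD => //; exact: (measurableT_comp mh mN).
move=> t _; have [t0|t0] := leP 0 t.
  by rewrite -[leLHS]adde0 leeD// /h indicE mem_set ?mule1//= in_itv/= t0.
rewrite -[leLHS]add0e leeD// {1}/h indicE mem_set ?mule1/=; last by rewrite in_itv/= oppr_ge0 ltW.
by rewrite /oneDsqr sqrrN.
Qed.

(** A product, hence integrable over [R^n] by Tonelli, and bounded below by a
    negative power of the norm ([decay_rV_norm]). *)
Definition decay_rV n (x : 'rV[R]_n) : R := \prod_i q (x ord0 i).

Lemma decay_rV_gt0 n (x : 'rV[R]_n) : 0 < decay_rV x.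
Proof. by apply: prodr_gt0 => i _; exact: q_gt0. Qed.

Lemma measurable_decay_rV n : measurable_fun setT (@decay_rV n).
Proof.
apply: measurable_prod => i _.
exact: (measurableT_comp measurable_q (measurable_coor_rV i)).
Qed.

Lemma integral_decay_prod d1 d2 (X : measurableType d1) (Y : measurableType d2)
  (mu : {sigma_finite_measure set X -> \bar R}) (nu : {sigma_finite_measure set Y -> \bar R})
  (a : X -> R) (b : Y -> R) : measurable_fun setT a -> measurable_fun setT b ->
  (forall x, 0 < a x) -> (forall y, 0 < b y) ->
  (\int[mu]_x (a x)%:E < +oo)%E -> (\int[nu]_y (b y)%:E < +oo)%E ->
  (\int[sprod mu nu]_p (a p.1 * b p.2)%:E < +oo)%E.
Proof.
move=> ma mb a0 b0 aoo boo; rewrite integral_sprod; last 2 first.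
- by apply/measurable_EFinP; apply: measurable_funM; exact: measurableT_comp.
- by move=> p; rewrite lee_fin mulr_ge0// ltW.
have bE : (\int[nu]_y (b y)%:E)%E \is a fin_num.
  by rewrite ge0_fin_numE//; apply: integral_ge0 => y _; rewrite lee_fin ltW.
have -> : (fun x => \int[nu]_y (a (x, y).1 * b (x, y).2)%:E)%E = (fun x => (a x)%:E * \int[nu]_y (b y)%:E)%E.
  apply/funext => x; rewrite -ge0_integralZl_EFin//; [by move=> y _; rewrite lee_fin ltW|exact/measurable_EFinP|by rewrite ltW].
rewrite ge0_integralZr//; [|exact/measurable_EFinP|by move=> x _; rewrite lee_fin ltW|by apply: integral_ge0 => y _; rewrite lee_fin ltW].
rewrite lte_mul_pinfty//; first by apply: integral_ge0 => y _; rewrite lee_fin ltW.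
by rewrite ge0_fin_numE//; apply: integral_ge0 => y _; rewrite lee_fin ltW.
Qed.

Lemma integral_decay_rV n : (\int[lebesgue_rV R n]_x (decay_rV x)%:E < +oo)%E.
Proof.
elim: n => [|n IH].
  rewrite /= integral_dirac//; last by apply/measurable_EFinP; exact: measurable_decay_rV.
  by rewrite diracT mul1e ltry.
have [_ _ _ h] := transports_cons R n.
have md : measurable_fun setT (fun x : 'rV[R]_n.+1 => (decay_rV x)%:E).
  by apply/measurable_EFinP; exact: measurable_decay_rV.
rewrite -(h _ md); last by move=> y; rewrite lee_fin ltW// decay_rV_gt0.
have := integral_decay_prod measurable_q (@measurable_decay_rV n) q_gt0 (@decay_rV_gt0 n) integral_q IH.
congr (_ < _)%E; apply: eq_integral => -[t v] _; rewrite mul1e; congr (_%:E).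
rewrite /decay_rV big_ord_recl /cons_rV mxE unlift_none /=; congr (_ * _).
by apply: eq_bigr => i _; rewrite mxE liftK.
Qed.

Context (n : nat).
Local Notation Rn := 'rV[R]_n.
Local Notation V := (Rn * Rn * R)%type.

Lemma schwartz_decay (u : V -> R) m : schwartz u ->
  exists2 C, 0 < C & forall p, `|u p| * (1 + `|p| ^+ 2) ^+ m <= C.
Proof.
move=> /(_ [::])[_ /= h]; have [C hC] := h (2 * m)%N; have [D hD] := h 0%N.
have D0 : 0 <= D by apply: le_trans (hD 0); rewrite mulr_ge0.
have C0 : 0 <= C by apply: le_trans (hC 0); rewrite mulr_ge0// exprn_ge0.
exists (2 ^+ m * (D + C) + 1); first by rewrite ltr_wpDl// mulr_ge0 ?exprn_ge0// addr_ge0.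
move=> p; apply: (@le_trans _ _ (2 ^+ m * (D + C))); last by rewrite lerDl.
have [p1|p1] := leP `|p| 1.
  rewrite mulrC; apply: ler_pM => //.
  - by rewrite lerXn2r ?nnegrE ?addr_ge0 ?exprn_ge0// (_ : 2 = 1 + 1)// lerD2l expr_le1.
  - by apply: le_trans (_ : D <= _); [have := hD p; rewrite expr0 mul1r|rewrite lerDl].
apply: (@le_trans _ _ (`|u p| * (2 * `|p| ^+ 2) ^+ m)).
  rewrite ler_wpM2l// lerXn2r ?nnegrE ?addr_ge0 ?mulr_ge0 ?exprn_ge0//.
  by rewrite mulr_natl mulr2n lerD2r expr_ge1// ltW.
rewrite exprMn -exprM mulrCA ler_wpM2l ?exprn_ge0//.
by apply: (@le_trans _ _ C); [rewrite mulrC; exact: hC|rewrite lerDr].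
Qed.

Lemma decay_rV_norm (x : Rn) (p : R) : `|x| <= p -> (1 + p ^+ 2) ^- n <= decay_rV x.
Proof.
move=> xp; have p0 : 0 <= p := le_trans (normr_ge0 x) xp.
have -> : (1 + p ^+ 2) ^- n = \prod_(i < n) (1 + p ^+ 2)^-1 by rewrite prodr_const card_ord exprVn.
apply: ler_prod => i _; rewrite invr_ge0 addr_ge0 ?exprn_ge0//= lef_pV2 ?posrE ?oneDsqr_pos//.
  rewrite /oneDsqr lerD2l -[leLHS]real_normK ?num_real// lerXn2r ?nnegrE//.
  exact: le_trans (coord_norm_le x i) xp.
Qed.

(** Differentiability gives the continuity that [continuous_measurable_pt]
    requires. *)
Lemma schwartz_c_measurable (f : cfun R (Rn * Rn * measurableTypeR R)%type) : schwartz_c f -> cmeas f.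
Proof.
move=> [s1 s2 _]; split; apply: continuous_measurable_pt => p; apply: differentiable_continuous.
  by have [+ _] := s1 [::]; exact.
by have [+ _] := s2 [::]; exact.
Qed.

Lemma schwartz_c_decay (f : cfun R (Rn * Rn * measurableTypeR R)%type) m : schwartz_c f ->
  exists2 C, 0 < C & forall p : V, nsq (f p) <= (C * (1 + `|p| ^+ 2) ^- m) ^+ 2.
Proof.
move=> [s1 s2 _]; have [C C0 hC] := schwartz_decay m s1; have [D D0 hD] := schwartz_decay m s2.
exists (C + D); first exact: addr_gt0.
move=> p; set w := (1 + `|p| ^+ 2) ^+ m.
have w0 : 0 < w by rewrite exprn_gt0// ltr_pwDl// exprn_ge0.
have h1 : `|complex.Re (f p)| <= C / w by rewrite ler_pdivlMr//; exact: hC.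
have h2 : `|complex.Im (f p)| <= D / w by rewrite ler_pdivlMr//; exact: hD.
apply: (@le_trans _ _ ((C / w) ^+ 2 + (D / w) ^+ 2)).
  rewrite /nsq -[X in X + _]real_normK ?num_real// -[X in _ + X <= _]real_normK ?num_real//.
  by apply: lerD; rewrite lerXn2r// nnegrE divr_ge0// ltW.
rewrite mulrDl sqrrD -addrA lerD2l lerDr mulrn_wge0// mulr_ge0// divr_ge0// ltW//.
Qed.

End decay.

(** * The operators of convolution *)

Lemma conv_parametric (R : realType) d1 d2 (Z : measurableType d1) (E : measurableType d2)
  (tau : {sigma_finite_measure set E -> \bar R}) (k : cfun R (Z * E)%type) (sg : Z * E -> Z) :
  cmeas k -> measurable_fun setT sg -> parametric (conv tau k sg).
Proof.
move=> mk msg d S h mh; rewrite /conv.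
pose H (q : (S * Z) * E) := k (q.1.2, q.2) * h (q.1.1, sg (q.1.2, q.2)).
have m1 : measurable_fun setT (fun q : (S * Z) * E => (q.1.2, q.2)).
  by apply/measurable_fun_pair => //; exact: (measurableT_comp measurable_snd measurable_fst).
have m2 : measurable_fun setT (fun q : (S * Z) * E => (q.1.1, sg (q.1.2, q.2))).
  apply/measurable_fun_pair; first exact: (measurableT_comp measurable_fst measurable_fst).
  exact: (measurableT_comp msg m1).
have mH : cmeas H by apply: cmeasM; [exact: cmeas_comp m1 mk|exact: cmeas_comp m2 mh].
exact: (cmeas_param_cint tau mH).
Qed.

Section concrete_convolutions.
Context (R : realType) (n : nat) (l : R).
Local Notation Rn := 'rV[R]_n.
Local Notation pt := (Rn * Rn * measurableTypeR R)%type.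
Local Notation mu1 := (@mu1 R n).
Local Notation eta := (eta l).
Local Notation ex r := (expR (l * r)).
Local Notation leb := (@lebesgue_measure R).
Local Notation tau := (sprod (lebesgue_rV R n) (lebesgue_rV R n)).

Let fst11 : measurable_fun setT (fun p : pt => p.1.1).
Proof. exact: (measurableT_comp measurable_fst measurable_fst). Qed.
Let fst12 : measurable_fun setT (fun p : pt => p.1.2).
Proof. exact: (measurableT_comp measurable_snd measurable_fst). Qed.
Let fst2 : measurable_fun setT (fun p : pt => p.2).
Proof. exact: measurable_snd. Qed.

Section twisted_convolution.
Context (f : cfun R pt) (sf : schwartz_c f).

Definition kL (p : pt * (Rn * Rn)) : R[i] :=
  f (p.2.1, p.2.2, p.1.2) * ebar (eta p.1.2 * beta p.2.1 (p.1.1.2 - p.2.2)).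

Definition sL (p : pt * (Rn * Rn)) : pt := (p.1.1.1 - p.2.1, p.1.1.2 - p.2.2, p.1.2).

Lemma LopE : Lop l f = conv tau kL sL.
Proof.
apply/funext => xi; apply/funext => -[[x y] r]; rewrite /Lop /conv; congr cint.
by apply/funext => -[a b]; rewrite /kL /sL /=; ring.
Qed.

Section kernel_measurability.
Context d (T : measurableType d) (a b y : T -> Rn) (r : T -> measurableTypeR R).
Hypotheses (ha : measurable_fun setT a) (hb : measurable_fun setT b).
Hypotheses (hy : measurable_fun setT y) (hr : measurable_fun setT r).

Lemma kL_cmeas0 : cmeas (fun p => f (a p, b p, r p) * ebar (eta (r p) * beta (a p) (y p - b p))).
Proof.
apply: cmeasM; first exact: cmeas_comp (measurable_triple ha hb hr) (schwartz_c_measurable sf).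
apply: cmeas_ephase; apply: measurableT_comp; first exact: oppr_measurable.
apply: measurable_funM; first exact: measurable_eta.
by apply: measurable_beta => //; apply: mrV_add => //; exact: mrV_opp.
Qed.

End kernel_measurability.

Let e11 : measurable_fun setT (fun p : pt * (Rn * Rn) => p.1.1.1).
Proof. exact: (measurableT_comp fst11 measurable_fst). Qed.
Let e12 : measurable_fun setT (fun p : pt * (Rn * Rn) => p.1.1.2).
Proof. exact: (measurableT_comp fst12 measurable_fst). Qed.
Let e2 : measurable_fun setT (fun p : pt * (Rn * Rn) => p.1.2).
Proof. exact: (measurableT_comp fst2 measurable_fst). Qed.
Let ea : measurable_fun setT (fun p : pt * (Rn * Rn) => p.2.1).
Proof. exact: (measurableT_comp measurable_fst measurable_snd). Qed.
Let eb : measurable_fun setT (fun p : pt * (Rn * Rn) => p.2.2).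
Proof. exact: (measurableT_comp measurable_snd measurable_snd). Qed.

Lemma kL_cmeas : cmeas kL.
Proof. exact: (kL_cmeas0 ea eb e12 e2). Qed.

Lemma sL_measurable : measurable_fun setT sL.
Proof. exact: (measurable_triple (mrV_add e11 (mrV_opp ea)) (mrV_add e12 (mrV_opp eb)) e2). Qed.

Lemma sL_transports t : transports mu1 mu1 (fun=> 1) (fun p => sL (p, t)).
Proof.
have := transports_prod (transports_prod (transports_rV_shift (- t.1)) (transports_rV_shift (- t.2))) (transports_id leb).
by apply: transports_eq => -[[x y] r] /=; rewrite ?mulr1.
Qed.

(** The integrable function dominating the kernel of [L_f], uniformly in the
    point [p]. *)
Definition gL (C : R) (t : Rn * Rn) : R := C * (decay_rV t.1 * decay_rV t.2).

Lemma gL_measurable C : measurable_fun setT (gL C).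
Proof.
apply: measurable_funM => //; apply: measurable_funM.
  exact: (measurableT_comp (@measurable_decay_rV R n) measurable_fst).
exact: (measurableT_comp (@measurable_decay_rV R n) measurable_snd).
Qed.

Lemma gL_integral C : 0 < C -> (\int[tau]_t (gL C t)%:E < +oo)%E.
Proof.
move=> C0; have md := @measurable_decay_rV R n.
have h := integral_decay_prod md md (@decay_rV_gt0 R n) (@decay_rV_gt0 R n) (integral_decay_rV R n) (integral_decay_rV R n).
have mp : measurable_fun setT (fun t : Rn * Rn => (decay_rV t.1 * decay_rV t.2)%:E).
  apply/measurable_EFinP; apply: measurable_funM.
    exact: (measurableT_comp md measurable_fst).
  exact: (measurableT_comp md measurable_snd).
have p0 (t : Rn * Rn) : (0 <= (decay_rV t.1 * decay_rV t.2)%:E)%E by rewrite lee_fin mulr_ge0// ltW// decay_rV_gt0.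
rewrite (_ : (fun t => _) = (fun t => C%:E * (decay_rV t.1 * decay_rV t.2)%:E)%E); last first.
  by apply/funext => t; rewrite -EFinM.
rewrite ge0_integralZl_EFin//; last exact: ltW.
by rewrite lte_mul_pinfty// lee_fin ltW.
Qed.

Lemma kL_bound : exists2 C, 0 < C & forall p t, nsq (kL (p, t)) <= gL C t ^+ 2.
Proof.
(* one factor [(1 + N ^+ 2) ^- n] for each of the two integration variables *)
have [C C0 hC] := schwartz_c_decay (n + n) sf; exists C => // p [a b].
rewrite /kL /= nsqM nsq_ephase mulr1; apply: le_trans (hC (a, b, p.2)) _.
set N := `|_|; have N0 : 0 <= N by exact: normr_ge0.
have w0 : 0 < 1 + N ^+ 2 by rewrite ltr_pwDl// exprn_ge0.
have [aN bN] : `|a| <= N /\ `|b| <= N.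
  by rewrite /N !prod_normE /= !le_max !lexx ?orbT.
have G0 : 0 <= gL C (a, b) by rewrite /gL !mulr_ge0 ?(ltW C0)// ltW// decay_rV_gt0.
have L0 : 0 <= C / (1 + N ^+ 2) ^+ (n + n) by rewrite divr_ge0 ?exprn_ge0 ?(ltW C0) ?(ltW w0).
rewrite lerXn2r ?nnegrE// /gL /= ler_wpM2l ?(ltW C0)// exprD invfM.
by apply: ler_pM; rewrite ?invr_ge0 ?exprn_ge0 ?(ltW w0)//; exact: decay_rV_norm.
Qed.

Lemma bop_Lop : bounded_op mu1 (Lop l f).
Proof.
have [C C0 hC] := kL_bound; rewrite LopE.
apply: (conv_bop kL_cmeas sL_measurable sL_transports (gL_measurable C) _ hC (gL_integral C0)).
by move=> t; rewrite /gL !mulr_gt0// decay_rV_gt0.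
Qed.

Lemma parametric_Lop : parametric (Lop l f).
Proof. by rewrite LopE; exact: conv_parametric kL_cmeas sL_measurable. Qed.

(** [L_f] acts on one leg of a larger space, of which [rd] reads that leg and [rp]
    replaces it.  The hypotheses say that the change of variables commutes with
    the translations of the leg and that the weight varies along them by the
    quotient of the phases in the kernel of [L_f] at the image point and at the
    point itself. *)
Section commutation.
Context d (Z : measurableType d) (mu : {sigma_finite_measure set Z -> \bar R}).
Context (rd : Z -> pt) (rp : Z -> pt -> Z) (W : wc R Z).
Let sZ (q : Z * (Rn * Rn)) : Z := rp q.1 (sL (rd q.1, q.2)).
Hypothesis mrd : measurable_fun setT rd.
Hypothesis msZ : measurable_fun setT sZ.
Hypothesis tsZ : forall t, transports mu mu (fun=> 1) (fun z => sZ (z, t)).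
Hypothesis vW : wvalid mu W.
Hypothesis WT : forall z t, wT W (sZ (z, t)) = sZ (wT W z, t).
Hypothesis Wr : forall z, (rd (wT W z)).2 = (rd z).2.
Hypothesis Wm : forall z (t : Rn * Rn), wm W (sZ (z, t)) * ebar (eta (rd z).2 * beta t.1 ((rd z).1.2 - t.2)) =
  wm W z * ebar (eta (rd z).2 * beta t.1 ((rd (wT W z)).1.2 - t.2)).

Definition leg_op (A : op R pt) : op R Z := fun xi z => A (fun p => xi (rp z p)) (rd z).

(** The weight is moved under the integral sign, where the hypotheses identify the
    two integrands.  The integral converges at almost every point, hence also at
    the image of almost every point. *)
Lemma Lop_commute : op_eq mu (leg_op (Lop l f) \o wact W) (wact W \o leg_op (Lop l f)).
Proof.
have [C C0 hC] := kL_bound.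
pose kZ (q : Z * (Rn * Rn)) := kL (rd q.1, q.2).
have mkZ : cmeas kZ.
  apply: cmeas_comp kL_cmeas; apply/measurable_fun_pair => //.
  exact: (measurableT_comp mrd measurable_fst).
have g0 t : 0 < gL C t by rewrite /gL !mulr_gt0// decay_rV_gt0.
move=> xi Lxi.
have := conv_integrable mkZ msZ tsZ (gL_measurable C) g0 (fun z => hC (rd z)) (gL_integral C0) Lxi.
have [_ _ tT _ [_ _ mn1]] := vW.
have wp z : 0 < nsq (wm W z).
  rewrite lt_neqAle nsq_ge0 andbT eq_sym; apply/eqP => /nsq_eq0 m0.
  by have := mn1 z; rewrite m0 mul0r => /esym/eqP; rewrite oner_eq0.
move=> /(transports_ae tT wp); apply: filterS => z iz _.
rewrite /= /leg_op LopE /wact /conv -cintZ; last exact: iz.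
congr cint; apply/funext => t; have := Wm z t; have := WT z t.
rewrite /sZ /= => -> E; rewrite mulrA [LHS](_ : _ = (f (t.1, t.2, (rd z).2) * (wm W (sZ (z, t)) * ebar (eta (rd z).2 * beta t.1 ((rd z).1.2 - t.2)))) * xi (rp (wT W z) (sL (rd (wT W z), t)))).
  by rewrite E /kL /= Wr; ring.
by rewrite /kL /sZ /=; ring.
Qed.

End commutation.

End twisted_convolution.

Section group_convolution.
Context (phi : cfun R pt) (sphi : schwartz_c phi).

Definition klam (p : pt * measurableTypeR R) : R[i] :=
  phi (ex (p.1.2 - p.2) *: p.1.1.1, ex (p.1.2 - p.2) *: p.1.1.2, p.2).

Definition slam (p : pt * measurableTypeR R) : pt := (p.1.1, p.1.2 - p.2).

Let e11 : measurable_fun setT (fun p : pt * measurableTypeR R => p.1.1.1).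
Proof. exact: (measurableT_comp fst11 measurable_fst). Qed.
Let e12 : measurable_fun setT (fun p : pt * measurableTypeR R => p.1.1.2).
Proof. exact: (measurableT_comp fst12 measurable_fst). Qed.
Let e2 : measurable_fun setT (fun p : pt * measurableTypeR R => p.1.2).
Proof. exact: (measurableT_comp fst2 measurable_fst). Qed.
Let ed : measurable_fun setT (fun p : pt * measurableTypeR R => p.1.2 - p.2 : measurableTypeR R).
Proof. by apply: measurable_funB => //; exact: measurable_snd. Qed.

Lemma klam_cmeas : cmeas klam.
Proof.
have he := measurable_expRl l ed.
exact: (cmeas_comp (measurable_triple (mrV_scale he e11) (mrV_scale he e12) measurable_snd) (schwartz_c_measurable sphi)).
Qed.

Lemma slam_measurable : measurable_fun setT slam.
Proof.
apply/measurable_fun_pair; last exact: ed.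
exact: (measurableT_comp measurable_fst measurable_fst).
Qed.

Lemma slam_transports t : transports mu1 mu1 (fun=> 1) (fun p => slam (p, t)).
Proof.
have := transports_prod (transports_id tau) (transports_leb_shift (- t)).
by apply: transports_eq => -[[x y] r] /=; rewrite ?mulr1.
Qed.

Lemma klam_bound : exists2 C, 0 < C & forall p t, nsq (klam (p, t)) <= (C * (oneDsqr t)^-1) ^+ 2.
Proof.
have [C C0 hC] := schwartz_c_decay 1 sphi; exists C => // p t.
apply: le_trans (hC _) _; set N := `|_|; have N0 : 0 <= N by exact: normr_ge0.
have w0 : 0 < 1 + N ^+ 2 by rewrite ltr_pwDl// exprn_ge0.
have tN : `|t| <= N by rewrite /N !prod_normE /= !le_max !lexx ?orbT.
rewrite lerXn2r ?nnegrE ?mulr_ge0 ?invr_ge0 ?exprn_ge0 ?(ltW C0) ?(ltW w0) ?(ltW (oneDsqr_pos t))//.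
rewrite ler_wpM2l ?(ltW C0)// expr1 lef_pV2 ?posrE ?oneDsqr_pos//.
by rewrite /oneDsqr lerD2l -[leLHS]real_normK ?num_real// lerXn2r ?nnegrE.
Qed.

(** The substitution [t = r - r'] turns the defining integral, over the variable of
    [xi], into one over the translation parameter. *)
Lemma lamopE xi : cmeas xi -> lamop l phi xi = conv leb klam slam xi.
Proof.
move=> mxi; apply/funext => -[[x y] r]; rewrite /lamop /conv.
have mt : measurable_fun setT (fun t : measurableTypeR R => t) by exact: measurable_id.
have mc (c : Rn) : measurable_fun setT (fun t : measurableTypeR R => c) by exact: measurable_cst.
have he := measurable_expRl l mt.
have m1 : measurable_fun setT (fun t : measurableTypeR R => r - t : measurableTypeR R).
  exact: measurable_funB.
have h1 := cmeas_comp (measurable_triple (mrV_scale he (mc x)) (mrV_scale he (mc y)) m1) (schwartz_c_measurable sphi).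
have h2 := cmeas_comp (measurable_triple (mc x) (mc y) mt) mxi.
have tr : transports leb leb (fun=> 1) (fun t => r - t : measurableTypeR R).
  have c1 : (-1 : R) != 0 by rewrite oppr_eq0 oner_neq0.
  have := transports_leb_affine r c1.
  by apply: transports_eq => t /=; rewrite ?normrN1// mulN1r addrC.
rewrite -(transports_cint tr (cmeasM h1 h2)); congr cint; apply/funext => t.
by rewrite mul1r /klam /slam /= subKr.
Qed.

Lemma bop_lamop : bounded_op mu1 (lamop l phi).
Proof.
have [C C0 hC] := klam_bound.
have mg : measurable_fun setT (fun t : measurableTypeR R => C * (oneDsqr t)^-1).
  by apply: measurable_funM => //; exact: measurable_q.
have g0 t : 0 < C * (oneDsqr t)^-1 by rewrite mulr_gt0// invr_gt0 oneDsqr_pos.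
have goo : (\int[leb]_t (C * (oneDsqr t)^-1)%:E < +oo)%E.
  under eq_integral do rewrite EFinM.
  rewrite ge0_integralZl_EFin//; [|by apply/measurable_EFinP; exact: measurable_q|exact: ltW].
  by rewrite lte_mul_pinfty// ?lee_fin ?(ltW C0)//; exact: integral_q.
have b := conv_bop klam_cmeas slam_measurable slam_transports mg g0 hC goo.
apply: (bop_eq b).
  by move=> xi Lxi; rewrite lamopE; [exact: ae_equal_refl|exact: (L2_cmeas Lxi)].
by move=> xi Lxi; rewrite lamopE; [exact: (bop_L2 b Lxi)|exact: (L2_cmeas Lxi)].
Qed.

End group_convolution.

End concrete_convolutions.

(** * The intertwiners act trivially on the convolution leg *)

Section intertwiners.
Context (R : realType) (n : nat) (l : R).
Local Notation Rn := 'rV[R]_n.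
Local Notation pt := (Rn * Rn * measurableTypeR R)%type.
Local Notation pt4 := ((pt * pt) * (pt * pt))%type.
Local Notation eta := (eta l).
Local Notation ex r := (expR (l * r)).
Local Notation Yw := (@Yw R n l).
Local Notation Zw := (@Zw R n l).
Local Notation Xw := (@Xw R n l).
Local Notation UAw := (@UAw R n l).

Local Notation Dw := (comult_intertwiner UAw Yw).
Local Notation Uw := (double_intertwiner Yw Xw Zw).

Definition rep2 (z : pt * pt) (p : pt) : pt * pt := (z.1, p).
Definition rep4 (z : pt4) (p : pt) : pt4 := (z.1, (z.2.1, p)).

Lemma Dw_T z t : wT Dw (rep2 z (sL (z.2, t))) = rep2 (wT Dw z) (sL ((wT Dw z).2, t)).
Proof.
case: z t => [[[x y] r] [[x' y'] r']] [a b] /=; rewrite /rep2 /sL /=.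
have e0 : ex (r' - r) != 0 by exact: ex_neq0.
congr (_, _, _, (_, _, _)); apply/rowP => i; rewrite !mxE; field; exact: e0.
Qed.

Lemma Dw_r z : (wT Dw z).2.2 = z.2.2.
Proof. by case: z => [[[x y] r] [[x' y'] r']] /=; rewrite addrC subrK. Qed.

(** The word [Y U Sigma] moves the second leg, and its weight varies with it
    accordingly. *)
Lemma Dw_m z (t : Rn * Rn) : wm Dw (rep2 z (sL (z.2, t))) * ebar (eta z.2.2 * beta t.1 (z.2.1.2 - t.2)) =
  wm Dw z * ebar (eta z.2.2 * beta t.1 ((wT Dw z).2.1.2 - t.2)).
Proof.
case: z t => [[[x y] r] [[x' y'] r']] [a b] /=; rewrite /rep2 /sL /= /ebar.
rewrite !polarE !(mul1r, mulr1) -!polarE !polarE !polarM !(mul1r, mulr1); congr polar.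
have e0 := ex_neq0 l r; have e1 := ex_neq0 l r'.
by rewrite !betaE !(etaN, etaD, exD, exN); field; rewrite e0 e1.
Qed.

Lemma Uw_T z t : wT Uw (rep4 z (sL (z.2.2, t))) = rep4 (wT Uw z) (sL ((wT Uw z).2.2, t)).
Proof.
case: z t => [[[[x1 y1] r1] [[x2 y2] r2]] [[[x3 y3] r3] [[x4 y4] r4]]] [a b] /=; rewrite /rep4 /sL /=.
have e1 := ex_neq0 l r1; have e2 := ex_neq0 l r2; have e3 := ex_neq0 l r3; have e4 := ex_neq0 l r4.
congr ((_, _, _, (_, _, _)), (_, _, _, (_, _, _))); apply/rowP => i; rewrite !mxE ?(exD, exN); field;
  by rewrite ?e1 ?e2 ?e3 ?e4.
Qed.

Lemma Uw_rd z : (wT Uw z).2.2 = z.2.2.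
Proof.
case: z => [[[[x1 y1] r1] [[x2 y2] r2]] [[[x3 y3] r3] [[x4 y4] r4]]] /=.
by rewrite subrK !scalerA mulfV ?ex_neq0// !scale1r.
Qed.

(** [etaD] for [r + s] and for [s + r]. *)
Lemma eta_sym (r s : R) : eta r * (ex s ^+ 2 - 1) = eta s * (ex r ^+ 2 - 1).
Proof. by have := etaD l r s; rewrite addrC etaD => E; apply/eqP; rewrite -subr_eq0; apply/eqP; move: E => /eqP; rewrite -subr_eq0 => /eqP <-; ring. Qed.

Lemma beta0l (x : Rn) : beta 0 x = 0. Proof. by rewrite -(scale0r 0) betaZl mul0r. Qed.
Lemma beta0r (x : Rn) : beta x 0 = 0. Proof. by rewrite -(scale0r 0) betaZr mul0r. Qed.

(** The terms of the phase that contain [x4] or [y4] cancel as rational functions,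
    except for a multiple of [beta x4 y2], which vanishes by [eta_sym]. *)
Lemma Uw_m0 p1 p2 p3 (x4 y4 : Rn) (r4 : measurableTypeR R) :
  wm Uw ((p1, p2), (p3, (x4, y4, r4))) = wm Uw ((p1, p2), (p3, (0, 0, r4))).
Proof.
case: p1 p2 p3 => [[x1 y1] r1] [[x2 y2] r2] [[x3 y3] r3] /=.
have e1 := ex_neq0 l r1; have e2 := ex_neq0 l r2; have e3 := ex_neq0 l r3; have e4 := ex_neq0 l r4.
rewrite !polarE !(mul1r, mulr1) !polarM !(mul1r, mulr1); congr polar.
rewrite subrK !(scaler0, subr0, addr0, add0r, beta0l, beta0r, mulr0, mul0r, oppr0).
(* a multiple of [eta_sym] is added to the right-hand side; the multiplier is the
   quotient of the remaining term by the difference of the two sides of [eta_sym] *)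
rewrite -[RHS]addr0 -[X in _ = _ + X](mulr0 (ex r4 / ex r2 / ex r3 ^+ 2 * beta x4 y2)) -[X in _ = _ + _ * X](subrr (eta r2 * (ex r3 ^+ 2 - 1))).
rewrite [X in _ = _ + _ * (_ - X)]eta_sym.
rewrite !betaE !(etaN, etaD, exD, exN).
move: e1 e2 e3 e4 (eta r1) (eta r2) (eta r3).
move: (ex r1) (ex r2) (ex r3) (ex r4) => a1 a2 a3 a4 e1 e2 e3 e4 E1 E2 E3.
move: (beta x1 y1) (beta x1 y2) (beta x1 y3) (beta x1 y4) => b11 b12 b13 b14.
move: (beta x2 y1) (beta x2 y2) (beta x2 y3) (beta x2 y4) => b21 b22 b23 b24.
move: (beta x3 y1) (beta x3 y2) (beta x3 y3) (beta x3 y4) => b31 b32 b33 b34.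
move: (beta x4 y1) (beta x4 y2) (beta x4 y3) (beta x4 y4) => b41 b42 b43 b44.
field.
by rewrite ?e1 ?e2 ?e3 ?e4.
Qed.

Lemma Uw_m z t : wm Uw (rep4 z (sL (z.2.2, t))) = wm Uw z.
Proof.
case: z t => [[p1 p2] [p3 [[x4 y4] r4]]] [a b].
exact: etrans (Uw_m0 p1 p2 p3 (x4 - a) (y4 - b) r4) (esym (Uw_m0 p1 p2 p3 x4 y4 r4)).
Qed.

Section fixed_by_intertwiners.
Local Notation mu1 := (@mu1 R n).
Local Notation mu2 := (@mu2 R n).
Local Notation mu4 := (@mu4 R n).
Local Notation T2 := (tens mu1 mu1).
Local Notation T4 := (tens mu2 mu2).
Context (e : nat -> cfun R pt) (eP : onb mu1 e).
Let EP : onb mu2 (onb_prod e e). Proof. exact (onb_sprod eP eP). Qed.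
Let i1 : bounded_op mu1 id. Proof. exact (bop_id mu1). Qed.
Let i2 : bounded_op mu2 id. Proof. exact (bop_id mu2). Qed.
Context (f : cfun R pt) (sf : schwartz_c f).
Local Notation a := (Lop l f).

Let ba : bounded_op mu1 a. Proof. exact (bop_Lop l sf). Qed.
Let pa : parametric a. Proof. exact (parametric_Lop l sf). Qed.
Let ba2 : bounded_op mu2 (T2 id a). Proof. exact (bop_tens eP eP i1 ba). Qed.
Let ba4 : bounded_op mu4 (T4 id (T2 id a)). Proof. exact (bop_tens EP EP i2 ba2). Qed.

Let bF2 : bounded_op mu2 (fiber a). Proof. exact (bop_fiber mu1 pa ba). Qed.
Let bF4 : bounded_op mu4 (fiber (fiber a)).
Proof. exact (bop_fiber mu2 (parametric_fiber pa) bF2). Qed.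

Let F2 : op_eq mu2 (T2 id a) (fiber a). Proof. exact (tens_fiber pa ba eP eP). Qed.
Let F4 : op_eq mu4 (T4 id (T2 id a)) (fiber (fiber a)).
Proof.
apply: (op_eq_trans (tens_eq EP EP i2 i2 ba2 bF2 (@op_eq_refl _ _ _ mu2 _) F2)).
exact (tens_fiber (parametric_fiber pa) bF2 EP EP).
Qed.

Let msL2 : measurable_fun setT (fun q : (pt * pt) * (Rn * Rn) => rep2 q.1 (sL (q.1.2, q.2))).
Proof.
apply/measurable_fun_pair; first exact: (measurableT_comp measurable_fst measurable_fst).
apply: (measurableT_comp (@sL_measurable R n)); apply/measurable_fun_pair => //.
exact: (measurableT_comp measurable_snd measurable_fst).
Qed.

Let msL4 : measurable_fun setT (fun q : pt4 * (Rn * Rn) => rep4 q.1 (sL (q.1.2.2, q.2))).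
Proof.
have m2 := measurableT_comp (@measurable_snd _ _ (pt * pt)%type (pt * pt)%type) (@measurable_fst _ _ pt4 (Rn * Rn)%type).
apply/measurable_fun_pair; first exact: (measurableT_comp measurable_fst measurable_fst).
apply/measurable_fun_pair; first exact: (measurableT_comp measurable_fst m2).
apply: (measurableT_comp (@sL_measurable R n)); apply/measurable_fun_pair => //.
exact: (measurableT_comp measurable_snd m2).
Qed.

Let tL2 t : transports mu2 mu2 (fun=> 1) (fun z : pt * pt => rep2 z (sL (z.2, t))).
Proof.
have := transports_prod (transports_id mu1) (sL_transports t).
by apply: transports_eq => z /=; rewrite ?mulr1.
Qed.

Let tL4 t : transports mu4 mu4 (fun=> 1) (fun z : pt4 => rep4 z (sL (z.2.2, t))).
Proof.
have := transports_prod (transports_id mu2) (tL2 t).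
by apply: transports_eq => z /=; rewrite ?mulr1.
Qed.

Let vD : wvalid mu2 Dw.
Proof. exact (comult_intertwiner_valid (rep_UA n l) (rep_Y l eP)). Qed.

Let vU : wvalid mu4 Uw.
Proof. exact (double_intertwiner_valid (rep_Y l eP) (rep_X l eP) (rep_Z l eP)). Qed.

Lemma wconj_Dw : op_eq mu2 (wconj Dw (T2 id a)) (T2 id a).
Proof.
apply: (op_eq_trans (wconj_eq vD ba2 bF2 F2)); apply: (op_eq_trans _ (op_eq_sym F2)).
apply: (wconj_commute vD bF2).
exact (Lop_commute sf (@measurable_snd _ _ pt pt) msL2 tL2 vD Dw_T Dw_r Dw_m).
Qed.

Lemma wconj_Uw : op_eq mu4 (wconj Uw (T4 id (T2 id a))) (T4 id (T2 id a)).
Proof.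
apply: (op_eq_trans (wconj_eq vU ba4 bF4 F4)); apply: (op_eq_trans _ (op_eq_sym F4)).
apply: (wconj_commute vU bF4).
have m22 := measurableT_comp (@measurable_snd _ _ pt pt) (@measurable_snd _ _ (pt * pt)%type (pt * pt)%type).
apply: (@Lop_commute R n l f sf _ (pt * pt * (pt * pt))%type mu4 (fun z => z.2.2) (@rep4) Uw m22 msL4 tL4 vU Uw_T).
  by move=> z; rewrite Uw_rd.
by move=> z t; rewrite Uw_m Uw_rd.
Qed.

End fixed_by_intertwiners.

End intertwiners.

(** * The comultiplication of the quantum double *)

Theorem proposition3p8 (R : realType) (n : nat) (l : R)
  (phi f : cfun R ('rV[R]_n * 'rV[R]_n * measurableTypeR R)%type) :
  (1 <= n)%N -> schwartz_c phi -> schwartz_c f ->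
  op_eq (@mu4 R n) (DeltaD l (Pi l phi f))
                  (DeltaD l (pi' (lamop l phi) \o pi_ l (Lop l f))) /\
  op_eq (@mu4 R n) (DeltaD l (pi' (lamop l phi) \o pi_ l (Lop l f)))
                  (tens_hom2 (@pi' R n) (Deltahat l (lamop l phi)) \o
                   tens_hom2 (@pi_ R n l) (Delta l (Lop l f))).
Proof.
move=> _ sphi sf; split; first exact (@op_eq_refl _ _ _ (@mu4 R n) _).
have [e eP] := onb_mu1 R n.
have bb := bop_lamop l sphi; have ba := bop_Lop l sf.
have := double_comultiplication eP (rep_UA n l) (rep_Y l eP) (rep_X l eP) (rep_Z l eP) ba
  (@wconj_Dw R n l e eP f sf) (@wconj_Uw R n l e eP f sf) bb.
by rewrite -flip23E.
Qed.
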